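(* Let $(X_t)$ be a Lévy process on $\mathbb{R}^n$ with $\mathbb{E}[e^{i\langle X_t,u\rangle}]=e^{t\varphi(u)}$, $$\varphi(u)=i\,m\cdot u-\frac12(au)\cdot u+\int_{\mathbb{R}^n\setminus\{0\}}\Big(e^{iu\cdot y}-1-i\frac{u\cdot y}{1+|y|^2}\Big)d\rho(y),$$ and suppose that the diffusion matrix $a$ satisfies, for some $\delta>0$, $\frac12(au)\cdot u\ge\delta|u|^2$ for all $u\in\mathbb{R}^n$. Let $\nu_t$ be the law of $X_t$, so that $\widehat\nu_t(u)=e^{t\varphi(u)}$. Then (the parameter $h$ being replaced by $t$) the family $(\nu_t)$ belongs to $\mathcal M(-\gamma,\mathbb{R}^n)$ whenever $0<\gamma<\delta$. As a consequence, if $0<\varepsilon<4\gamma$, then for each $t>0$ the measure $\nu_t$ has a density $\Phi_t$ with respect to the Lebesgue measure, and $\Phi_t$ has a holomorphic extension to $\mathbb{C}^n$ such that, for some constant $C$ and all $Y\in\mathbb{R}^n$, $$\int_{\mathbb{R}^n}|\Phi_t(X+iY)|\,dX\le C\,e^{\frac1{\varepsilon t}|Y|^2}.$$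
   Context: In the Lévy–Khintchine representation, $m\in\mathbb{R}^n$, $a$ is a positive semidefinite real symmetric $n\times n$ matrix (the diffusion matrix), and $\rho$ is a measure on $\mathbb{R}^n\setminus\{0\}$ with $\int\inf(1,|y|^2)\,d\rho(y)<+\infty$. Here $\nu_t(E)=\mathbb{P}[X_t\in E]$ and $\widehat\nu(u)=\int e^{iu\cdot X}d\nu(X)$. For $\gamma'<0$, $\mathcal M(\gamma',\mathbb{R}^n)$ is the set of families $(\nu_h)_{h>0}$ of bounded measures on $\mathbb{R}^n$ such that $\widehat\nu_h(u)=e^{h\varphi(u)}$, where $\varphi=\varphi_1+\varphi_2$ is a function on $\mathbb{R}^n$ such that: 1. $\varphi_1$ is the symbol of a bounded operator $T$ in $L^\infty(\mathbb{R}^n)$ commuting with translations, i.e. $T(e^{ia\cdot X})=\varphi_1(a)e^{ia\cdot X}$ for every $a\in\mathbb{R}^n$; 2. $\varphi_2\in C^\infty(\mathbb{R}^n)$; for every $\alpha\in\mathbb{N}^n$ there is $A_\alpha>0$ with $|\partial^\alpha\varphi_2(u)|\le A_\alpha(|u|^2+1)$ for all $u$; and ${\rm Re}\,\varphi_2(u)\le\gamma'|u|^2$ for every $u$ large enough. *)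

(* Defs.v *)
From HB Require Import structures.
From mathcomp Require Import all_boot all_order all_algebra.
From mathcomp Require Import all_classical all_reals all_analysis.
From mathcomp Require Import complex.

Set Implicit Arguments.
Unset Strict Implicit.
Unset Printing Implicit Defensive.

Import Order.TTheory GRing.Theory Num.Theory.
Import numFieldNormedType.Exports.

Local Open Scope classical_set_scope.
Local Open Scope ring_scope.
Local Open Scope complex_scope.

(* R[i] as a normed space over itself: differentiability of a function from
   'rV[R[i]]_n to R[i] is then complex (Frechet) differentiability. *)
HB.instance Definition _ (R : realType) :=
  PseudoPointedMetric.copy R[i] (R[i])^o.
HB.instance Definition _ (R : realType) := NormedModule.copy R[i] (R[i])^o.

(* The sigma-algebra on row vectors is the product of the Borel sigma-algebras
   of the coordinates, as the library does for n.-tuple; it coincides with the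
   Borel sigma-algebra of R^n. *)
Definition measure_rV_display : measure_display.
Proof. exact: default_measure_display. Qed.

Section measurable_rV.
Context {R : realType} {n : nat}.

Definition rV_coord (i : 'I_n) (v : 'rV[R]_n) : R := v ord0 i.

Definition rV_measurable : set (set 'rV[R]_n) := g_sigma_preimage rV_coord.

Let rV_measurable0 : rV_measurable set0.
Proof. exact: sigma_algebra0. Qed.

Let rV_measurableC A : rV_measurable A -> rV_measurable (~` A).
Proof. exact: sigma_algebraC. Qed.

Let rV_measurable_bigcup (F : (set 'rV[R]_n)^nat) :
  (forall i, rV_measurable (F i)) -> rV_measurable (\bigcup_i (F i)).
Proof. exact: sigma_algebra_bigcup. Qed.

HB.instance Definition _ := @isMeasurable.Build measure_rV_display
  'rV[R]_n rV_measurable rV_measurable0 rV_measurableC rV_measurable_bigcup.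

Lemma measurable_rV_coord (i : 'I_n) : measurable_fun setT (rV_coord i).
Proof.
move=> _ Y mY; rewrite setTI; apply: sub_sigma_algebra => /=.
rewrite -bigcup_seq/=; exists i => /=; first by rewrite mem_index_enum.
by exists Y => //; rewrite setTI.
Qed.

Lemma measurable_fun_rV d (T : measurableType d) (f : T -> 'rV[R]_n) :
  (forall i, measurable_fun setT (fun x => f x ord0 i)) ->
  measurable_fun setT f.
Proof.
move=> mf; apply: (measurability
  (\big[setU/set0]_(i < n) preimage_set_system setT (rV_coord i) measurable)).
  by [].
rewrite -bigcup_seq => _ [_ [i _ [C mC <-]] <-].
by rewrite !setTI; have := mf i measurableT C mC; rewrite setTI.
Qed.

End measurable_rV.

Section lebesgue_rV.
Context {R : realType}.

Definition rV_cons n (p : R * 'rV[R]_n) : 'rV[R]_n.+1 :=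
  \row_i (if unlift ord0 i is Some j then p.2 ord0 j else p.1).

Definition rV_uncons n (v : 'rV[R]_n.+1) : R * 'rV[R]_n :=
  (v ord0 ord0, \row_j v ord0 (lift ord0 j)).

Lemma rV_consK n : cancel (@rV_cons n) (@rV_uncons n).
Proof.
move=> [x v]; rewrite /rV_uncons mxE unlift_none; congr pair.
by apply/rowP => j; rewrite !mxE liftK.
Qed.

Lemma rV_unconsK n : cancel (@rV_uncons n) (@rV_cons n).
Proof.
move=> v; apply/rowP => i; rewrite mxE.
by case: unliftP => [j ->|->] //=; rewrite mxE.
Qed.

Lemma measurable_rV_cons n : measurable_fun setT (@rV_cons n).
Proof.
apply: measurable_fun_rV => i.
under eq_fun do rewrite mxE.
case: (unlift ord0 i) => [j|]; last exact: measurable_fst.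
exact: measurableT_comp (measurable_rV_coord j) measurable_snd.
Qed.

Lemma measurable_rV_uncons n : measurable_fun setT (@rV_uncons n).
Proof.
apply/measurable_fun_pair; first exact: (measurable_rV_coord ord0).
apply: measurable_fun_rV => i; under eq_fun do rewrite mxE.
exact: (measurable_rV_coord (lift ord0 i)).
Qed.

Section rV_push.
Context {n : nat} (nu : {sigma_finite_measure set 'rV[R]_n -> \bar R}).
Local Open Scope ereal_scope.

Definition rV_push : set 'rV[R]_n.+1 -> \bar R :=
  pushforward (@lebesgue_measure R \x nu) (@rV_cons n).

Let rV_push0 : rV_push set0 = 0.
Proof. by rewrite /rV_push /pushforward preimage_set0 measure0. Qed.

Let rV_push_ge0 A : 0 <= rV_push A.
Proof. by rewrite /rV_push /pushforward measure_ge0. Qed.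

Let rV_push_sigma_additive : semi_sigma_additive rV_push.
Proof.
pose mu := measure_function_pushforward__canonical__measure_function_Measure
  (@lebesgue_measure R \x nu)%E (@measurable_rV_cons n).
exact: (@measure_semi_sigma_additive _ _ _ mu).
Qed.

HB.instance Definition _ := isMeasure.Build _ _ _ rV_push
  rV_push0 rV_push_ge0 rV_push_sigma_additive.

Let rV_push_sigma_finite : sigma_finite setT rV_push.
Proof.
have /sigma_finiteP[F [TF ndF Foo]] := sigma_finiteT (@lebesgue_measure R).
have /sigma_finiteP[G [TG ndG Goo]] := sigma_finiteT nu.
exists (fun k => @rV_uncons n @^-1` (F k `*` G k)).
  apply/esym; rewrite -subTset => v _.
  have [k _ Fk] : (\bigcup_k F k) (v ord0 ord0) by rewrite -TF.
  have [l _ Gl] : (\bigcup_k G k) (rV_uncons v).2 by rewrite -TG.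
  exists (maxn k l) => //; split.
    by move: Fk; exact/subsetPset/ndF/leq_maxl.
  by move: Gl; exact/subsetPset/ndG/leq_maxr.
move=> k; have [mF Fk] := Foo k; have [mG Gk] := Goo k; split.
  rewrite -[X in measurable X]setTI.
  by apply: measurable_rV_uncons => //; exact: measurableX.
rewrite /rV_push /pushforward -comp_preimage.
rewrite (_ : _ \o _ = id); last by apply/funext => p; exact: rV_consK.
by rewrite preimage_id product_measure1E// lte_mul_pinfty// ge0_fin_numE.
Qed.

HB.instance Definition _ :=
  Measure_isSigmaFinite.Build _ _ _ rV_push rV_push_sigma_finite.

End rV_push.

Fixpoint lebesgue_rV n : {sigma_finite_measure set 'rV[R]_n -> \bar R} :=
  if n is n'.+1 return {sigma_finite_measure set 'rV[R]_n -> \bar R}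
  then rV_push (lebesgue_rV n') else dirac (0 : 'rV[R]_0).

Lemma lebesgue_rV_box n (A : 'I_n -> set R) : (forall i, measurable (A i)) ->
  lebesgue_rV n [set v | forall i, A i (v ord0 i)] =
  (\prod_(i < n) lebesgue_measure (A i))%E.
Proof.
elim: n A => [|n IH] A mA.
  by rewrite big_ord0 /= diracE mem_set // => -[].
rewrite big_ord_recl -IH //= /rV_push /pushforward.
set B := [set v : 'rV[R]_n | forall i, A (lift ord0 i) (v ord0 i)].
have mB : measurable B.
  have -> : B =
      \bigcap_(i in [set: 'I_n]) (rV_coord i @^-1` A (lift ord0 i)).
    by apply/seteqP; split => v /= Av i; [move=> _|]; exact: Av.
  apply: fin_bigcap_measurable => // i _.
  by rewrite -[X in measurable X]setTI; exact: measurable_rV_coord.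
suff -> : @rV_cons n @^-1` [set v | forall i, A i (v ord0 i)] = A ord0 `*` B.
  by rewrite product_measure1E; [|exact: mA|exact: mB].
apply/seteqP; split => [[x v] /= Av|[x v] /= [Ax Av] i].
  split; first by have := Av ord0; rewrite mxE unlift_none.
  by move=> i; have := Av (lift ord0 i); rewrite mxE liftK.
by rewrite mxE; case: unliftP => [j ->|->]//=.
Qed.

End lebesgue_rV.

Section euclidean.
Context {R : realType} {n : nat}.

Definition dotp (u v : 'rV[R]_n) : R := \sum_(i < n) u ord0 i * v ord0 i.

(* The library norm on row vectors is the sup norm; |u| is the Euclidean one. *)
Definition sqnorm (u : 'rV[R]_n) : R := dotp u u.

Definition enorm (u : 'rV[R]_n) : R := Num.sqrt (sqnorm u).

End euclidean.

Section complex_functions.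
Context {R : realType}.

Definition expi (x : R) : R[i] := cos x +i* sin x.

Definition cexp (z : R[i]) : R[i] :=
  (expR (complex.Re z))%:C * expi (complex.Im z).

Definition cmeasurable_fun d (T : measurableType d) (f : T -> R[i]) :=
  measurable_fun setT (fun x => complex.Re (f x)) /\
  measurable_fun setT (fun x => complex.Im (f x)).

Definition cintegral d (T : measurableType d)
    (mu : {measure set T -> \bar R}) (D : set T) (f : T -> R[i]) : R[i] :=
  (\int[mu]_(x in D) complex.Re (f x)) +i* (\int[mu]_(x in D) complex.Im (f x)).

End complex_functions.

(* A bounded (complex) measure is given by its real and imaginary parts, which
   are finite signed measures. *)
Record bounded_measure d (T : measurableType d) (R : realType) := BoundedMeasure {
  bm_Re : {charge set T -> \bar R} ;
  bm_Im : {charge set T -> \bar R} }.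

Section bounded_measure_theory.
Context d (T : measurableType d) (R : realType).

Definition hahn_pos (nu : {charge set T -> \bar R}) : set T :=
  sval (cid (Hahn_decomposition nu)).

Definition hahn_neg (nu : {charge set T -> \bar R}) : set T :=
  sval (cid (svalP (cid (Hahn_decomposition nu)))).

Lemma hahn_posnegP (nu : {charge set T -> \bar R}) :
  hahn_decomposition nu (hahn_pos nu) (hahn_neg nu).
Proof. exact: svalP (cid (svalP (cid (Hahn_decomposition nu)))). Qed.

(* The Jordan decomposition does not depend on the chosen Hahn sets. *)
Definition charge_integral (nu : {charge set T -> \bar R}) (f : T -> R[i]) :
    R[i] :=
  cintegral (jordan_pos (hahn_posnegP nu)) setT f -
  cintegral (jordan_neg (hahn_posnegP nu)) setT f.

Definition bm_integral (nu : bounded_measure T R) (f : T -> R[i]) : R[i] :=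
  charge_integral (bm_Re nu) f + (0 +i* 1) * charge_integral (bm_Im nu) f.

Definition bm_of_probability (mu : probability T R) : bounded_measure T R :=
  BoundedMeasure (charge_of_finite_measure mu) czero.

End bounded_measure_theory.

Section class_M.
Context {R : realType} {n : nat}.
Local Notation V := 'rV[R]_n.
Local Notation leb := (@lebesgue_rV R n).

Definition plane_wave (a : V) : V -> R[i] := fun x => expi (dotp a x).

Definition fourier (nu : bounded_measure V R) (u : V) : R[i] :=
  bm_integral nu (plane_wave u).

Definition Linfty_norm (f : V -> R[i]) : \bar R :=
  Lnorm leb +oo%E (fun x => (Normc.normc (f x))%:E).

Definition Linfty (f : V -> R[i]) : Prop :=
  cmeasurable_fun f /\ (Linfty_norm f < +oo)%E.

(* T acts on representatives; the second and third clauses make it a linear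
   operator on classes modulo almost everywhere equality. *)
Record bounded_op (T : (V -> R[i]) -> V -> R[i]) : Prop := {
  bounded_op_Linfty : forall f, Linfty f -> Linfty (T f) ;
  bounded_op_ae : forall f g, Linfty f -> Linfty g ->
    f = g %[ae leb] -> T f = T g %[ae leb] ;
  bounded_op_linear : forall (c : R[i]) f g, Linfty f -> Linfty g ->
    T (fun x => c * f x + g x) = (fun x => c * T f x + T g x) %[ae leb] ;
  bounded_op_bounded : exists M : R, forall f, Linfty f ->
    (Linfty_norm (T f) <= M%:E * Linfty_norm f)%E }.

Definition commutes_with_translations (T : (V -> R[i]) -> V -> R[i]) : Prop :=
  forall (a : V) f, Linfty f ->
    T (fun x => f (x - a)) = (fun x => T f (x - a)) %[ae leb].

Definition is_symbol (T : (V -> R[i]) -> V -> R[i]) (phi : V -> R[i]) : Prop :=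
  forall a : V,
    T (plane_wave a) = (fun x => phi a * plane_wave a x) %[ae leb].

Definition partial (i : 'I_n) (g : V -> R) : V -> R :=
  fun x => 'D_(delta_mx ord0 i) g x.

(* All iterated partial derivatives, taken in any order, exist and are
   continuous. *)
Definition smooth (g : V -> R) : Prop :=
  forall s : seq 'I_n, let h := foldr partial g s in
    continuous h /\ forall i x, derivable h x (delta_mx ord0 i).

Definition partial_multi (alpha : 'I_n -> nat) (g : V -> R) : V -> R :=
  foldr (fun i => iter (alpha i) (partial i)) g (enum 'I_n).

Definition csmooth (phi : V -> R[i]) : Prop :=
  smooth (fun u => complex.Re (phi u)) /\ smooth (fun u => complex.Im (phi u)).

Definition cpartial_multi (alpha : 'I_n -> nat) (phi : V -> R[i]) : V -> R[i] :=
  fun u => partial_multi alpha (fun v => complex.Re (phi v)) u +i*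
           partial_multi alpha (fun v => complex.Im (phi v)) u.

Definition class_M (gamma' : R) (nu : R -> bounded_measure V R) : Prop :=
  exists phi1 phi2 : V -> R[i],
    [/\ forall (h : R) (u : V), 0 < h ->
          fourier (nu h) u = cexp (h%:C * (phi1 u + phi2 u)),
        exists T, [/\ bounded_op T, commutes_with_translations T
                    & is_symbol T phi1],
        csmooth phi2,
        forall alpha : 'I_n -> nat, exists2 A : R, 0 < A &
          forall u, Normc.normc (cpartial_multi alpha phi2 u)
                    <= A * (sqnorm u + 1)
      & exists r : R, forall u, r <= enorm u ->
          complex.Re (phi2 u) <= gamma' * sqnorm u].

End class_M.

Section levy.
Context {R : realType} {n : nat}.
Local Notation V := 'rV[R]_n.

Definition is_levy_measure (rho : {measure set V -> \bar R}) : Prop :=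
  (\int[rho]_(y in ~` [set 0%R]) (Num.min 1 (sqnorm y))%:E < +oo)%E.

(* The mass that rho may give to the origin plays no role: rho stands for its
   restriction to R^n minus the origin. With row vectors, u *m a^T is the
   vector au. *)
Definition levy_symbol (m : V) (a : 'M[R]_n) (rho : {measure set V -> \bar R})
    (u : V) : R[i] :=
  (0 +i* dotp m u) - (2^-1 * dotp (u *m a^T) u)%:C +
  cintegral rho (~` [set 0%R])
    (fun y => expi (dotp u y) - 1 - (0 +i* (dotp u y / (1 + sqnorm y)))).

Context d {T : measurableType d} (P : probability T R).

(* Only the times t >= 0 matter. *)
Record levy_process (X : R -> {RV P >-> V}) : Prop := {
  levy_init : {ae P, forall w, X 0 w = 0} ;
  levy_indep : forall (k : nat) (s : nat -> R) (B : 'I_k -> set V),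
    0 <= s 0%N -> (forall i, (i < k)%N -> s i < s i.+1) ->
    (forall i, measurable (B i)) ->
    P [set w | forall i : 'I_k, B i (X (s i.+1) w - X (s i) w)] =
    (\prod_(i < k) P [set w | B i (X (s i.+1) w - X (s i) w)%R])%E ;
  levy_stationary : forall (s t : R) (B : set V),
    0 <= s -> 0 <= t -> measurable B ->
    P [set w | B (X (s + t) w - X s w)] = P [set w | B (X t w)] ;
  levy_stoch_cont : forall (s e : R), 0 <= s -> 0 < e ->
    P [set w | e < enorm (X t w - X s w)]
      @[t --> within [set t | 0 <= t] (nbhs s)] --> 0%E }.

Definition char_fun (Y : {RV P >-> V}) (u : V) : R[i] :=
  cintegral P setT (fun w => expi (dotp (Y w) u)).

Definition law (Y : {RV P >-> V}) : probability V R := distribution P Y.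

End levy.

Section density.
Context {R : realType} {n : nat}.

Definition is_density (mu : probability 'rV[R]_n R) (f : 'rV[R]_n -> R) : Prop :=
  [/\ measurable_fun setT f, forall x, 0 <= f x
    & forall A : set 'rV[R]_n, measurable A ->
        mu A = (\int[lebesgue_rV n]_(x in A) (f x)%:E)%E].

Definition cvec (x y : 'rV[R]_n) : 'rV[R[i]]_n :=
  \row_j (x ord0 j +i* y ord0 j).

Definition holomorphic (F : 'rV[R[i]]_n -> R[i]) : Prop :=
  forall z, differentiable F z.

End density.

(* Main.v *)
Require Import Defs.
From HB Require Import structures.
From mathcomp Require Import all_boot all_order all_algebra.
From mathcomp Require Import all_classical all_reals all_analysis.
From mathcomp Require Import measurable_realfun ess_sup_inf complex.
From mathcomp Require Import ring lra.

(** Put s = t * delta. Since the quadratic part of the exponent dominates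
    delta |u|^2, the Fourier transform of the law of X t factors as
    exp(- s |u|^2) w(u) with w(u) = exp(t (phi(u) + delta |u|^2)), and w is
    still the Fourier transform of an infinitely divisible law. Hence the
    density of X t is an inverse Fourier integral, which makes sense at complex
    points because of the Gaussian factor:
      F(x + i y) = (2 pi)^-n \int exp(- i (x + i y).u) exp(- s |u|^2) w(u) du.
    If w = 1 this is an explicit Gaussian and the integral of |F(x + i y)| over
    x equals exp(|y|^2 / (4 s)). In general F(. + i y) is the convolution of that
    function with a probability measure, and convolution does not increase the
    L1 norm; as eps t < 4 s, the bound of the theorem follows with C = 1.

    The law with transform w is not constructed. Instead, [heat_bounded s B v]
    records the L1 bound, with constant B, for v in place of w, and
    [heat_multiplier s c w] says that multiplication by w enlarges such
    constants at most by the factor c. The transform of a finite measure of mass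
    c is a multiplier of constant c ([heat_multiplier_fourier]); constants add and
    multiply like norms, and pass to pointwise limits. The key step is
    [heat_multiplier_exp]: if w has constant c, then exp(w - c), the limit of the
    powers (1 + (w - c) / k)^k, has constant 1. This gives compound Poisson
    factors; as limits, the Gaussians of rank one
    ([heat_multiplier_gauss_line]) and then, by a decomposition into squares, those
    of any positive semidefinite form ([heat_multiplier_psd]); and finally, by
    truncating the small jumps, the whole factor w ([heat_multiplier_levy]).

    That the inverse Fourier integral is a density ([fourier_densityP]) is seen
    by smoothing the law with a heat kernel: the smoothed law has a nonnegative
    density given by a Fourier integral, which converges as the smoothing is
    removed, while integrals of Lipschitz functions are hardly changed. Lipschitz
    approximations of the indicators of boxes then identify the measure.
    Holomorphy ([holomorphic_fourier_extension]) follows from a second-order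
    Taylor estimate under the integral sign.

    For the membership in the class M, phi1 is the Fourier transform of the
    Levy measure restricted to |y| > 1. This measure is finite, so phi1 is the
    symbol of the bounded operator that averages the translates of a function
    ([bounded_average], [average_symbol]). The rest phi2 is a quadratic polynomial
    plus the integrals over |y| <= 1 of cos(u.y) - 1 and of sin(u.y) - u.y
    ([small_jump_symbolE]). Derivatives may be taken under the integral: each of
    them lowers the order in u and brings down a factor y, so the integrands stay
    O(|y|^2) and the growth in u stays at most quadratic ([tame_trig_integral]).
    Finally Re phi2 is at most minus the quadratic part of the exponent, hence
    at most - delta |u|^2 ([Re_small_jump_le]). *)

Set Implicit Arguments.
Unset Strict Implicit.
Unset Printing Implicit Defensive.

Import Order.TTheory GRing.Theory Num.Theory.
Import numFieldNormedType.Exports.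

Local Open Scope classical_set_scope.
Local Open Scope ring_scope.
Local Open Scope complex_scope.

Local Notation normc := Normc.normc.

(** * Elementary estimates for real and complex exponentials *)

Section elementary.
Context {R : realType}.
Implicit Types (x y a b : R) (z w : R[i]).

Lemma normr_sinB x y : `|sin x - sin y| <= `|x - y|.
Proof.
wlog xy : x y / x <= y.
  move=> h; have [/h//|/ltW/h] := leP x y; by rewrite distrC (distrC y).
move: xy; rewrite le_eqVlt => /predU1P[->|xy]; first by rewrite !subrr.
have dsin (c : R) : is_derive c 1 (@sin R) (cos c) by exact: is_derive_sin.
have [c _ e] := @MVT _ (@sin R) (@cos R) x y xy (fun c _ => dsin c)
  (continuous_subspaceT (@continuous_sin R)).
by rewrite distrC e normrM (distrC y) ler_piMl// cos_max.
Qed.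

Lemma normr_sin_le x : `|sin x| <= `|x|.
Proof. by have := normr_sinB x 0; rewrite sin0 !subr0. Qed.

Lemma normr_cosB1 x : `|cos x - 1| <= x ^+ 2 / 2.
Proof.
have -> : cos x = 1 - 2 * sin (x / 2) ^+ 2.
  rewrite {1}(_ : x = (x / 2) *+ 2); last by rewrite mulr2n; lra.
  by rewrite cos_mulr2n cos2sin2 mulr2n; ring.
rewrite (_ : _ - 1 = - (2 * sin (x / 2) ^+ 2)); last by ring.
rewrite normrN.
have h0 := normr_sin_le (x / 2).
have := ler_pM (normr_ge0 _) (normr_ge0 _) h0 h0.
rewrite -!expr2 !real_normK ?num_real// => h.
rewrite ger0_norm; last by rewrite mulr_ge0 ?sqr_ge0.
have : (x/2)^+2 = x ^+2/4 by field.
move=> e; rewrite e in h; lra.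
Qed.

Lemma normr_sinB_id x : `|sin x - x| <= x ^+ 2.
Proof.
suff H y : 0 <= y -> `|sin y - y| <= y ^+ 2.
  have [/H//|/ltW x0] := leP 0 x.
  have := H (- x); rewrite oppr_ge0 => /(_ x0).
  by rewrite sinN sqrrN -opprD normrN.
rewrite le_eqVlt => /predU1P[<-|y0].
  by rewrite sin0 subrr normr0 expr0n.
have ds (c : R) : is_derive c 1 (fun x : R => sin x - x) (cos c - 1).
  exact: is_deriveB.
have cs : continuous (fun x : R => sin x - x).
  move=> c; apply: differentiable_continuous; apply/derivable1_diffP.
  by apply: ex_derive.
have [c cy e] := @MVT _ (fun x : R => sin x - x) _ 0 y y0 (fun c _ => ds c)
  (continuous_subspaceT cs).
move: e; rewrite sin0 !subr0 => ->; rewrite normrM expr2 (gtr0_norm y0).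
rewrite ler_pM2r//.
have /andP[c0 /ltW cy'] : 0 < c < y by rewrite in_itv/= in cy.
have [y2|y2] := leP y 2.
  apply: (le_trans (normr_cosB1 c)); rewrite expr2.
  have : c * c <= y * y by apply: ler_pM => //; apply: ltW.
  have : y * y <= y * 2 by rewrite ler_pM2l.
  lra.
apply: (le_trans _ (ltW y2)); rewrite ler_norml.
have := cos_le1 c; have := cos_geN1 c; lra.
Qed.

Lemma normr_expRB1 a : `|expR a - 1| <= `|a| * expR `|a|.
Proof.
have h1 := expR_ge1Dx a; have h2 := expR_ge1Dx (- a).
have e0 := expR_gt0 a.
have h3 : (1 - a) * expR a <= 1.
  by have := ler_wpM2r (ltW e0) h2; rewrite -expRD addNr expR0.
have [a0|a0] := leP 0 a.
  rewrite (ger0_norm a0) ger0_norm; lra.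
have e1 : 1 <= expR (- a) by rewrite -expR0 ler_expR; lra.
have : - a * 1 <= - a * expR (- a) by rewrite ler_wpM2l//; lra.
have e2 : expR a <= 1 by rewrite -expR0 ler_expR ltW.
rewrite (ltr0_norm a0) ler0_norm; lra.
Qed.

Lemma normr_expRB1B a : `|expR a - 1 - a| <= a ^+ 2 * expR `|a|.
Proof.
have h1 := expR_ge1Dx a; have h2 := expR_ge1Dx (- a).
have e0 := expR_gt0 a.
have h3 : (1 - a) * expR a <= 1.
  by have := ler_wpM2r (ltW e0) h2; rewrite -expRD addNr expR0.
rewrite ger0_norm; last by lra.
have h4 : expR a - 1 - a <= `|a| * `|expR a - 1|.
  by rewrite -normrM; apply: le_trans (ler_norm _); nra.
apply: (le_trans h4).
rewrite (_ : a ^+ 2 = `|a| * `|a|); last by rewrite -normrM ger0_norm ?sqr_ge0.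
by rewrite -mulrA ler_wpM2l// normr_expRB1.
Qed.

Lemma normc_Re z : `|complex.Re z| <= normc z.
Proof.
case: z => a b /=; rewrite -[leLHS]sqrtr_sqr ler_wsqrtr// lerDl.
exact: sqr_ge0.
Qed.

Lemma normc_Im z : `|complex.Im z| <= normc z.
Proof.
case: z => a b /=; rewrite -[leLHS]sqrtr_sqr ler_wsqrtr// lerDr.
exact: sqr_ge0.
Qed.

Lemma normc_ge0 z : 0 <= normc z.
Proof. by case: z => a b; exact: sqrtr_ge0. Qed.

Lemma normc_sqr z : normc z ^+ 2 = complex.Re z ^+ 2 + complex.Im z ^+ 2.
Proof. by case: z => a b /=; rewrite sqr_sqrtr// addr_ge0 ?sqr_ge0. Qed.

Lemma normc_le_ReIm z : normc z <= `|complex.Re z| + `|complex.Im z|.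
Proof.
rewrite -(@ler_pXn2r _ 2)// ?nnegrE ?normc_ge0 ?addr_ge0//.
rewrite normc_sqr sqrrD !real_normK ?num_real// [leRHS]addrAC lerDl.
by rewrite mulrn_wge0// mulr_ge0.
Qed.

Lemma normc_real x : normc x%:C = `|x|.
Proof. by rewrite /= expr0n addr0 sqrtr_sqr. Qed.

Lemma normc_im x : normc (0 +i* x) = `|x|.
Proof. by rewrite /= expr0n add0r sqrtr_sqr. Qed.

Lemma normc_expi x : normc (expi x) = 1.
Proof. by rewrite /expi /= cos2Dsin2 sqrtr1. Qed.

Lemma expi0 : expi 0 = 1 :> R[i].
Proof. by rewrite /expi cos0 sin0. Qed.

Lemma expiD x y : expi (x + y) = expi x * expi y.
Proof.
rewrite /expi cosD sinD; apply/eqP.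
by rewrite eq_complex /= eqxx /= [X in _ == X]addrC [_ * sin y]mulrC.
Qed.

Lemma cexpD z w : cexp (z + w) = cexp z * cexp w.
Proof.
case: z w => [a b] [c d]; rewrite /cexp/= expRD expiD rmorphM/=; ring.
Qed.

Lemma cexp0 : cexp 0 = 1 :> R[i].
Proof. by rewrite /cexp /= expR0 expi0 mulr1. Qed.

Lemma normc_cexp z : normc (cexp z) = expR (complex.Re z).
Proof.
by rewrite /cexp Normc.normcM normc_real normc_expi mulr1 ger0_norm ?expR_ge0.
Qed.

Lemma cexpX z k : cexp z ^+ k = cexp (z *+ k).
Proof.
elim: k => [|k IH]; first by rewrite expr0 mulr0n cexp0.
by rewrite exprS IH -cexpD mulrS.
Qed.

Lemma cexp_real x : cexp x%:C = (expR x)%:C.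
Proof. by rewrite /cexp /= expi0 mulr1. Qed.

Lemma cexp_im x : cexp (0 +i* x) = expi x.
Proof. by rewrite /cexp /= expR0 mul1r. Qed.

(** Second-order Taylor bound. It is the only analytic input for two limits:
    powers converging to an exponential, and the complex derivative of a
    Fourier integral. *)
Lemma normc_cexpB1B z :
  normc (cexp z - 1 - z) <= 2 * normc z ^+ 2 * expR (normc z).
Proof.
apply: (le_trans (normc_le_ReIm _)).
have aez : expR `|complex.Re z| <= expR (normc z) by rewrite ler_expR normc_Re.
rewrite normc_sqr; apply: (@le_trans _ _ (2 * (complex.Re z ^+ 2 +
  complex.Im z ^+ 2) * expR `|complex.Re z|)); last first.
  by rewrite ler_wpM2l// mulr_ge0// addr_ge0 ?sqr_ge0.
move: {aez} z => [a b]/=; rewrite !mul0r subr0 addr0 oppr0 addr0.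
have ea : expR a <= expR `|a| by rewrite ler_expR ler_norm.
set E := expR `|a| in ea *.
have E0 : 0 <= E by exact: expR_ge0.
have h1 : `|expR a * cos b - 1 - a| <= E * (b ^+ 2 / 2) + a ^+ 2 * E.
  rewrite (_ : _ - _ - _ = expR a * (cos b - 1) + (expR a - 1 - a)); last by ring.
  apply: (le_trans (ler_normD _ _)); apply: lerD; last exact: normr_expRB1B.
  rewrite normrM ger0_norm ?expR_ge0//.
  by apply: ler_pM => //; exact: normr_cosB1.
have h2 : `|expR a * sin b - b| <= E * b ^+ 2 + `|a| * E * `|b|.
  rewrite (_ : _ - _ = expR a * (sin b - b) + (expR a - 1) * b); last by ring.
  apply: (le_trans (ler_normD _ _)); apply: lerD; rewrite normrM.
    rewrite ger0_norm ?expR_ge0//.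
    by apply: ler_pM => //; exact: normr_sinB_id.
  by rewrite ler_wpM2r// normr_expRB1.
have h3 : `|a| * E * `|b| <= E * (a ^+ 2 / 2 + b ^+ 2 / 2).
  rewrite mulrAC [leLHS]mulrC ler_wpM2l//.
  rewrite -(real_normK (num_real a)) -(real_normK (num_real b)).
  have := sqr_ge0 (`|a| - `|b|); rewrite !expr2; nra.
apply: (le_trans (lerD h1 h2)).
have b2 : 0 <= b ^+ 2 * E by rewrite mulr_ge0 ?sqr_ge0.
have a2 : 0 <= a ^+ 2 * E by rewrite mulr_ge0 ?sqr_ge0.
lra.
Qed.

End elementary.

(** * Integration of complex-valued functions *)

Section complex_measurable.
Context d (T : measurableType d) (R : realType).
Implicit Types (f g : T -> R[i]) (h k : T -> R).

Lemma cmeasurable_cst (c : R[i]) : cmeasurable_fun (fun _ : T => c).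
Proof. by split; exact: measurable_cst. Qed.

Lemma cmeasurable_RI h k : measurable_fun setT h -> measurable_fun setT k ->
  cmeasurable_fun (fun x => h x +i* k x).
Proof. by []. Qed.

Lemma cmeasurable_real h : measurable_fun setT h ->
  cmeasurable_fun (fun x => (h x)%:C).
Proof. by move=> mh; split => //; exact: measurable_cst. Qed.

Lemma cmeasurableD f g : cmeasurable_fun f -> cmeasurable_fun g ->
  cmeasurable_fun (fun x => f x + g x).
Proof.
move=> [mfr mfi] [mgr mgi]; split.
  rewrite (_ : (fun _ => _) = (fun x => complex.Re (f x) + complex.Re (g x))).
    exact: measurable_funD.
  by apply/funext => x; case: (f x) (g x) => [? ?] [].
rewrite (_ : (fun _ => _) = (fun x => complex.Im (f x) + complex.Im (g x))).
  exact: measurable_funD.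
by apply/funext => x; case: (f x) (g x) => [? ?] [].
Qed.

Lemma cmeasurableM f g : cmeasurable_fun f -> cmeasurable_fun g ->
  cmeasurable_fun (fun x => f x * g x).
Proof.
move=> [mfr mfi] [mgr mgi]; split.
  rewrite (_ : (fun _ => _) = (fun x => complex.Re (f x) * complex.Re (g x)
     - complex.Im (f x) * complex.Im (g x))).
    by apply: measurable_funB; exact: measurable_funM.
  by apply/funext => x; case: (f x) (g x) => [? ?] [].
rewrite (_ : (fun _ => _) = (fun x => complex.Re (f x) * complex.Im (g x)
  + complex.Im (f x) * complex.Re (g x))).
  by apply: measurable_funD; exact: measurable_funM.
by apply/funext => x; case: (f x) (g x) => [? ?] [].
Qed.

Lemma cmeasurableN f : cmeasurable_fun f -> cmeasurable_fun (fun x => - f x).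
Proof.
move=> mf; rewrite (_ : (fun x => _) = (fun x => (-1) * f x)).
  exact: (cmeasurableM (cmeasurable_cst _)).
by apply/funext => x; rewrite mulN1r.
Qed.

Lemma cmeasurableB f g : cmeasurable_fun f -> cmeasurable_fun g ->
  cmeasurable_fun (fun x => f x - g x).
Proof. by move=> mf mg; exact/cmeasurableD/cmeasurableN. Qed.

Lemma cmeasurable_prod (I : Type) (s : seq I) (F : I -> T -> R[i]) :
  (forall i, cmeasurable_fun (F i)) ->
  cmeasurable_fun (fun x => \prod_(i <- s) F i x).
Proof.
move=> mF; elim: s => [|i s IH].
  by under eq_fun do rewrite big_nil; exact: cmeasurable_cst.
under eq_fun do rewrite big_cons; exact: cmeasurableM.
Qed.

Lemma cmeasurable_expi h : measurable_fun setT h ->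
  cmeasurable_fun (fun x => expi (h x)).
Proof.
move=> mh; split => /=.
  apply: (measurableT_comp _ mh).
  exact: (continuous_measurable_fun (@continuous_cos R)).
apply: (measurableT_comp _ mh).
exact: (continuous_measurable_fun (@continuous_sin R)).
Qed.

Lemma measurable_normc f : cmeasurable_fun f ->
  measurable_fun setT (fun x => normc (f x)).
Proof.
move=> [mfr mfi].
rewrite (_ : (fun _ => _) = (fun x => Num.sqrt (complex.Re (f x) ^+ 2 +
  complex.Im (f x) ^+ 2))); last by apply/funext => x; case: (f x).
apply: (measurableT_comp (continuous_measurable_fun (@sqrt_continuous R))) => //.
by apply: measurable_funD; exact: measurable_funX.
Qed.

Lemma cmeasurable_comp d' (S : measurableType d') (g : T -> S) (f : S -> R[i]) :
  measurable_fun setT g -> cmeasurable_fun f ->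
  cmeasurable_fun (fun x => f (g x)).
Proof.
by move=> mg [mr mi]; split; [exact: (measurableT_comp mr)|
  exact: (measurableT_comp mi)].
Qed.

End complex_measurable.

(** Convergence is taken on real and imaginary parts, so that it combines
    directly with [cintegral], which is defined in the same way. *)
Definition ccvg {R : realType} (u : nat -> R[i]) (l : R[i]) : Prop :=
  complex.Re (u k) @[k --> \oo] --> complex.Re l /\
  complex.Im (u k) @[k --> \oo] --> complex.Im l.

Section complex_limits.
Context {R : realType}.
Implicit Types (u v : nat -> R[i]) (l m : R[i]).

Lemma ccvg_cst l : ccvg (fun=> l) l.
Proof. by split; exact: cvg_cst. Qed.

Lemma ccvgD u v l m : ccvg u l -> ccvg v m -> ccvg (fun k => u k + v k) (l + m).
Proof.
have e (x y : R[i]) : (complex.Re (x + y) = complex.Re x + complex.Re y) *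
  (complex.Im (x + y) = complex.Im x + complex.Im y) by case: x; case: y.
move=> [ur ui] [vr vi]; split; under eq_fun do rewrite e; rewrite e;
  exact: cvgD.
Qed.

Lemma ccvgM u v l m : ccvg u l -> ccvg v m -> ccvg (fun k => u k * v k) (l * m).
Proof.
have e (x y : R[i]) : (complex.Re (x * y) =
    complex.Re x * complex.Re y - complex.Im x * complex.Im y) *
  (complex.Im (x * y) = complex.Re x * complex.Im y + complex.Im x * complex.Re y).
  by case: x; case: y.
move=> [ur ui] [vr vi]; split; under eq_fun do rewrite e; rewrite e.
  by apply: cvgB; exact: cvgM.
by apply: cvgD; exact: cvgM.
Qed.

Lemma ccvg_real (h : nat -> R) (x : R) : h k @[k --> \oo] --> x ->
  ccvg (fun k => (h k)%:C) x%:C.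
Proof. by split => //=; exact: cvg_cst. Qed.

Lemma ccvg_cexp u l : ccvg u l -> ccvg (fun k => cexp (u k)) (cexp l).
Proof.
move=> [ur ui]; apply: ccvgM.
  by apply: ccvg_real; apply: continuous_cvg => //; exact: continuous_expR.
split => /=.
  by apply: continuous_cvg => //; exact: continuous_cos.
by apply: continuous_cvg => //; exact: continuous_sin.
Qed.

Lemma ccvg_normc u l : ccvg u l -> normc (u k) @[k --> \oo] --> normc l.
Proof.
move=> [ur ui].
have e (x : R[i]) : normc x = Num.sqrt (complex.Re x ^+ 2 + complex.Im x ^+ 2).
  by case: x.
under eq_fun do rewrite e; rewrite e; apply: continuous_cvg.
  exact: sqrt_continuous.
by apply: cvgD; rewrite expr2; under eq_fun do rewrite expr2; exact: cvgM.
Qed.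

Lemma ccvg_le u l (r : nat -> R) : r k @[k --> \oo] --> (0 : R) ->
  (\forall k \near \oo, normc (u k - l) <= r k) -> ccvg u l.
Proof.
move=> r0 ur.
have e (x y : R[i]) : (complex.Re (x - y) = complex.Re x - complex.Re y) *
  (complex.Im (x - y) = complex.Im x - complex.Im y) by case: x; case: y.
have H (p : R[i] -> R) : (forall z, `|p z| <= normc z) ->
    (forall x y, p (x - y) = p x - p y) -> p (u k) @[k --> \oo] --> p l.
  move=> pn pB; apply/cvgrPdist_le => eps e0.
  have rl : \forall k \near \oo, `|0 - r k| <= eps by apply: cvgr_dist_le.
  near=> k; rewrite distrC -pB (le_trans (pn _))//.
  have h1 : normc (u k - l) <= r k by near: k.
  have h2 : `|0 - r k| <= eps by near: k.
  rewrite (le_trans h1)// (le_trans _ h2)// sub0r normrN; exact: ler_norm.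
split; apply: H => [z|x y]; rewrite ?e//; [exact: normc_Re|exact: normc_Im].
Unshelve. all: by end_near. Qed.

Lemma ccvg_normc_le u l (M : R) : ccvg u l -> (forall k, normc (u k) <= M) ->
  normc l <= M.
Proof.
move=> /ccvg_normc ul uM.
have /cvg_lim <- := ul => //.
apply: limr_le; first by apply/cvg_ex; exists (normc l).
exact: nearW.
Qed.

End complex_limits.

Section complex_integral.
Context d (T : measurableType d) (R : realType) (mu : {measure set T -> \bar R}).
Variables (D : set T) (mD : measurable D).
Implicit Types (f g : T -> R[i]).

Definition cintegrable f :=
  mu.-integrable D (EFin \o (fun x => complex.Re (f x))) /\
  mu.-integrable D (EFin \o (fun x => complex.Im (f x))).

Lemma cintegrable_le f (h : T -> R) : cmeasurable_fun f ->
  mu.-integrable D (EFin \o h) -> (forall x, D x -> normc (f x) <= h x) ->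
  cintegrable f.
Proof.
move=> [mr mi] ih fh; split; apply: (le_integrable mD _ _ ih).
- exact/measurable_EFinP/measurable_funTS.
- move=> x Dx /=; rewrite lee_fin (le_trans (normc_Re _))//.
  by rewrite (le_trans (fh _ Dx))// ler_norm.
- exact/measurable_EFinP/measurable_funTS.
- move=> x Dx /=; rewrite lee_fin (le_trans (normc_Im _))//.
  by rewrite (le_trans (fh _ Dx))// ler_norm.
Qed.

Lemma integrable_normc f : cmeasurable_fun f -> cintegrable f ->
  mu.-integrable D (EFin \o (fun x => normc (f x))).
Proof.
move=> mf [ir ii].
apply: (le_integrable mD _ _ (integrableD mD (integrable_norm ir)
  (integrable_norm ii))).
  exact/measurable_EFinP/measurable_funTS/measurable_normc.
move=> x Dx /=; rewrite lee_fin.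
rewrite (ger0_norm (normc_ge0 _)) (@ger0_norm _ (`|_| + `|_|)) ?addr_ge0//.
exact: normc_le_ReIm.
Qed.

Lemma eq_cintegral f g : (forall x, D x -> f x = g x) ->
  cintegral mu D f = cintegral mu D g.
Proof.
move=> fg; congr Complex; apply: eq_Rintegral => x; rewrite inE => Dx;
  by rewrite fg.
Qed.

Lemma cintegrableD f g : cintegrable f -> cintegrable g ->
  cintegrable (fun x => f x + g x).
Proof.
move=> [fr fi] [gr gi]; split.
  have := integrableD mD fr gr; apply: eq_integrable => // x _ /=.
  by case: (f x) (g x) => [? ?] [].
have := integrableD mD fi gi; apply: eq_integrable => // x _ /=.
by case: (f x) (g x) => [? ?] [].
Qed.

Lemma cintegralD f g : cintegrable f -> cintegrable g ->
  cintegral mu D (fun x => f x + g x) = cintegral mu D f + cintegral mu D g.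
Proof.
move=> [fr fi] [gr gi].
rewrite /cintegral; simpc; rewrite -!RintegralD//.
by congr Complex; apply: eq_Rintegral => x _; case: (f x) (g x) => [? ?] [].
Qed.

Lemma cintegrableZl (c : R[i]) f : cintegrable f ->
  cintegrable (fun x => c * f x).
Proof.
case: c => a b [fr fi]; split.
  have := integrableB mD (integrableZl mD a fr) (integrableZl mD b fi).
  by apply: eq_integrable => // x _ /=; case: (f x) => [? ?].
have := integrableD mD (integrableZl mD a fi) (integrableZl mD b fr).
by apply: eq_integrable => // x _ /=; case: (f x) => [? ?].
Qed.

Lemma cintegralZl (c : R[i]) f : cintegrable f ->
  cintegral mu D (fun x => c * f x) = c * cintegral mu D f.
Proof.
case: c => a b [fr fi]; rewrite /cintegral; simpc.
rewrite -!RintegralZl// -RintegralB//; last 2 first.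
  exact: (integrableZl mD a fr).
  exact: (integrableZl mD b fi).
rewrite -RintegralD//; last 2 first.
  exact: (integrableZl mD a fi).
  exact: (integrableZl mD b fr).
by congr Complex; apply: eq_Rintegral => x _; case: (f x) => [? ?].
Qed.

Lemma cintegrableB f g : cintegrable f -> cintegrable g ->
  cintegrable (fun x => f x - g x).
Proof.
move=> fi gi; apply: cintegrableD => //.
by have := cintegrableZl (-1) gi; under eq_fun do rewrite mulN1r.
Qed.

Lemma cintegralB f g : cintegrable f -> cintegrable g ->
  cintegral mu D (fun x => f x - g x) = cintegral mu D f - cintegral mu D g.
Proof.
move=> fi gi; rewrite cintegralD//; last first.
  by have := cintegrableZl (-1) gi; under eq_fun do rewrite mulN1r.
by congr (_ + _); under eq_fun do rewrite -mulN1r; rewrite cintegralZl// mulN1r.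
Qed.

Lemma le_normc_cintegral f : cmeasurable_fun f -> cintegrable f ->
  normc (cintegral mu D f) <= \int[mu]_(x in D) normc (f x).
Proof.
move=> mf iF; set I := cintegral mu D f.
have [->|I0] := eqVneq I 0.
  by rewrite Normc.normc0 Rintegral_ge0// => x _; exact: normc_ge0.
have nI0 : 0 < normc I.
  rewrite lt_neqAle normc_ge0 andbT eq_sym; apply/eqP => /Normc.eq0_normc.
  exact/eqP.
(* multiplying by the conjugate phase makes the integral a positive real *)
have key : normc I * normc I <= normc I * \int[mu]_(x in D) normc (f x).
  have -> : normc I * normc I = complex.Re (conjc I * I).
    by rewrite -expr2 normc_sqr; case: (I) => a b /=; ring.
  rewrite -(cintegralZl _ iF) /= -RintegralZl//; last exact: integrable_normc.
  apply: le_Rintegral => //.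
  - exact: (cintegrableZl (conjc I) iF).1.
  - exact: (integrableZl mD _ (integrable_normc mf iF)).
  - move=> x Dx; rewrite (le_trans (ler_norm _))//.
    rewrite (le_trans (normc_Re _))// Normc.normcM ler_wpM2r ?normc_ge0//.
    by case: (I) => a b /=; rewrite sqrrN.
by rewrite ler_pM2l in key.
Qed.

Lemma le_normc_cintegral_ereal f : cmeasurable_fun f -> cintegrable f ->
  ((normc (cintegral mu D f))%:E <= \int[mu]_(x in D) (normc (f x))%:E)%E.
Proof.
move=> mf iF; rewrite -[leRHS]fineK; last first.
  exact: (integrable_fin_num mD (integrable_normc mf iF)).
by rewrite lee_fin; exact: le_normc_cintegral.
Qed.

Lemma Rdominated_cvg (f_ : nat -> T -> R) (f h : T -> R) :
  (forall k, measurable_fun setT (f_ k)) -> measurable_fun setT f ->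
  (forall x, D x -> f_ k x @[k --> \oo] --> f x) ->
  mu.-integrable D (EFin \o h) ->
  (forall k x, D x -> `|f_ k x| <= h x) ->
  (\int[mu]_(x in D) f_ k x : R) @[k --> \oo] --> \int[mu]_(x in D) f x.
Proof.
move=> mf_ mf cvf ih fh; apply: fine_cvg.
have [] := @dominated_convergence _ _ _ mu D mD (fun k x => (f_ k x)%:E)
  (fun x => (f x)%:E) (EFin \o h).
- by move=> k; exact/measurable_EFinP/measurable_funTS.
- exact/measurable_EFinP/measurable_funTS.
- by apply: aeW => x Dx; apply: cvg_EFin; [exact: nearW|exact: cvf].
- exact: ih.
- by apply: aeW => x k Dx /=; rewrite lee_fin; exact: fh.
- by move=> if_ _; rewrite fineK//; exact: integrable_fin_num.
Qed.

Lemma cdominated_cvg (f_ : nat -> T -> R[i]) f (h : T -> R) :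
  (forall k, cmeasurable_fun (f_ k)) -> cmeasurable_fun f ->
  (forall x, D x -> ccvg (f_ ^~ x) (f x)) ->
  mu.-integrable D (EFin \o h) ->
  (forall k x, D x -> normc (f_ k x) <= h x) ->
  ccvg (fun k => cintegral mu D (f_ k)) (cintegral mu D f).
Proof.
move=> mf_ mf cvf ih fh; split => /=; apply: (Rdominated_cvg (h := h)) => //.
- by move=> k; exact: (mf_ k).1.
- exact: mf.1.
- by move=> x Dx; exact: (cvf x Dx).1.
- by move=> k x Dx; exact: le_trans (normc_Re _) (fh k x Dx).
- by move=> k; exact: (mf_ k).2.
- exact: mf.2.
- by move=> x Dx; exact: (cvf x Dx).2.
- by move=> k x Dx; exact: le_trans (normc_Im _) (fh k x Dx).
Qed.

End complex_integral.

Section fubini.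
Context d1 d2 (T1 : measurableType d1) (T2 : measurableType d2) (R : realType).
Variable m1 : {sigma_finite_measure set T1 -> \bar R}.
Variable m2 : {sigma_finite_measure set T2 -> \bar R}.

Lemma measurable_Rintegral (f : T1 * T2 -> R) : measurable_fun setT f ->
  measurable_fun setT (fun x => \int[m2]_(y in setT) f (x, y)).
Proof.
move=> mf; have mfE : measurable_fun setT (EFin \o f) by exact/measurable_EFinP.
apply: measurableT_comp => //.
under eq_fun do rewrite integralE.
apply: emeasurable_funB.
  have := @measurable_fun_fubini_tonelli_F _ _ _ _ _ m2 ((EFin \o f)^\+)%E
    (measurable_funepos mfE) (funepos_ge0 _).
  rewrite (_ : fubini_F _ _ = (fun x : T1 =>
    (\int[m2]_y (fun y : T2 => (f (x, y))%:E)^\+ y)%E)); first exact.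
  by apply/funext => x; apply: eq_integral => y _; rewrite !funepos.unlock.
have := @measurable_fun_fubini_tonelli_F _ _ _ _ _ m2 ((EFin \o f)^\-)%E
  (measurable_funeneg mfE) (funeneg_ge0 _).
rewrite (_ : fubini_F _ _ = (fun x : T1 =>
    (\int[m2]_y (fun y : T2 => (f (x, y))%:E)^\- y)%E)); first exact.
  by apply/funext => x; apply: eq_integral => y _; rewrite !funeneg.unlock.
Qed.

Lemma cmeasurable_cintegral (f : T1 * T2 -> R[i]) : cmeasurable_fun f ->
  cmeasurable_fun (fun x => cintegral m2 setT (fun y => f (x, y))).
Proof.
move=> [mr mi]; split => /=.
  exact: (measurable_Rintegral mr).
exact: (measurable_Rintegral mi).
Qed.

(** A bound of |f (x, y)| by a product g x * h y of integrable functions is the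
    form of domination under which Fubini is applied everywhere below. *)
Section dominated_product.
Variables (f : T1 * T2 -> R) (g : T1 -> R) (h : T2 -> R).
Hypotheses (mf : measurable_fun setT f).
Hypotheses (ig : m1.-integrable setT (EFin \o g)).
Hypotheses (ih : m2.-integrable setT (EFin \o h)).
Hypotheses (g0 : forall x, 0 <= g x) (h0 : forall y, 0 <= h y).
Hypotheses (fgh : forall x y, `|f (x, y)| <= g x * h y).

Let mfE : measurable_fun setT (EFin \o f).
Proof. exact/measurable_EFinP. Qed.

Lemma integrable_product : (m1 \x m2)%E.-integrable setT (EFin \o f).
Proof.
have ghE x : (\int[m2]_y (g x * h y)%:E = (g x)%:E * \int[m2]_y (h y)%:E)%E.
  under eq_integral do rewrite EFinM.
  rewrite ge0_integralZl//.
  - by case/integrableP: ih.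
  - by move=> y _; rewrite lee_fin.
  - by rewrite lee_fin.
apply/integrable12ltyP => //.
apply: (@le_lt_trans _ _ (\int[m1]_x \int[m2]_y (g x * h y)%:E)%E).
  apply: ge0_le_integral => //.
  - by move=> x _; exact: integral_ge0.
  - apply: (measurable_fun_fubini_tonelli_F (abse \o (EFin \o f))) => //.
      exact: measurableT_comp.
    by move=> x; exact: abse_ge0.
  - under eq_fun do rewrite ghE.
    apply: emeasurable_funM; first by case/integrableP: ig.
    exact: measurable_cst.
  - move=> x _; apply: ge0_le_integral => //.
    + apply/measurable_EFinP/measurableT_comp => //.
      exact: (measurableT_comp mf (measurable_pair1 _)).
    + apply/measurable_EFinP/measurable_funM => //.
      by case/integrableP : ih => /measurable_EFinP.
    + by move=> y _ /=; rewrite lee_fin.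
under eq_integral do rewrite ghE.
rewrite ge0_integralZr//.
- have gf := integrable_fin_num measurableT ig.
  have hf := integrable_fin_num measurableT ih.
  by rewrite /= in gf hf; rewrite -(fineK gf) -(fineK hf) -EFinM ltry.
- by case/integrableP: ig.
- by move=> x _; rewrite lee_fin.
- by apply: integral_ge0 => y _; rewrite lee_fin.
Qed.

Let sectionE x :
  (\int[m2]_y (f (x, y))%:E = (\int[m2]_(y in setT) f (x, y))%:E)%E.
Proof.
rewrite fineK//; apply: integrable_fin_num => //.
apply: (le_integrable measurableT _ _ (integrableZl measurableT (g x) ih)).
  apply/measurable_EFinP.
  exact: (measurableT_comp mf (measurable_pair1 _)).
by move=> y _ /=; rewrite lee_fin (le_trans (fgh _ _))// ler_norm.
Qed.

Lemma Rintegral_product : \int[(m1 \x m2)%E]_(z in setT) f z =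
  \int[m1]_(x in setT) \int[m2]_(y in setT) f (x, y).
Proof.
congr fine; rewrite -(integral12_prod_meas1 integrable_product).
by apply: eq_integral => x _; rewrite /fubini_F sectionE.
Qed.

Lemma Rintegral_fubini : \int[m1]_(x in setT) \int[m2]_(y in setT) f (x, y) =
  \int[m2]_(y in setT) \int[m1]_(x in setT) f (x, y).
Proof.
rewrite -Rintegral_product; congr fine.
rewrite -(integral21_prod_meas1 integrable_product).
apply: eq_integral => y _; rewrite fineK//; apply: integrable_fin_num => //.
apply: (le_integrable measurableT _ _ (integrableZr measurableT (h y) ig)).
  apply/measurable_EFinP.
  exact: (measurableT_comp mf (measurable_pair2 _)).
by move=> x _ /=; rewrite lee_fin (le_trans (fgh _ _))// ler_norm.
Qed.

End dominated_product.

Lemma cintegral_product (f : T1 * T2 -> R[i]) (g : T1 -> R) (h : T2 -> R) :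
  cmeasurable_fun f ->
  m1.-integrable setT (EFin \o g) -> m2.-integrable setT (EFin \o h) ->
  (forall x, 0 <= g x) -> (forall y, 0 <= h y) ->
  (forall x y, normc (f (x, y)) <= g x * h y) ->
  cintegral (m1 \x m2)%E setT f =
  cintegral m1 setT (fun x => cintegral m2 setT (fun y => f (x, y))).
Proof.
move=> [mr mi] ig ih g0 h0 fgh; congr Complex => /=.
  apply: (Rintegral_product mr ig ih) => // x y.
  exact/(le_trans (normc_Re _)).
apply: (Rintegral_product mi ig ih) => // x y.
exact/(le_trans (normc_Im _)).
Qed.

Lemma cintegral_fubini (f : T1 * T2 -> R[i]) (g : T1 -> R) (h : T2 -> R) :
  cmeasurable_fun f ->
  m1.-integrable setT (EFin \o g) -> m2.-integrable setT (EFin \o h) ->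
  (forall x, 0 <= g x) -> (forall y, 0 <= h y) ->
  (forall x y, normc (f (x, y)) <= g x * h y) ->
  cintegral m1 setT (fun x => cintegral m2 setT (fun y => f (x, y))) =
  cintegral m2 setT (fun y => cintegral m1 setT (fun x => f (x, y))).
Proof.
move=> [mr mi] ig ih g0 h0 fgh; congr Complex => /=.
  apply: (Rintegral_fubini mr ig ih) => // x y.
  exact/(le_trans (normc_Re _)).
apply: (Rintegral_fubini mi ig ih) => // x y.
exact/(le_trans (normc_Im _)).
Qed.

End fubini.

(** * Lebesgue measure on row vectors: translations and Fubini *)

Lemma cintegral_pushforward d1 d2 (T1 : measurableType d1)
    (T2 : measurableType d2) (R : realType) (phi : T1 -> T2)
    (mphi : measurable_fun setT phi) (mu : {measure set T1 -> \bar R})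
    (nu : {measure set T2 -> \bar R}) (f : T2 -> R[i]) :
  (forall A, measurable A -> nu A = pushforward mu phi A) ->
  cmeasurable_fun f -> cintegrable mu setT (f \o phi) ->
  cintegral nu setT f = cintegral mu setT (f \o phi).
Proof.
move=> nuE [mr mi] [ir ii]; congr Complex; congr fine.
- rewrite (@eq_measure_integral _ _ _ _ (pushforward mu phi)) => [|A mA _].
    by rewrite integral_pushforward//; exact/measurable_EFinP.
  exact: nuE.
- rewrite (@eq_measure_integral _ _ _ _ (pushforward mu phi)) => [|A mA _].
    by rewrite integral_pushforward//; exact/measurable_EFinP.
  exact: nuE.
Qed.

Section translation1.
Context {R : realType}.
Local Notation leb1 := (@lebesgue_measure R).

Lemma lebesgue_measureD (c : R) (A : set R) : measurable A ->
  pushforward leb1 ((fun x => x + c) : _ -> measurableTypeR R) A = leb1 A.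
Proof.
move=> mA.
have mc : measurable_fun setT ((fun x => x + c) : R -> measurableTypeR R).
  exact: measurable_funD.
apply/esym.
apply: (@lebesgue_measure_unique R
  (measure_function_pushforward__canonical__measure_function_Measure
    leb1 mc)) => //= _ [[a b]] _ <-.
rewrite /pushforward (_ : _ @^-1` _ = `]a - c, b - c]%classic).
  by rewrite !lebesgue_measure_itv/= !lte_fin ltrD2r; case: ifPn => // _; rewrite -!EFinB; congr EFin; ring.
by apply/seteqP; split => x /=; rewrite !in_itv/= ltrBlDr lerBrDr.
Qed.

(** Translation invariance on the line, then on row vectors by induction on
    the dimension: one coordinate is translated at a time. *)
Lemma ge0_integral_translation1 (c : R) (f : R -> \bar R) :
  measurable_fun setT f -> (forall x, 0 <= f x)%E ->
  (\int[leb1]_x f ((x : R) + c)%R = \int[leb1]_x f x)%E.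
Proof.
move=> mf f0.
have mc : measurable_fun setT
    ((fun x => (x : R) + c) : measurableTypeR R -> measurableTypeR R).
  have : measurable_fun setT (fun x : R => x + c) by exact: measurable_funD.
  exact.
rewrite -[LHS](@ge0_integral_pushforward _ _ _ _ _ _ mc leb1 setT f)//.
by apply: eq_measure_integral => A mA _; exact: lebesgue_measureD.
Qed.
End translation1.

Section rV_measurability.
Context {R : realType} {n : nat} d (T : measurableType d).
Implicit Types (f g : T -> 'rV[R]_n).

Lemma measurable_coord f i : measurable_fun setT f ->
  measurable_fun setT (fun x => f x ord0 i).
Proof. by move=> mf; exact: (measurableT_comp (measurable_rV_coord i) mf). Qed.

Lemma measurable_dotp f g : measurable_fun setT f -> measurable_fun setT g ->
  measurable_fun setT (fun x => dotp (f x) (g x)).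
Proof.
move=> mf mg; apply: measurable_sum => i.
by apply: measurable_funM; exact: measurable_coord.
Qed.

Lemma measurable_sqnorm f : measurable_fun setT f ->
  measurable_fun setT (fun x => sqnorm (f x)).
Proof. by move=> mf; exact: measurable_dotp. Qed.

Lemma measurable_rVD f g : measurable_fun setT f -> measurable_fun setT g ->
  measurable_fun setT (fun x => f x + g x).
Proof.
move=> mf mg; apply: measurable_fun_rV => i; under eq_fun do rewrite mxE.
by apply: measurable_funD; exact: measurable_coord.
Qed.

Lemma measurable_rVN f : measurable_fun setT f ->
  measurable_fun setT (fun x => - f x).
Proof.
move=> mf; apply: measurable_fun_rV => i; under eq_fun do rewrite mxE.
by apply: measurableT_comp => //; exact: measurable_coord.
Qed.

Lemma measurable_rVB f g : measurable_fun setT f -> measurable_fun setT g ->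
  measurable_fun setT (fun x => f x - g x).
Proof. by move=> mf mg; exact/measurable_rVD/measurable_rVN. Qed.

End rV_measurability.

Section dot_product.
Context {R : realType} {n : nat}.
Implicit Types (u v w : 'rV[R]_n) (c : R).

Lemma dotpDl u v w : dotp (u + v) w = dotp u w + dotp v w.
Proof. by rewrite -big_split/=; apply: eq_bigr => i _; rewrite mxE mulrDl. Qed.

Lemma dotpC u v : dotp u v = dotp v u.
Proof. by apply: eq_bigr => i _; rewrite mulrC. Qed.

Lemma dotpDr u v w : dotp w (u + v) = dotp w u + dotp w v.
Proof. by rewrite dotpC dotpDl !(dotpC w). Qed.

Lemma dotpZl c u v : dotp (c *: u) v = c * dotp u v.
Proof. by rewrite mulr_sumr; apply: eq_bigr => i _; rewrite mxE mulrA. Qed.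

Lemma dotpZr c u v : dotp u (c *: v) = c * dotp u v.
Proof. by rewrite dotpC dotpZl dotpC. Qed.

Lemma dotpNl u v : dotp (- u) v = - dotp u v.
Proof. by rewrite -scaleN1r dotpZl mulN1r. Qed.

Lemma dotpNr u v : dotp u (- v) = - dotp u v.
Proof. by rewrite dotpC dotpNl dotpC. Qed.

Lemma dotp0l u : dotp 0 u = 0.
Proof. by rewrite -(scale0r (0 : 'rV[R]_n)) dotpZl mul0r. Qed.

Lemma dotp0r u : dotp u 0 = 0.
Proof. by rewrite dotpC dotp0l. Qed.

Lemma sqnorm_ge0 u : 0 <= sqnorm u.
Proof. by apply: sumr_ge0 => i _; rewrite -expr2 sqr_ge0. Qed.

Lemma sqnormE u : sqnorm u = \sum_i u ord0 i ^+ 2.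
Proof. by apply: eq_bigr => i _; rewrite expr2. Qed.

Lemma sqnorm_eq0 u : (sqnorm u == 0) = (u == 0).
Proof.
apply/eqP/eqP => [|->]; last by rewrite /sqnorm dotp0l.
rewrite sqnormE => /eqP; rewrite psumr_eq0 => [/allP h|i _]; last exact: sqr_ge0.
apply/rowP => i; rewrite mxE; apply/eqP; rewrite -sqrf_eq0.
by apply: h; exact: mem_index_enum.
Qed.

Lemma enorm_ge0 u : 0 <= enorm u.
Proof. exact: sqrtr_ge0. Qed.

Lemma sqr_enorm u : enorm u ^+ 2 = sqnorm u.
Proof. by rewrite sqr_sqrtr// sqnorm_ge0. Qed.

Lemma sqnormB u v : sqnorm (u - v) = sqnorm u - 2 * dotp u v + sqnorm v.
Proof.
rewrite /sqnorm dotpDl !dotpDr !dotpNl !dotpNr (dotpC v u); ring.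
Qed.

Lemma sqnormD u v : sqnorm (u + v) = sqnorm u + 2 * dotp u v + sqnorm v.
Proof. rewrite /sqnorm dotpDl !dotpDr (dotpC v u); ring. Qed.

Lemma sqnormZ c u : sqnorm (c *: u) = c ^+ 2 * sqnorm u.
Proof. by rewrite /sqnorm dotpZl dotpZr mulrA. Qed.

Lemma cauchy_schwarz u v : dotp u v ^+ 2 <= sqnorm u * sqnorm v.
Proof.
have [/eqP|v0] := eqVneq (sqnorm v) 0.
  rewrite sqnorm_eq0 => /eqP ->; by rewrite /sqnorm !dotp0r expr0n mulr0.
have vp : 0 < sqnorm v by rewrite lt_neqAle eq_sym v0 sqnorm_ge0.
have := sqnorm_ge0 (u - (dotp u v / sqnorm v) *: v).
rewrite sqnormB dotpZr sqnormZ.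
rewrite (_ : _ + _ = (sqnorm u * sqnorm v - dotp u v ^+ 2) / sqnorm v).
  by rewrite pmulr_lge0 ?invr_gt0// subr_ge0.
by field.
Qed.

Lemma dotp_le_enorm u v : `|dotp u v| <= enorm u * enorm v.
Proof.
rewrite -(@ler_pXn2r _ 2)// ?nnegrE ?mulr_ge0 ?enorm_ge0//.
by rewrite real_normK ?num_real// exprMn !sqr_enorm cauchy_schwarz.
Qed.

Lemma normr_coord_le u i : `|u ord0 i| <= enorm u.
Proof.
rewrite -(@ler_pXn2r _ 2)// ?nnegrE ?enorm_ge0// real_normK ?num_real//.
rewrite sqr_enorm sqnormE (bigD1 i)//= lerDl sumr_ge0// => j _.
exact: sqr_ge0.
Qed.

End dot_product.

Section lebesgue_rV_theory.
Context {R : realType}.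
Local Notation leb n := (@lebesgue_rV R n).
Local Notation leb1 := (@lebesgue_measure R).

Lemma ge0_integral_rVS n (f : 'rV[R]_n.+1 -> \bar R) :
  measurable_fun setT f -> (forall x, 0 <= f x)%E ->
  (\int[leb n.+1]_v f v = \int[leb1]_x \int[leb n]_v f (rV_cons (x, v)))%E.
Proof.
move=> mf f0.
rewrite (@eq_measure_integral _ _ _ _
  (pushforward (leb1 \x leb n)%E (@rV_cons R n)))//.
  exact: measurable_rV_cons.
move=> mc; rewrite (ge0_integral_pushforward mc)//.
rewrite preimage_setT fubini_tonelli1//; last by move=> x; exact: f0.
by apply: (measurableT_comp mf); exact: measurable_rV_cons.
Qed.

Lemma rV_consD n (x y : R) (v w : 'rV[R]_n) :
  rV_cons (x, v) + rV_cons (y, w) = rV_cons (x + y, v + w).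
Proof.
by apply/rowP => i; rewrite !mxE; case: unliftP => [j _|_]//=; rewrite mxE.
Qed.

Lemma measurable_rV_cons1 n (x : R) : measurable_fun setT
  (fun v : 'rV[R]_n => rV_cons (x, v)).
Proof.
exact: (measurableT_comp (@measurable_rV_cons R n) (measurable_pair1 x)).
Qed.

Lemma ge0_integral_translation n (a : 'rV[R]_n) (f : 'rV[R]_n -> \bar R) :
  measurable_fun setT f -> (forall x, 0 <= f x)%E ->
  (\int[leb n]_v f (v + a)%R = \int[leb n]_v f v)%E.
Proof.
elim: n a f => [|n IH] a f mf f0.
  apply: eq_integral => v _; congr f.
  by apply/rowP => -[].
rewrite (ge0_integral_rVS mf f0) (ge0_integral_rVS (f := fun v => f (v + a)));
  [|by apply: (measurableT_comp mf); exact: measurable_rVD|by []].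
have aE : a = rV_cons (a ord0 ord0, \row_j a ord0 (lift ord0 j)).
  by rewrite -[LHS]rV_unconsK.
transitivity (\int[leb1]_x \int[leb n]_v f (rV_cons (((x : R) + a ord0 ord0)%R, v)))%E.
  apply: eq_integral => x _; under eq_integral do rewrite {1}aE rV_consD.
  apply: (IH _ (fun v => f (rV_cons (x + a ord0 ord0, v)))) => //.
  by apply: (measurableT_comp mf); exact: measurable_rV_cons1.
apply: (ge0_integral_translation1 (a ord0 ord0)
  (f := fun x => \int[leb n]_v f (rV_cons (x, v)))%E).
  apply: (measurable_fun_fubini_tonelli_F (fun p => f (rV_cons p))) => //.
  by apply: (measurableT_comp mf); exact: measurable_rV_cons.
by move=> x; exact: integral_ge0.
Qed.

Lemma Rintegral_translation n (a : 'rV[R]_n) (g : 'rV[R]_n -> R) :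
  measurable_fun setT g ->
  \int[leb n]_(v in setT) g (v + a) = \int[leb n]_(v in setT) g v.
Proof.
move=> mg; have mgE : measurable_fun setT (EFin \o g) by exact/measurable_EFinP.
congr fine; rewrite integralE [RHS]integralE; congr (_ - _)%E.
  rewrite -[RHS](ge0_integral_translation a) //.
  - by apply: eq_integral => v _; rewrite !funepos.unlock.
  - exact: measurable_funepos.
rewrite -[RHS](ge0_integral_translation a) //.
- by apply: eq_integral => v _; rewrite !funeneg.unlock.
- exact: measurable_funeneg.
Qed.

Lemma cintegral_translation n (a : 'rV[R]_n) (f : 'rV[R]_n -> R[i]) :
  cmeasurable_fun f ->
  cintegral (leb n) setT (fun v => f (v + a)) = cintegral (leb n) setT f.
Proof.
by move=> [mr mi]; congr Complex; [exact: Rintegral_translation mr|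
  exact: Rintegral_translation mi].
Qed.

Lemma measurable_rV_prod n (f : 'I_n -> R -> R) :
  (forall i, measurable_fun setT (f i)) ->
  measurable_fun setT (fun v : 'rV[R]_n => \prod_(i < n) f i (v ord0 i)).
Proof.
move=> mf; apply: measurable_prod => i _; apply: (measurableT_comp (mf i)).
exact: measurable_rV_coord.
Qed.

Lemma ge0_integral_prod n (f : 'I_n -> R -> R) :
  (forall i, measurable_fun setT (f i)) -> (forall i x, 0 <= f i x) ->
  (\int[leb n]_v (\prod_(i < n) f i (v ord0 i))%:E =
   \prod_(i < n) \int[leb1]_x (f i x)%:E)%E.
Proof.
elim: n f => [|n IH] f mf f0.
  rewrite big_ord0; under eq_integral do rewrite big_ord0.
  by rewrite integral_cst//= diracT mul1e.
rewrite ge0_integral_rVS; last 2 first.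
- by apply/measurable_EFinP; exact: measurable_rV_prod.
- by move=> v; rewrite lee_fin; apply: prodr_ge0.
rewrite big_ord_recl -IH//.
transitivity (\int[leb1]_x ((f ord0 x)%:E * \int[leb n]_v
    (\prod_(i < n) f (lift ord0 i) (v ord0 i))%:E))%E.
  apply: eq_integral => x _.
  under eq_integral => v _.
    rewrite big_ord_recl mxE unlift_none/=.
    under eq_bigr do rewrite mxE liftK/=.
    rewrite EFinM; over.
  rewrite ge0_integralZl ?lee_fin//.
  - apply/measurable_EFinP.
    exact: (measurable_rV_prod (f := fun i => f (lift ord0 i))).
  - by move=> v _; rewrite lee_fin; apply: prodr_ge0.
rewrite ge0_integralZr//.
- by apply/measurable_EFinP; exact: mf.
- by move=> x _; rewrite lee_fin.
- by apply: integral_ge0 => v _; rewrite lee_fin; apply: prodr_ge0.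
Qed.

Lemma cintegral_rVS n (f : 'rV[R]_n.+1 -> R[i]) (g : R -> R) (h : 'rV[R]_n -> R) :
  cmeasurable_fun f ->
  leb1.-integrable setT (EFin \o g) -> (leb n).-integrable setT (EFin \o h) ->
  (forall x, 0 <= g x) -> (forall v, 0 <= h v) ->
  (forall x v, normc (f (rV_cons (x, v))) <= g x * h v) ->
  cintegral (leb n.+1) setT f =
  cintegral leb1 setT
    (fun x => cintegral (leb n) setT (fun v => f (rV_cons (x, v)))).
Proof.
move=> mf ig ih g0 h0 fgh.
have mc : measurable_fun [set: measurableTypeR R * 'rV[R]_n] (@rV_cons R n).
  exact: measurable_rV_cons.
have mfc : cmeasurable_fun (fun p : measurableTypeR R * 'rV[R]_n => f (rV_cons p)).
  exact: cmeasurable_comp mc mf.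
rewrite -(cintegral_product (f := fun p : measurableTypeR R * 'rV[R]_n =>
  f (rV_cons p)) mfc ig ih)//.
apply: (cintegral_pushforward mc) => //; split.
  apply: (integrable_product mfc.1 ig ih) => // x v.
  exact: le_trans (normc_Re _) _.
apply: (integrable_product mfc.2 ig ih) => // x v.
exact: le_trans (normc_Im _) _.
Qed.

(** Fubini for products of functions of one coordinate each; this reduces the
    Fourier transform of a Gaussian to dimension one. *)
Lemma cintegral_prod n (f : 'I_n -> R -> R[i]) (g : 'I_n -> R -> R) :
  (forall i, cmeasurable_fun (f i)) ->
  (forall i, leb1.-integrable setT (EFin \o g i)) ->
  (forall i x, normc (f i x) <= g i x) ->
  cintegral (leb n) setT (fun v => \prod_(i < n) f i (v ord0 i)) =
   \prod_(i < n) cintegral leb1 setT (f i).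
Proof.
elim: n f g => [|n IH] f g mf ig fg.
  rewrite big_ord0; under [LHS]eq_cintegral do rewrite big_ord0.
  have e : leb 0 setT = 1%E by rewrite /= diracT.
  by rewrite /cintegral !Rintegral_cst// [X in fine X]e mulr1 mul0r.
have g0 i x : 0 <= g i x by exact: le_trans (normc_ge0 _) (fg _ _).
have mg i : measurable_fun setT (g i).
  by have /integrableP[/measurable_EFinP] := ig i.
have mP k (h : 'I_k -> R -> R[i]) : (forall i, cmeasurable_fun (h i)) ->
    cmeasurable_fun (fun v : 'rV[R]_k => \prod_(i < k) h i (v ord0 i)).
  move=> mh; apply: cmeasurable_prod => i; apply: (cmeasurable_comp _ (mh i)).
  exact: measurable_rV_coord.
have nP k (h : 'I_k -> R[i]) : normc (\prod_(i < k) h i) = \prod_(i < k) normc (h i).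
  by elim/big_rec2: _ => [|i a b _ <-]; rewrite ?Normc.normc1 ?Normc.normcM.
pose h (v : 'rV[R]_n) := \prod_(i < n) g (lift ord0 i) (v ord0 i).
have ih : (leb n).-integrable setT (EFin \o h).
  apply/integrableP; split.
    apply/measurable_EFinP.
    exact: (measurable_rV_prod (f := fun i => g (lift ord0 i))).
  under eq_integral do rewrite gee0_abs ?lee_fin ?prodr_ge0//.
  rewrite (@ge0_integral_prod n (fun i => g (lift ord0 i)))//.
  rewrite ltey_eq; apply/orP; left.
  elim/big_ind: _ => // [x y|i _]; first exact: fin_numM.
  exact: (integrable_fin_num measurableT (ig (lift ord0 i))).
rewrite (cintegral_rVS (g := g ord0) (h := h))//; last 2 first.
- by move=> v; rewrite /h prodr_ge0.
- move=> x v; rewrite big_ord_recl mxE unlift_none/=.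
  under eq_bigr do rewrite mxE liftK/=.
  rewrite Normc.normcM nP; apply: ler_pM; rewrite ?normc_ge0 ?prodr_ge0//.
    by move=> i _; exact: normc_ge0.
  by apply: ler_prod => i _; rewrite normc_ge0/=.
rewrite big_ord_recl -[X in _ = _ * X](IH _ (fun i => g (lift ord0 i)))//.
have ig0 : cintegrable leb1 setT (f ord0).
  apply: (@cintegrable_le _ _ _ leb1 setT _ (f ord0) (g ord0)) => //.
  exact: mf.
transitivity (cintegral leb1 setT (fun x => cintegral (leb n) setT
    (fun v => \prod_(i < n) f (lift ord0 i) (v ord0 i)) * f ord0 x)).
  apply: eq_cintegral => x _; rewrite mulrC -cintegralZl//; last first.
    apply: (cintegrable_le _ _ ih) => //.
      exact: (mP _ (fun i => f (lift ord0 i))).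
    move=> v _; rewrite nP; apply: ler_prod => i _.
    by rewrite normc_ge0/=.
  apply: eq_cintegral => v _; rewrite big_ord_recl mxE unlift_none/=.
  by under eq_bigr do rewrite mxE liftK/=.
  by rewrite cintegralZl// mulrC.
exact: mP.
Qed.

End lebesgue_rV_theory.

(** * The Fourier transform of a Gaussian on the line *)

(** Differentiation under the integral sign, in terms of [is_derive] so that the
    derivatives of the integrand can be computed by type class resolution. *)
Lemma is_derive_Rintegral {R : realType} d (T : measurableType d)
    (mu : {measure set T -> \bar R}) (D : set T) (f f' : R -> T -> R)
    (a e : R) (G : T -> R) :
  measurable D -> 0 < e ->
  (forall x, `|x - a| < e -> mu.-integrable D (EFin \o f x)) ->
  (forall x y, `|x - a| < e -> D y -> is_derive x (1 : R) (f^~ y) (f' x y)) ->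
  mu.-integrable D (EFin \o G) ->
  (forall x y, `|x - a| < e -> D y -> `|f' x y| <= G y) ->
  is_derive a (1 : R) (fun x => \int[mu]_(y in D) f x y)
    (\int[mu]_(y in D) f' a y).
Proof.
move=> mD e0 intf df iG fG.
have Ie x : `]a - e, a + e[%classic x -> `|x - a| < e.
  by rewrite /= in_itv/= ltr_distl.
have Ia : `]a - e, a + e[%classic a.
  by rewrite /= in_itv/= ltrDl e0 gtrBl e0.
have d1E x y : `]a - e, a + e[%classic x -> D y -> partial1of2 f x y = f' x y.
  move=> /Ie xe Dy; rewrite partial1of2E.
  exact: (@derive_val _ _ _ _ _ _ _ (df x y xe Dy)).
have derf x y : `]a - e, a + e[%classic x -> D y -> derivable (f ^~ y) x 1.
  by move=> /Ie xe Dy; exact: (@ex_derive _ _ _ _ _ _ _ (df x y xe Dy)).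
have inf x : `]a - e, a + e[%classic x -> mu.-integrable D (EFin \o f x).
  by move=> /Ie; exact: intf.
pose H y := `|G y|.
have H0 y : 0 <= H y by exact: normr_ge0.
have iH : mu.-integrable D (EFin \o H) by exact: integrable_norm.
have Gub x y : `]a - e, a + e[%classic x -> D y -> `|partial1of2 f x y| <= H y.
  move=> xe Dy; rewrite d1E// (le_trans (fG _ _ (Ie _ xe) Dy))//.
  exact: ler_norm.
apply: DeriveDef.
  exact: (derivable_under_integral mD Ia inf derf H0 iH Gub).
rewrite -derive1E (differentiation_under_integral mD Ia inf derf H0 iH Gub).
by apply: eq_Rintegral => y; rewrite inE => Dy; exact: d1E.
Qed.

Section gaussian1.
Context {R : realType}.
Local Notation leb1 := (@lebesgue_measure R).

Definition gauss1 (s u : R) : R := expR (- (s * u ^+ 2)).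

Lemma gauss1_ge0 s u : 0 <= gauss1 s u. Proof. exact: expR_ge0. Qed.

Lemma measurable_gauss1 s : measurable_fun setT (gauss1 s).
Proof.
apply: measurableT_comp => //; apply: measurableT_comp => //.
by apply: measurable_funM => //; exact: measurable_funX.
Qed.

Variable s : R.
Hypothesis s0 : 0 < s.

Lemma integral_gauss1 :
  (\int[leb1]_x (gauss1 s x)%:E = (Num.sqrt (pi / s))%:E)%E.
Proof.
pose sigma : R := Num.sqrt (2 * s)^-1.
have sg : sigma ^+ 2 = (2 * s)^-1.
  by rewrite sqr_sqrtr// invr_ge0 mulr_ge0// ltW.
have sigma0 : sigma != 0.
  by rewrite -sqrf_eq0 sg invr_eq0 mulf_neq0// gt_eqF.
have pk0 := normal_peak_gt0 sigma0.
have -> : Num.sqrt (pi / s) = (normal_peak sigma)^-1.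
  rewrite /normal_peak invrK; congr Num.sqrt; rewrite sg -mulr_natr.
  by field; rewrite gt_eqF.
have := integral_normal_pdf (0 : R) sigma.
under eq_integral => x _.
  rewrite normal_pdfE// (_ : normal_fun 0 sigma x = gauss1 s x); last first.
    rewrite /normal_fun /gauss1 subr0 sg; congr expR; rewrite -mulr_natr.
    by field; rewrite gt_eqF.
  rewrite EFinM; over.
rewrite ge0_integralZl//=; last 3 first.
- by apply/measurable_EFinP; exact: measurable_gauss1.
- by move=> x _; rewrite lee_fin gauss1_ge0.
- by rewrite lee_fin ltW.
move=> /(congr1 (fun z => (normal_peak sigma)^-1%:E * z)%E).
by rewrite muleA -EFinM mulVf ?gt_eqF// mul1e mule1.
Qed.

Lemma integrable_gauss1 : leb1.-integrable setT (EFin \o gauss1 s).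
Proof.
apply/integrableP; split; first by apply/measurable_EFinP; exact: measurable_gauss1.
under eq_integral do rewrite gee0_abs ?lee_fin ?gauss1_ge0//.
by rewrite integral_gauss1 ltry.
Qed.

End gaussian1.

Section gaussian1_fourier.
Context {R : realType}.
Local Notation leb1 := (@lebesgue_measure R).
Variable s : R.
Hypothesis s0 : 0 < s.

(** Half of the Gaussian absorbs the factor |u| that a differentiation in the
    Fourier variable produces. *)
Lemma gauss1_moment u : `|u| * gauss1 s u <= (1 + 2 / s) * gauss1 (s / 2) u.
Proof.
have -> : gauss1 s u = gauss1 (s / 2) u * gauss1 (s / 2) u.
  by rewrite /gauss1 -expRD; congr expR; field.
rewrite mulrA ler_wpM2r ?gauss1_ge0//.
have := expR_ge1Dx (s / 2 * u ^+ 2).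
set E := expR _ => hE.
have E1 : 1 <= E.
  by apply: le_trans hE; rewrite lerDl mulr_ge0 ?sqr_ge0// divr_ge0// ltW.
have -> : gauss1 (s / 2) u = E^-1 by rewrite /gauss1 expRN.
rewrite ler_pdivrMr ?(lt_le_trans _ E1)//.
have h2 : u ^+ 2 <= 2 / s * E.
  apply: (@le_trans _ _ (2 / s * (s / 2 * u ^+ 2))).
    by rewrite mulrA (_ : 2 / s * (s / 2) = 1) ?mul1r//; field; rewrite gt_eqF.
  by rewrite ler_wpM2l// ?divr_ge0// ?ltW//; lra.
have h1 : `|u| <= 1 + u ^+ 2.
  by rewrite -(real_normK (num_real u)); have := sqr_ge0 (`|u| - 1); rewrite !expr2; nra.
lra.
Qed.

Lemma gauss1_shift_le (r tau u : R) : 0 < r -> `|tau| < 1 ->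
  gauss1 r (u + tau) <= expR r * gauss1 (r / 2) u.
Proof.
move=> r0 t1; rewrite /gauss1 -expRD ler_expR.
have tau2 : tau ^+ 2 <= 1.
  by rewrite -(real_normK (num_real tau)) expr_le1// ltW.
have := sqr_ge0 (u + 2 * tau); rewrite !expr2 in tau2 *.
nra.
Qed.

Let ig r : 0 < r -> leb1.-integrable setT (EFin \o gauss1 r).
Proof. exact: integrable_gauss1. Qed.

Lemma integrable_dom_gauss1 (f : R -> R) (C r : R) : 0 < r ->
  measurable_fun setT f -> (forall u, `|f u| <= C * gauss1 r u) ->
  leb1.-integrable setT (EFin \o f).
Proof.
move=> r0 mf fC; have := integrableZl measurableT C (ig r0).
apply: le_integrable => //; first by apply/measurable_EFinP; exact: mf.
by move=> u _ /=; rewrite lee_fin (le_trans (fC u))// ler_norm.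
Qed.

Lemma Rintegral_translation1 (c : R) (f : R -> R) : measurable_fun setT f ->
  \int[leb1]_(x in setT) f ((x : R) + c) = \int[leb1]_(x in setT) f x.
Proof.
move=> mf; have mfE : measurable_fun setT (EFin \o f) by exact/measurable_EFinP.
congr fine; rewrite integralE [RHS]integralE; congr (_ - _)%E.
  rewrite -[RHS](ge0_integral_translation1 c) //.
  - by apply: eq_integral => v _; rewrite !funepos.unlock.
  - exact: measurable_funepos.
rewrite -[RHS](ge0_integral_translation1 c) //.
- by apply: eq_integral => v _; rewrite !funeneg.unlock.
- exact: measurable_funeneg.
Qed.

(* A phase theta treats cosine and sine integrals at once: theta = 0 gives the
   real part of the Fourier transform, theta = - pi / 2 the imaginary part. *)
Variables (theta : R).

Let mlin (x : R) : measurable_fun setT (fun u : R => x * u + theta).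
Proof. by apply: measurable_funD => //; exact: measurable_funM. Qed.

Let mcos (x : R) : measurable_fun setT (fun u : R => cos (x * u + theta)).
Proof.
exact: (measurableT_comp (continuous_measurable_fun (@continuous_cos R)) (mlin x)).
Qed.

Let msin (x : R) : measurable_fun setT (fun u : R => sin (x * u + theta)).
Proof.
exact: (measurableT_comp (continuous_measurable_fun (@continuous_sin R)) (mlin x)).
Qed.

Let h (x : R) := \int[leb1]_(u in setT) (cos (x * u + theta) * gauss1 s u).
Let k (x : R) := \int[leb1]_(u in setT) ((u : R) * sin (x * u + theta) * gauss1 s u).

Let int_cos x : leb1.-integrable setT
  (EFin \o (fun u => cos (x * u + theta) * gauss1 s u)).
Proof.
apply: (@integrable_dom_gauss1 _ 1 s) => //.
  by apply: measurable_funM => //; exact: measurable_gauss1.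
move=> u; rewrite mul1r normrM (ger0_norm (gauss1_ge0 _ _)).
by rewrite ler_piMl ?gauss1_ge0// cos_max.
Qed.

Let int_usin x : leb1.-integrable setT
  (EFin \o (fun u => u * sin (x * u + theta) * gauss1 s u)).
Proof.
apply: (@integrable_dom_gauss1 _ (1 + 2 / s) (s / 2)).
- by rewrite divr_gt0.
- by apply: measurable_funM => //; [exact: measurable_funM|exact: measurable_gauss1].
- move=> u; apply: le_trans (gauss1_moment u).
  rewrite !normrM (ger0_norm (gauss1_ge0 _ _)) ler_wpM2r ?gauss1_ge0//.
  by rewrite ler_piMr// sin_max.
Qed.

Let derive_h (x : R) : is_derive x (1 : R) h (- k x).
Proof.
have -> : - k x = \int[leb1]_(u in setT) (- (u * sin (x * u + theta)) * gauss1 s u).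
  rewrite -mulN1r -RintegralZl//; apply: eq_Rintegral => u _; ring.
apply: (@is_derive_Rintegral R _ _ leb1 setT
  (fun x u => cos (x * u + theta) * gauss1 s u)
  (fun x u => - (u * sin (x * u + theta)) * gauss1 s u) x 1
  (fun u => (1 + 2 / s) * gauss1 (s / 2) u)) => //.
- move=> y u _ _.
  apply: is_derive_eq.
  rewrite !scaler0 add0r addr0 !scaler1 /GRing.scale /=; ring.
- apply: (@integrable_dom_gauss1 _ (1 + 2 / s) (s / 2)).
  + by rewrite divr_gt0.
  + by apply: measurable_funM => //; exact: measurable_gauss1.
  + move=> u; rewrite ger0_norm// mulr_ge0 ?gauss1_ge0// addr_ge0// divr_ge0//.
    exact: ltW.
- move=> y u _ _; apply: le_trans (gauss1_moment u).
  rewrite !normrM normrN (ger0_norm (gauss1_ge0 _ _)) ler_wpM2r ?gauss1_ge0//.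
  by rewrite normrM ler_piMr// sin_max.
Qed.

(* the integral is invariant under u |-> u + tau; differentiating this
   invariance at tau = 0 replaces an integration by parts *)
Let parts x : x * h x = 2 * s * k x.
Proof.
pose f (tau u : R) := sin (x * (u + tau) + theta) * gauss1 s (u + tau).
pose f' (tau u : R) := (x * cos (x * (u + tau) + theta) -
  2 * s * (u + tau) * sin (x * (u + tau) + theta)) * gauss1 s (u + tau).
have mf0 : measurable_fun setT (fun u => sin (x * u + theta) * gauss1 s u).
  by apply: measurable_funM => //; exact: measurable_gauss1.
have mD (tau : R) : measurable_fun setT (fun u : R => u + tau) by exact: measurable_funD.
have mft tau : measurable_fun setT (f tau).
  exact: (measurableT_comp mf0 (mD tau)).
have bs : forall tau u, `|tau| < 1 -> `|f tau u| <= expR s * gauss1 (s / 2) u.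
  move=> tau u t1; apply: le_trans (gauss1_shift_le _ s0 t1).
  rewrite /f normrM (ger0_norm (gauss1_ge0 _ _)).
  by rewrite ler_piMl ?gauss1_ge0// sin_max.
pose C : R := `|x| + 2 * s * (1 + 2 / s).
have C0 : 0 <= C by rewrite addr_ge0// !mulr_ge0 ?addr_ge0 ?divr_ge0// ltW.
have bs' tau u : `|tau| < 1 -> `|f' tau u| <= C * (expR (s / 2) * gauss1 (s / 2 / 2) u).
  move=> t1; apply: (@le_trans _ _ (C * gauss1 (s / 2) (u + tau))); last first.
    by rewrite ler_wpM2l// gauss1_shift_le// divr_gt0.
  rewrite /f'; set v := u + tau.
  have g2 : gauss1 s v <= gauss1 (s / 2) v.
    rewrite ler_expR lerN2 ler_wpM2r ?sqr_ge0//.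
    by rewrite ler_pdivrMr// ler_peMr ?ler1n// ltW.
  rewrite mulrBl; apply: (le_trans (ler_normB _ _)).
  rewrite /C [leRHS]mulrDl; apply: lerD; rewrite !normrM (ger0_norm (gauss1_ge0 _ _)).
    apply: ler_pM => //; rewrite ?mulr_ge0 ?gauss1_ge0//.
    by rewrite ler_piMr// cos_max.
  have := gauss1_moment v; rewrite (ger0_norm (ltW s0)) (ger0_norm (ler0n _ 2)).
  have := sin_max (x * v + theta); have := normr_ge0 v; have := gauss1_ge0 s v.
  move=> a1 a2 a3 a4; rewrite -!mulrA ler_wpM2l// ler_wpM2l ?(ltW s0)//.
  apply: le_trans a4; rewrite ler_wpM2l// ler_piMl//.
have df : is_derive 0 (1 : R) (fun tau => \int[leb1]_(u in setT) f tau u)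
    (\int[leb1]_(u in setT) f' 0 u).
  apply: (@is_derive_Rintegral R _ _ leb1 setT f f' 0 1
    (fun u => C * (expR (s / 2) * gauss1 (s / 2 / 2) u))) => //.
  - move=> tau; rewrite subr0 => t1.
    apply: (@integrable_dom_gauss1 _ (expR s) (s / 2)) => //.
      by rewrite divr_gt0.
    by move=> u; exact: bs.
  - move=> tau u _ _; rewrite /f /f' /gauss1.
    apply: is_derive_eq.
    rewrite /GRing.scale /= !expr2; ring.
  - apply: (@integrable_dom_gauss1 _ (C * expR (s / 2)) (s / 2 / 2)).
    + by rewrite !divr_gt0.
    + apply: measurable_funM => //; apply: measurable_funM => //.
      exact: measurable_gauss1.
    + move=> u; rewrite ger0_norm ?mulrA//.
      by rewrite !mulr_ge0 ?gauss1_ge0 ?expR_ge0.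
  - by move=> tau u; rewrite subr0 => t1 _; exact: bs'.
have cst0 : (fun tau => \int[leb1]_(u in setT) f tau u) =
    cst (\int[leb1]_(u in setT) (sin (x * u + theta) * gauss1 s u)).
  apply/funext => tau; exact: (Rintegral_translation1 tau mf0).
rewrite cst0 in df.
have e0 : \int[leb1]_(u in setT) f' 0 u = 0.
  have := @derive_val _ _ _ _ _ _ _ df; rewrite derive_cst => <-//.
have fE u : f' 0 u = x * (cos (x * u + theta) * gauss1 s u) -
    2 * s * (u * sin (x * u + theta) * gauss1 s u).
  by rewrite /f' addr0; ring.
move: e0; under eq_Rintegral do rewrite fE.
rewrite RintegralB//; last 2 first.
- exact: (integrableZl measurableT x (int_cos x)).
- exact: (integrableZl measurableT (2 * s) (int_usin x)).
by rewrite !RintegralZl// => /eqP; rewrite subr_eq0 => /eqP.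
Qed.

(** The integral h satisfies the differential equation h' = - x h / (2 s), from
    [derive_h] and [parts], so its product with exp(x^2 / (4 s)) is constant. *)
Lemma Rintegral_cos_gauss1 x :
  \int[leb1]_(u in setT) (cos (x * u + theta) * gauss1 s u) =
  cos theta * Num.sqrt (pi / s) * expR (- (x ^+ 2 / (4 * s))).
Proof.
rewrite -/(h x).
pose H x := h x * expR (x ^+ 2 / (4 * s)).
have dH y : is_derive y (1 : R) H 0.
  have dh := derive_h y.
  apply: is_derive_eq.
  rewrite /GRing.scale /=.
  have := parts y => e.
  have -> : k y = y * h y / (2 * s) by rewrite e; field; rewrite gt_eqF.
  field. by rewrite gt_eqF.
have HE : H x = H 0 by apply: is_derive_0_is_cst.
have H0 : H 0 = cos theta * Num.sqrt (pi / s).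
  rewrite /H expr0n mul0r expR0 mulr1 /h.
  under eq_Rintegral do rewrite mul0r add0r.
  rewrite RintegralZl//; last exact: ig.
  by rewrite /Rintegral integral_gauss1.
by rewrite -H0 -HE /H -mulrA -expRD subrr expR0 mulr1.
Qed.

End gaussian1_fourier.

Lemma fourier_gauss1 {R : realType} (s x : R) : 0 < s ->
  cintegral (@lebesgue_measure R) setT (fun u => expi (x * u) * (gauss1 s u)%:C)
  = (Num.sqrt (pi / s) * expR (- (x ^+ 2 / (4 * s))))%:C.
Proof.
move=> s0; congr Complex.
  have := Rintegral_cos_gauss1 s0 0 x; rewrite cos0 mul1r => <-.
  by apply: eq_Rintegral => u _ /=; rewrite addr0 mulr0 subr0.
have := Rintegral_cos_gauss1 s0 (- (pi / 2)) x; rewrite cosN cos_pihalf !mul0r => <-.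
apply: eq_Rintegral => u _ /=; rewrite mulr0 add0r; congr (_ * _).
by rewrite -cosBpihalf.
Qed.

(** * Gaussian Fourier integrals and the multipliers that preserve their L1 bounds *)

Section gaussian.
Context {R : realType} {n : nat}.
Local Notation V := 'rV[R]_n.
Local Notation leb := (@lebesgue_rV R n).
Implicit Types (u x y : V) (s : R).

Definition gauss (s : R) (u : V) : R := expR (- (s * sqnorm u)).

Lemma gauss_ge0 s u : 0 <= gauss s u. Proof. exact: expR_ge0. Qed.

Lemma measurable_gauss s : measurable_fun setT (gauss s).
Proof.
apply: measurableT_comp => //; apply: measurableT_comp => //.
by apply: measurable_funM => //; exact: measurable_sqnorm.
Qed.

Lemma gauss_prod s u : gauss s u = \prod_(i < n) gauss1 s (u ord0 i).
Proof.
by rewrite /gauss1 -expR_sum /gauss sqnormE mulr_sumr sumrN.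
Qed.

Lemma integral_gauss s : 0 < s ->
  (\int[leb]_u (gauss s u)%:E = (Num.sqrt (pi / s) ^+ n)%:E)%E.
Proof.
move=> s0; under eq_integral do rewrite gauss_prod.
rewrite (@ge0_integral_prod R n (fun=> gauss1 s)).
- under eq_bigr do rewrite integral_gauss1//.
  by rewrite prodEFin prodr_const card_ord.
- by move=> _; exact: measurable_gauss1.
- by move=> _ x; exact: gauss1_ge0.
Qed.

Lemma integrable_gauss s : 0 < s -> leb.-integrable setT (EFin \o gauss s).
Proof.
move=> s0; apply/integrableP; split.
  by apply/measurable_EFinP; exact: measurable_gauss.
under eq_integral do rewrite gee0_abs ?lee_fin ?gauss_ge0//.
by rewrite integral_gauss// ltry.
Qed.

Lemma fourier_gauss s x : 0 < s ->
  cintegral leb setT (fun u => expi (dotp x u) * (gauss s u)%:C) =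
  (Num.sqrt (pi / s) ^+ n * gauss (4 * s)^-1 x)%:C.
Proof.
move=> s0.
have expi_sum (I : Type) (r : seq I) (F : I -> R) :
    expi (\sum_(i <- r) F i) = \prod_(i <- r) expi (F i).
  by elim/big_rec2: _ => [|i a b _ <-]; rewrite ?expi0 ?expiD.
transitivity (cintegral leb setT (fun u => \prod_(i < n)
    (expi (x ord0 i * u ord0 i) * (gauss1 s (u ord0 i))%:C))).
  apply: eq_cintegral => u _.
  by rewrite big_split/= -expi_sum gauss_prod rmorph_prod.
rewrite (@cintegral_prod R n
  (fun i t => expi (x ord0 i * t) * (gauss1 s t)%:C) (fun=> gauss1 s)).
- under eq_bigr do rewrite fourier_gauss1//.
  rewrite -rmorph_prod big_split/= prodr_const card_ord -expR_sum.
  congr (_ * expR _)%:C; rewrite sqnormE sumrN mulr_sumr; congr (- _).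
  by apply: eq_bigr => i _; rewrite mulrC.
- move=> i; apply: cmeasurableM.
    by apply: cmeasurable_expi; exact: measurable_funM.
  by apply: cmeasurable_real; exact: measurable_gauss1.
- by move=> i; exact: integrable_gauss1.
- by move=> i t; rewrite Normc.normcM normc_expi mul1r normc_real ger0_norm ?gauss1_ge0.
Qed.

(** Completing the square costs half of the Gaussian; this bounds the integrands
    of Fourier integrals at complex points. *)
Lemma expR_gauss_le (c s : R) u : 0 < s ->
  expR (c * enorm u) * gauss s u <= expR (c ^+ 2 / (2 * s)) * gauss (s / 2) u.
Proof.
move=> s0; rewrite /gauss -!expRD ler_expR -sqr_enorm.
rewrite -subr_ge0.
have -> : c ^+ 2 / (2 * s) - s / 2 * enorm u ^+ 2 -
    (c * enorm u - s * enorm u ^+ 2) = (c - s * enorm u) ^+ 2 / (2 * s).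
  by field; rewrite gt_eqF.
by rewrite divr_ge0 ?sqr_ge0// mulr_ge0// ltW.
Qed.

Lemma expR_dotp_gauss_le s y u : 0 < s ->
  expR (dotp y u) * gauss s u <= expR (sqnorm y / (2 * s)) * gauss (s / 2) u.
Proof.
move=> s0; apply: le_trans (_ : expR (enorm y * enorm u) * gauss s u <= _).
  rewrite ler_wpM2r ?gauss_ge0// ler_expR.
  exact: le_trans (ler_norm _) (dotp_le_enorm _ _).
by rewrite -[in leRHS]sqr_enorm expR_gauss_le.
Qed.

End gaussian.

Section gauss_fourier.
Context {R : realType} {n : nat}.
Local Notation V := 'rV[R]_n.
Local Notation leb := (@lebesgue_rV R n).
Variable s : R.
Hypothesis s0 : 0 < s.
Implicit Types (v w : V -> R[i]) (x y u : V).

(** An integrable majorant of [fourier_kernel], up to the bound of v. *)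
Definition kernel_bound (y u : V) : R :=
  expR (sqnorm y / (2 * s)) * gauss (s / 2) u.

Lemma kernel_bound_ge0 y u : 0 <= kernel_bound y u.
Proof. by rewrite mulr_ge0 ?expR_ge0 ?gauss_ge0. Qed.

Lemma integrable_kernel_bound (B : R) y :
  leb.-integrable setT (EFin \o (fun u => B * kernel_bound y u)).
Proof.
have s20 : 0 < s / 2 by rewrite divr_gt0.
have := integrableZl measurableT (B * expR (sqnorm y / (2 * s)))
  (@integrable_gauss R n _ s20).
by apply: eq_integrable => // u _ /=; rewrite -EFinM mulrA.
Qed.

(** The integrand exp(- i (x + i y).u) exp(- s |u|^2) v(u) of the inverse Fourier
    transform at the complex point x + i y. *)
Definition fourier_kernel (v : V -> R[i]) (x y u : V) : R[i] :=
  expi (- dotp x u) * ((expR (dotp y u) * gauss s u)%:C * v u).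

Definition gauss_fourier (v : V -> R[i]) (x y : V) : R[i] :=
  cintegral leb setT (fourier_kernel v x y).

Lemma normc_fourier_kernel v x y u (B : R) : normc (v u) <= B ->
  normc (fourier_kernel v x y u) <= B * kernel_bound y u.
Proof.
move=> vB; rewrite !Normc.normcM normc_expi mul1r normc_real mulrC.
apply: ler_pM => //; first exact: normc_ge0.
by rewrite ger0_norm ?expR_dotp_gauss_le// mulr_ge0 ?expR_ge0 ?gauss_ge0.
Qed.

Lemma cmeasurable_fourier_kernel d (T : measurableType d) (fx fy fu : T -> V)
    (fv : T -> R[i]) :
  measurable_fun setT fx -> measurable_fun setT fy ->
  measurable_fun setT fu -> cmeasurable_fun fv ->
  cmeasurable_fun (fun p => expi (- dotp (fx p) (fu p)) *
    ((expR (dotp (fy p) (fu p)) * gauss s (fu p))%:C * fv p)).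
Proof.
move=> mx my mu mv; apply: cmeasurableM.
  apply: cmeasurable_expi; apply: measurableT_comp => //; exact: measurable_dotp.
apply: cmeasurableM => //; apply: cmeasurable_real; apply: measurable_funM.
  by apply: measurableT_comp => //; exact: measurable_dotp.
exact: (measurableT_comp (measurable_gauss s) mu).
Qed.

Section one_multiplier.
Variables (v : V -> R[i]) (B : R).
Hypotheses (mv : cmeasurable_fun v) (vB : forall u, normc (v u) <= B).

Lemma cmeasurable_kernel x y : cmeasurable_fun (fourier_kernel v x y).
Proof. exact: cmeasurable_fourier_kernel. Qed.

Lemma cintegrable_kernel x y : cintegrable leb setT (fourier_kernel v x y).
Proof.
apply: (cintegrable_le measurableT (cmeasurable_kernel x y)
  (integrable_kernel_bound B y)) => u _.
exact: normc_fourier_kernel.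
Qed.

Lemma cmeasurable_gauss_fourier y : cmeasurable_fun (gauss_fourier v ^~ y).
Proof.
apply: (cmeasurable_cintegral leb
  (f := fun p : V * V => fourier_kernel v p.1 y p.2)).
apply: cmeasurable_fourier_kernel => //; exact: cmeasurable_comp mv.
Qed.

Lemma normc_gauss_fourier x y : normc (gauss_fourier v x y) <=
  \int[leb]_(u in setT) (B * kernel_bound y u).
Proof.
apply: le_trans (le_normc_cintegral measurableT (cmeasurable_kernel x y)
  (cintegrable_kernel x y)) _.
apply: le_Rintegral => //.
- exact: (integrable_normc measurableT (cmeasurable_kernel x y)
    (cintegrable_kernel x y)).
- exact: integrable_kernel_bound.
- by move=> u _; exact: normc_fourier_kernel.
Qed.

End one_multiplier.

(** The last clause is the L1 bound of the theorem, up to the normalising factor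
    (2 pi)^-n: B = 1 is what the heat kernel itself, v = 1, achieves. The second
    clause is what keeps the class stable under limits, by domination. *)
Definition heat_bounded (B : R) (v : V -> R[i]) : Prop :=
  [/\ cmeasurable_fun v, forall u, normc (v u) <= B &
   forall y, (\int[leb]_x (normc (gauss_fourier v x y))%:E <=
     (B * ((2 * pi) ^+ n * expR (sqnorm y / (4 * s))))%:E)%E].

Lemma heat_bounded_ge0 B v : heat_bounded B v -> 0 <= B.
Proof. by move=> [_ vB _]; exact: le_trans (normc_ge0 _) (vB 0). Qed.

(** Shifting the variable u by y / (2 s) removes the factor exp(y.u) and leaves
    exp(|y|^2 / (4 s)) times a phase and the Fourier transform of a Gaussian. *)
Lemma heat_bounded_one : heat_bounded 1 (fun=> 1).
Proof.
split=> [|u|y]; first exact: cmeasurable_cst.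
  by rewrite Normc.normc1.
pose a := (2 * s)^-1 *: y.
have FE x : gauss_fourier (fun=> 1) x y =
    expi (- dotp x a) * (expR (sqnorm y / (4 * s)))%:C *
    (Num.sqrt (pi / s) ^+ n * gauss (4 * s)^-1 x)%:C.
  rewrite /gauss_fourier -(cintegral_translation a); last first.
    by apply: cmeasurable_kernel; exact: cmeasurable_cst.
  have -> : gauss (4 * s)^-1 x = gauss (4 * s)^-1 (- x).
    by rewrite /gauss /sqnorm dotpNl dotpNr opprK.
  rewrite -fourier_gauss// -cintegralZl//; last first.
    apply: (cintegrable_le measurableT _ (integrable_gauss s0)).
      apply: cmeasurableM; last by apply: cmeasurable_real; exact: measurable_gauss.
      by apply: cmeasurable_expi; exact: measurable_dotp.
    move=> u _; rewrite Normc.normcM normc_expi mul1r normc_real.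
    by rewrite ger0_norm ?gauss_ge0.
  apply: eq_cintegral => u _.
  rewrite /fourier_kernel mulr1 dotpDr opprD expiD.
  rewrite (_ : expR (dotp y (u + a)) * gauss s (u + a) =
    expR (sqnorm y / (4 * s)) * gauss s u).
    rewrite rmorphM/= dotpNl; ring.
  rewrite /gauss -!expRD; congr expR.
  rewrite sqnormD dotpDr /a !dotpZr sqnormZ /sqnorm (dotpC u y).
  by field; rewrite gt_eqF.
under eq_integral => x _.
  rewrite FE !Normc.normcM normc_expi mul1r !normc_real.
  rewrite (ger0_norm (expR_ge0 _)) ger0_norm; last first.
    by rewrite mulr_ge0 ?gauss_ge0// exprn_ge0// sqrtr_ge0.
  rewrite mulrA EFinM; over.
rewrite ge0_integralZl ?lee_fin ?mulr_ge0 ?expR_ge0 ?exprn_ge0 ?sqrtr_ge0//;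
  last 2 first.
- by apply/measurable_EFinP; exact: measurable_gauss.
- by move=> x _; rewrite lee_fin gauss_ge0.
rewrite integral_gauss ?invr_gt0 ?mulr_gt0// mul1r -EFinM lee_fin.
rewrite mulrAC -mulrA mulrC ler_wpM2r ?expR_ge0//.
rewrite mulrC -exprMn -sqrtrM ?divr_ge0 ?pi_ge0 ?(ltW s0)//.
rewrite (_ : pi / s * (pi / (4 * s)^-1) = (2 * pi) ^+ 2).
  by rewrite sqrtr_sqr ger0_norm// mulr_ge0// pi_ge0.
by field; rewrite gt_eqF.
Qed.

Lemma heat_boundedD B C v w : heat_bounded B v -> heat_bounded C w ->
  heat_bounded (B + C) (fun u => v u + w u).
Proof.
move=> [mv vB vI] [mw wC wI]; split=> [|u|y]; first exact: cmeasurableD.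
  by rewrite (le_trans (le_normcD _ _))// lerD.
rewrite mulrDl EFinD; apply: le_trans (leeD (vI y) (wI y)).
rewrite -ge0_integralD//.
- apply: ge0_le_integral => //.
  + by move=> x _; rewrite lee_fin normc_ge0.
  + apply/measurable_EFinP/measurable_normc/cmeasurable_gauss_fourier.
    exact: cmeasurableD.
  + apply/measurable_EFinP; apply: measurable_funD.
      exact/measurable_normc/cmeasurable_gauss_fourier.
    exact/measurable_normc/cmeasurable_gauss_fourier.
  + move=> x _; rewrite -EFinD lee_fin.
    rewrite (_ : gauss_fourier _ x y = gauss_fourier v x y + gauss_fourier w x y).
      exact: le_normcD.
    rewrite /gauss_fourier -cintegralD//.
    * by apply: eq_cintegral => u _; rewrite /fourier_kernel !mulrDr.
    * exact: (cintegrable_kernel mv vB).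
    * exact: (cintegrable_kernel mw wC).
- by move=> x _; rewrite lee_fin normc_ge0.
- exact/measurable_EFinP/measurable_normc/cmeasurable_gauss_fourier.
- by move=> x _; rewrite lee_fin normc_ge0.
- exact/measurable_EFinP/measurable_normc/cmeasurable_gauss_fourier.
Qed.

Lemma heat_boundedZ (c : R[i]) B v : heat_bounded B v ->
  heat_bounded (normc c * B) (fun u => c * v u).
Proof.
move=> [mv vB vI]; split=> [|u|y].
- by apply: cmeasurableM => //; exact: cmeasurable_cst.
- by rewrite Normc.normcM ler_wpM2l// normc_ge0.
- have FE x : gauss_fourier (fun u => c * v u) x y = c * gauss_fourier v x y.
    rewrite /gauss_fourier -cintegralZl//; last exact: (cintegrable_kernel mv vB).
    by apply: eq_cintegral => u _; rewrite /fourier_kernel; ring.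
  under eq_integral do rewrite FE Normc.normcM EFinM.
  rewrite ge0_integralZl//.
  + by rewrite -mulrA EFinM lee_wpmul2l// lee_fin normc_ge0.
  + exact/measurable_EFinP/measurable_normc/cmeasurable_gauss_fourier.
  + by move=> x _; rewrite lee_fin normc_ge0.
  + by rewrite lee_fin normc_ge0.
Qed.

Lemma limn_einf_le (a : nat -> \bar R) (M : \bar R) : (forall k, a k <= M)%E ->
  (limn_einf a <= M)%E.
Proof.
move=> aM; rewrite limn_einf_lim; apply: lime_le; first exact: is_cvg_einfs.
apply: nearW => k; apply: le_trans (aM k); apply: ereal_inf_lbound.
by exists k => /=.
Qed.

(** The Fourier integrals converge pointwise by dominated convergence, and Fatou's
    lemma passes the L1 bounds to the limit. *)
Lemma heat_bounded_lim B (v_ : nat -> V -> R[i]) v :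
  (forall k, heat_bounded B (v_ k)) -> (forall u, ccvg (v_ ^~ u) (v u)) ->
  heat_bounded B v.
Proof.
move=> hv cv.
have mv : cmeasurable_fun v.
  split.
    apply: (@measurable_fun_cvg _ _ _ setT (fun k u => complex.Re (v_ k u))).
      by move=> k; case: (hv k) => -[].
    by move=> u _; exact: (cv u).1.
  apply: (@measurable_fun_cvg _ _ _ setT (fun k u => complex.Im (v_ k u))).
    by move=> k; case: (hv k) => -[].
  by move=> u _; exact: (cv u).2.
have mvk k : cmeasurable_fun (v_ k) by case: (hv k).
have vkB k u : normc (v_ k u) <= B by case: (hv k).
have vB u : normc (v u) <= B.
  by apply: (ccvg_normc_le (cv u)) => k; exact: vkB.
split=> // y.
have cF x : (fun k => (normc (gauss_fourier (v_ k) x y))%:E) @ \oo -->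
    (normc (gauss_fourier v x y))%:E.
  apply: cvg_EFin; first exact: nearW.
  apply: ccvg_normc.
  apply: (cdominated_cvg measurableT (fun k => cmeasurable_kernel (mvk k) x y)
    (cmeasurable_kernel mv x y) _ (integrable_kernel_bound B y)).
    move=> u _; apply: ccvgM; first exact: ccvg_cst.
    by apply: ccvgM; [exact: ccvg_cst|exact: cv].
  by move=> k u _; exact: normc_fourier_kernel.
have -> : (\int[leb]_x (normc (gauss_fourier v x y))%:E =
    \int[leb]_x limn_einf (fun k => (normc (gauss_fourier (v_ k) x y))%:E))%E.
  apply: eq_integral => x _.
  rewrite is_cvg_limn_einfE; last by apply/cvg_ex; eexists; exact: cF.
  by apply/esym/cvg_lim => //; exact: cF.
apply: le_trans (@fatou _ _ _ leb setT measurableT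
  (fun k x => (normc (gauss_fourier (v_ k) x y))%:E) _ _) _.
- move=> k; apply/measurable_EFinP/measurable_normc.
  exact: cmeasurable_gauss_fourier.
- by move=> k x _; rewrite lee_fin normc_ge0.
- by apply: limn_einf_le => k; case: (hv k).
Qed.

(** Multiplication by w enlarges the L1 bound of a Fourier integral by a factor at
    most c. Asking this against every v, and not only v = 1, makes the
    multipliers an algebra on which the constants behave like a norm. *)
Definition heat_multiplier (c : R) (w : V -> R[i]) : Prop :=
  forall B v, heat_bounded B v -> heat_bounded (c * B) (fun u => w u * v u).

Lemma eq_heat_multiplier c w z : (forall u, w u = z u) ->
  heat_multiplier c w -> heat_multiplier c z.
Proof. by move=> /funext ->. Qed.

Lemma heat_multiplier_bounded c w : heat_multiplier c w -> heat_bounded c w.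
Proof.
move=> /(_ _ _ heat_bounded_one); rewrite mulr1.
by under eq_fun do rewrite mulr1.
Qed.

Lemma heat_multiplier_ge0 c w : heat_multiplier c w -> 0 <= c.
Proof. by move=> /heat_multiplier_bounded/heat_bounded_ge0. Qed.

Lemma heat_multiplier_cst (z : R[i]) : heat_multiplier (normc z) (fun=> z).
Proof. by move=> B v; exact: heat_boundedZ. Qed.

Lemma heat_multiplierD c e w z : heat_multiplier c w -> heat_multiplier e z ->
  heat_multiplier (c + e) (fun u => w u + z u).
Proof.
move=> hw hz B v hv; rewrite mulrDl; under eq_fun do rewrite mulrDl.
exact: heat_boundedD (hw _ _ hv) (hz _ _ hv).
Qed.

Lemma heat_multiplierM c e w z : heat_multiplier c w -> heat_multiplier e z ->
  heat_multiplier (c * e) (fun u => w u * z u).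
Proof.
move=> hw hz B v hv; rewrite -mulrA; under eq_fun do rewrite -mulrA.
exact/hw/hz.
Qed.

Lemma heat_multiplierX c w k : heat_multiplier c w ->
  heat_multiplier (c ^+ k) (fun u => w u ^+ k).
Proof.
move=> hw; elim: k => [|k IH].
  have := heat_multiplier_cst 1; rewrite Normc.normc1 expr0.
  by under [X in _ -> heat_multiplier _ X]eq_fun do rewrite expr0.
rewrite exprS; under eq_fun do rewrite exprS.
exact: heat_multiplierM.
Qed.

Lemma heat_multiplier_lim c (w_ : nat -> V -> R[i]) w :
  (forall k, heat_multiplier c (w_ k)) -> (forall u, ccvg (w_ ^~ u) (w u)) ->
  heat_multiplier c w.
Proof.
move=> hw cw B v hv.
apply: (@heat_bounded_lim _ (fun k u => w_ k u * v u)).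
  by move=> k; exact: hw.
by move=> u; apply: ccvgM => //; exact: ccvg_cst.
Qed.

(** On the Fourier side, multiplication by the transform of la replaces the
    function by an average of its translates, with total weight la(R^n). *)
Lemma heat_multiplier_fourier (la : {finite_measure set V -> \bar R}) :
  heat_multiplier (fine (la setT))
    (fun u => cintegral la setT (fun y => expi (dotp u y))).
Proof.
move=> B v hv; have [mv vB vI] := hv; have B0 := heat_bounded_ge0 hv.
pose w (u : V) := cintegral la setT (fun y => expi (dotp u y)).
rewrite -/w.
have mexp : cmeasurable_fun (fun p : V * V => expi (dotp p.1 p.2)).
  by apply: cmeasurable_expi; exact: measurable_dotp.
have mw : cmeasurable_fun w.
  exact: (cmeasurable_cintegral la mexp).
have i1 (r : R) : la.-integrable setT (EFin \o (fun=> r)).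
  exact: finite_measure_integrable_cst.
have iexp u : cintegrable la setT (fun y => expi (dotp u y)).
  apply: (cintegrable_le measurableT _ (i1 1)).
    by apply: cmeasurable_expi; exact: measurable_dotp.
  by move=> y _; rewrite normc_expi.
have laE : \int[la]_(x in setT) 1 = fine (la setT).
  by rewrite Rintegral_cst// mul1r.
have wl u : normc (w u) <= fine (la setT).
  apply: le_trans (le_normc_cintegral measurableT _ (iexp u)) _.
    by apply: cmeasurable_expi; exact: measurable_dotp.
  by under eq_Rintegral do rewrite normc_expi; rewrite laE.
have mwv : cmeasurable_fun (fun u => w u * v u) by exact: cmeasurableM.
have wvB u : normc (w u * v u) <= fine (la setT) * B.
  by rewrite Normc.normcM ler_pM ?normc_ge0.
split=> // y.
have FE x : gauss_fourier (fun u => w u * v u) x y =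
    cintegral la setT (fun z => gauss_fourier v (x - z) y).
  have mk : cmeasurable_fun (fun p : V * V => fourier_kernel v (x - p.1) y p.2).
    apply: (@cmeasurable_fourier_kernel _ _ (fun p : V * V => x - p.1)
      (fun=> y) snd (fun p : V * V => v p.2)) => //.
      exact: measurable_rVB.
    exact: cmeasurable_comp mv.
  rewrite /gauss_fourier (cintegral_fubini mk (i1 1) (integrable_kernel_bound B y))//.
  - apply: eq_cintegral => u _ /=; rewrite /fourier_kernel.
    transitivity (cintegral la setT (fun z =>
       (expi (- dotp x u) * ((expR (dotp y u) * gauss s u)%:C * v u)) *
        expi (dotp u z))).
      by rewrite cintegralZl// /w; ring.
    apply: eq_cintegral => z _.
    rewrite dotpDl dotpNl opprD opprK expiD (dotpC z u); ring.
  - by move=> u; rewrite mulr_ge0 ?kernel_bound_ge0.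
  - by move=> z u; rewrite mul1r; exact: normc_fourier_kernel.

have mG : cmeasurable_fun (fun p : V * V => gauss_fourier v (p.1 - p.2) y).
  apply: (cmeasurable_comp (g := fun p : V * V => p.1 - p.2)
    _ (cmeasurable_gauss_fourier mv y)).
  exact: measurable_rVB.
have mGx x : cmeasurable_fun (fun z : V => gauss_fourier v (x - z) y).
  apply: (cmeasurable_comp (g := fun z : V => x - z)
    _ (cmeasurable_gauss_fourier mv y)).
  exact: measurable_rVB.
have mnG : measurable_fun setT
    (fun p : V * V => (normc (gauss_fourier v (p.1 - p.2) y))%:E).
  exact/measurable_EFinP/measurable_normc.
apply: (@le_trans _ _ (\int[leb]_x \int[la]_z
    (normc (gauss_fourier v (x - z) y))%:E)%E).
  apply: ge0_le_integral => //.
  - by move=> x _; rewrite lee_fin normc_ge0.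
  - apply/measurable_EFinP/measurable_normc.
    exact: (cmeasurable_gauss_fourier mwv).
  - apply: (measurable_fun_fubini_tonelli_F
      (fun p : V * V => (normc (gauss_fourier v (p.1 - p.2) y))%:E)) => //.
    by move=> p; rewrite lee_fin normc_ge0.
  - move=> x _; rewrite FE.
    apply: (le_normc_cintegral_ereal measurableT (mGx x)).
    apply: (cintegrable_le measurableT (mGx x) (i1 _)) => z _.
    exact: normc_gauss_fourier.
rewrite (fubini_tonelli
  (fun p : V * V => (normc (gauss_fourier v (p.1 - p.2) y))%:E)) => [|//|p];
  last by rewrite lee_fin normc_ge0.
apply: (@le_trans _ _ (\int[la]_z
   (B * ((2 * pi) ^+ n * expR (sqnorm y / (4 * s))))%:E)%E).
  apply: ge0_le_integral => //.
  - by move=> z _; apply: integral_ge0 => x _; rewrite lee_fin normc_ge0.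
  - apply: (measurable_fun_fubini_tonelli_G
      (fun p : V * V => (normc (gauss_fourier v (p.1 - p.2) y))%:E)) => //.
    by move=> p; rewrite lee_fin normc_ge0.
  - move=> z _.
    rewrite (ge0_integral_translation (- z)
      (f := fun x => (normc (gauss_fourier v x y))%:E))//.
    + exact/measurable_EFinP/measurable_normc/cmeasurable_gauss_fourier.
    + by move=> x; rewrite lee_fin normc_ge0.
rewrite integral_cst//= -[X in (_ * X)%E]fineK ?fin_num_measure// -EFinM lee_fin.
by rewrite le_eqVlt; apply/orP; left; apply/eqP; ring.
Qed.

End gauss_fourier.

(** * Exponentials, translations and degenerate Gaussians as multipliers *)

Section complex_exponential_limit.
Context {R : realType}.
Implicit Types (z a b : R[i]).

(** Telescoping a^k - b^k. *)
Lemma normc_subX a b k : normc a <= 1 -> normc b <= 1 ->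
  normc (a ^+ k - b ^+ k) <= k%:R * normc (a - b).
Proof.
move=> a1 b1; elim: k => [|k IH]; first by rewrite !expr0 subrr mul0r Normc.normc0.
have bk : normc (b ^+ k) <= 1.
  elim: k {IH} => [|k IH]; first by rewrite expr0 Normc.normc1.
  by rewrite exprS Normc.normcM mulr_ile1 ?normc_ge0.
rewrite !exprS (_ : _ - _ = a * (a ^+ k - b ^+ k) + (a - b) * b ^+ k); last by ring.
apply: (le_trans (le_normcD _ _)); rewrite !Normc.normcM -natr1 mulrDl mul1r lerD//.
  by apply: le_trans IH; rewrite ler_piMl// normc_ge0.
by rewrite ler_piMr// normc_ge0.
Qed.

(** Both 1 + z / K and exp(z / K) have modulus at most 1 and differ by O(K^-2), so
    their K-th powers differ by O(K^-1). The sequence starts at K = N because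
    the modulus of 1 + z / K may exceed 1 for small K. *)
Lemma ccvg_expX z (N : nat) : complex.Re z <= 0 -> (0 < N)%N ->
  (forall k, normc (1 + (k + N)%:R^-1%:C * z) <= 1) ->
  ccvg (fun k => (1 + (k + N)%:R^-1%:C * z) ^+ (k + N)) (cexp z).
Proof.
move=> z0 N0 h1.
pose C : R := 2 * normc z ^+ 2 * expR (normc z).
have C0 : 0 <= C by rewrite /C mulr_ge0 ?expR_ge0// mulr_ge0 ?sqr_ge0.
have cK : (C * (k + N)%:R^-1 : R) @[k --> \oo] --> (0 : R).
  rewrite -(mulr0 C); apply: cvgM; first exact: cvg_cst.
  by have := @cvg_harmonic R; rewrite /harmonic -(cvg_shiftn N.-1) /=;
    under eq_fun do rewrite -addnS prednK//.
apply: (ccvg_le cK); apply: nearW => k.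
set K := (k + N)%:R^-1; have K0 : 0 < K by rewrite invr_gt0 ltr0n addn_gt0 N0 orbT.
have K1 : K <= 1.
  by rewrite invf_le1 ?ltr0n ?ler1n ?addn_gt0 ?N0 ?orbT.
have -> : cexp z = cexp (K%:C * z) ^+ (k + N).
  rewrite cexpX -mulr_natl mulrA -(rmorph_nat (real_complex R)) -rmorphM/=.
  by rewrite /K divff ?mul1r// pnatr_eq0 -lt0n addn_gt0 N0 orbT.
apply: (le_trans (normc_subX _ (h1 k) _)).
  rewrite normc_cexp -expR0 ler_expR.
  by case: (z) z0 => a b /= a0; rewrite mul0r subr0 mulr_ge0_le0// ltW.
rewrite -normcN opprB opprD addrA.
have := normc_cexpB1B (K%:C * z).
rewrite Normc.normcM normc_real (gtr0_norm K0) => h.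
have h2 : normc (cexp (K%:C * z) - 1 - K%:C * z) <= C * K ^+ 2.
  apply: (le_trans h); rewrite (_ : C * K ^+ 2 =
    2 * (K * normc z) ^+ 2 * expR (normc z)); last by rewrite /C; ring.
  rewrite ler_wpM2l//; first by rewrite mulr_ge0 ?sqr_ge0.
  by rewrite ler_expR ler_piMl ?normc_ge0.
rewrite (_ : C * K = (k + N)%:R * (C * K ^+ 2)); first by rewrite ler_wpM2l.
have kK : (k + N)%:R * K = 1.
  by rewrite divff// pnatr_eq0 -lt0n addn_gt0 N0 orbT.
by rewrite mulrCA expr2 (mulrA _ K K) kK mul1r.
Qed.

End complex_exponential_limit.

Section multipliers.
Context {R : realType} {n : nat}.
Local Notation V := 'rV[R]_n.
Variable s : R.
Hypothesis s0 : 0 < s.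
Local Notation heat_multiplier := (@heat_multiplier R n s).

(** For large k, 1 + (w - c) / k = (1 - c / k) + w / k is a multiplier with constant
    (1 - c / k) + c / k = 1, hence so is its k-th power. When w is the transform of
    a measure of mass c this is the construction of the compound Poisson law. *)
Lemma heat_multiplier_exp c w : heat_multiplier c w ->
  heat_multiplier 1 (fun u => cexp (w u - c%:C)).
Proof.
move=> hw; have c0 := heat_multiplier_ge0 s0 hw.
pose N := (Num.bound c).
have cN : c < N%:R by exact: archi_boundP.
have N0 : (0 < N)%N by rewrite -(ltr0n R) (le_lt_trans c0).
have [_ wc _] := heat_multiplier_bounded s0 hw.
have hk k : heat_multiplier 1
    (fun u => 1 + (k + N)%:R^-1%:C * (w u - c%:C)).
  set K := (k + N)%:R^-1.
  have K0 : 0 < K by rewrite invr_gt0 ltr0n addn_gt0 N0 orbT.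
  have Kc : 0 <= 1 - K * c.
    rewrite subr_ge0 mulrC ler_pdivrMr ?mul1r ?ltr0n ?addn_gt0 ?N0 ?orbT//.
    by rewrite (le_trans (ltW cN))// ler_nat leq_addl.
  have := heat_multiplierD s0 (heat_multiplier_cst s0 (1 - K * c)%:C)
    (heat_multiplierM (heat_multiplier_cst s0 K%:C) hw).
  rewrite !normc_real (ger0_norm Kc) (gtr0_norm K0) subrK.
  apply: eq_heat_multiplier => u; rewrite rmorphB rmorphM rmorph1/=; ring.
have hb k u : normc (1 + (k + N)%:R^-1%:C * (w u - c%:C)) <= 1.
  by have [_] := heat_multiplier_bounded s0 (hk k).
apply: (@heat_multiplier_lim _ _ _ s0 _ (fun k u =>
  (1 + (k + N)%:R^-1%:C * (w u - c%:C)) ^+ (k + N))).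
  by move=> k; have := heat_multiplierX s0 (k + N) (hk k); rewrite expr1n.
move=> u; apply: ccvg_expX => //.
rewrite (_ : complex.Re _ = complex.Re (w u) - c).
  by rewrite subr_le0 (le_trans (ler_norm _))// (le_trans (normc_Re _)).
by case: (w u).
Qed.

(** The transform of the Dirac mass at m. *)
Lemma heat_multiplier_translation (m : V) :
  heat_multiplier 1 (fun u => expi (dotp u m)).
Proof.
have := heat_multiplier_fourier s0 (dirac m : {finite_measure set V -> \bar R}).
rewrite (_ : fine _ = 1); last by rewrite /= /dirac indicE mem_set.
apply: eq_heat_multiplier => u.
have [mr mi] : cmeasurable_fun (fun y => expi (dotp u y)).
  by apply: cmeasurable_expi; exact: measurable_dotp.
rewrite /cintegral /Rintegral !integral_dirac//.
- by rewrite diracT !mul1e.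
- exact/measurable_EFinP.
- exact/measurable_EFinP.
Qed.

Lemma cos_quadratic_cvg (x : R) :
  (k.+1%:R ^+ 2 * (cos (x / k.+1%:R) - 1) : R) @[k --> \oo] --> - (x ^+ 2 / 2).
Proof.
have e (k : nat) : k.+1%:R ^+ 2 * (cos (x / k.+1%:R) - 1) =
    - 2 * (k.+1%:R * sin (x / 2 / k.+1%:R)) ^+ 2 :> R.
  rewrite (_ : x / k.+1%:R = (x / 2 / k.+1%:R) *+ 2); last first.
    by rewrite mulr2n; field; rewrite nat1r pnatr_eq0.
  by rewrite cos_mulr2n cos2sin2 mulr2n exprMn; ring.
under eq_fun do rewrite e.
rewrite (_ : - (x ^+ 2 / 2) = - 2 * (x / 2) ^+ 2); last by field.
apply: cvgM; first exact: cvg_cst.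
suff h : (k.+1%:R * sin (x / 2 / k.+1%:R) : R) @[k --> \oo] --> x / 2.
  by rewrite expr2; under eq_fun do rewrite expr2; exact: cvgM.
apply/cvgrPdist_le => eps e0.
have : ((x / 2) ^+ 2 * k.+1%:R^-1 : R) @[k --> \oo] --> (0 : R).
  by rewrite -(mulr0 ((x / 2) ^+ 2)); apply: cvgM; [exact: cvg_cst|exact: cvg_harmonic].
move=> /cvgrPdist_le/(_ _ e0); apply: filterS => k.
rewrite sub0r normrN ger0_norm; last by rewrite mulr_ge0 ?sqr_ge0.
apply: le_trans; rewrite distrC.
have k0 : k.+1%:R != 0 :> R by rewrite pnatr_eq0.
rewrite {2}(_ : x / 2 = k.+1%:R * (x / 2 / k.+1%:R)); last by field; rewrite nat1r.
rewrite -mulrBr normrM ger0_norm//.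
apply: le_trans (_ : k.+1%:R * (x / 2 / k.+1%:R) ^+ 2 <= _).
  by rewrite ler_wpM2l// normr_sinB_id.
by rewrite le_eqVlt; apply/orP; left; apply/eqP; field; rewrite nat1r.
Qed.

(** A degenerate Gaussian in the direction v as a limit of compound Poisson laws
    with jumps v / k and - v / k at rate k^2 / 2 each. *)
Lemma heat_multiplier_gauss_line (v : V) :
  heat_multiplier 1 (fun u => (expR (- (dotp u v ^+ 2 / 2)))%:C).
Proof.
pose w (k : nat) (u : V) : R[i] := (k.+1%:R ^+ 2 * cos (dotp u v / k.+1%:R))%:C.
have hw k : heat_multiplier (k.+1%:R ^+ 2) (w k).
  pose c : R := k.+1%:R ^+ 2 / 2.
  have c0 : 0 <= c by rewrite divr_ge0 ?sqr_ge0.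
  have h m := heat_multiplierM (heat_multiplier_cst s0 c%:C)
    (heat_multiplier_translation m).
  have := heat_multiplierD s0 (h (k.+1%:R^-1 *: v)) (h (- (k.+1%:R^-1 *: v))).
  rewrite normc_real (ger0_norm c0) mulr1 (_ : c + c = k.+1%:R ^+ 2); last first.
    by rewrite /c; field.
  apply: eq_heat_multiplier => u; rewrite /w /expi dotpNr dotpZr cosN sinN; simpc.
  by rewrite (mulrC _ (dotp u v)); congr Complex; rewrite /c; field.
apply: (@heat_multiplier_lim _ _ _ s0 _
  (fun k u => cexp (w k u - (k.+1%:R ^+ 2)%:C))).
  by move=> k; exact: heat_multiplier_exp.
move=> u; rewrite -cexp_real; apply: ccvg_cexp.
rewrite rmorphN.
under [X in ccvg X]eq_fun do rewrite /w -rmorphB/= -[X in _ - X]mulr1 -mulrBr.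
by rewrite -rmorphN; apply: ccvg_real; exact: cos_quadratic_cvg.
Qed.

End multipliers.

(** * The Levy exponent as a multiplier *)

Section quadratic_forms.
Context {R : realType} {n : nat}.
Local Notation V := 'rV[R]_n.
Implicit Types (b : 'M[R]_n) (u v : V).

Lemma dotp_delta v i : dotp v (delta_mx ord0 i) = v ord0 i.
Proof.
rewrite /dotp (bigD1 i)//= big1 => [|j ji]; rewrite mxE !eqxx ?mulr1 ?addr0//.
by rewrite (negbTE ji) mulr0.
Qed.

Lemma dotp_mulmx_sym b u v : b^T = b -> dotp (u *m b) v = dotp (v *m b) u.
Proof.
move=> bT; have dE x y : dotp x y = (x *m y^T) ord0 ord0.
  by rewrite mxE; apply: eq_bigr => i _; rewrite mxE.
rewrite !dE -mulmxA -[in LHS]bT -trmx_mul -[LHS]/((u *m (v *m b)^T) ord0 ord0).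
by rewrite -!dE dotpC.
Qed.

Lemma mulmx_dotp_outer u v w : dotp (u *m (v^T *m w)) u = dotp u v * dotp w u.
Proof.
rewrite mulmxA /dotp big_distrr/=; apply: eq_bigr => i _.
rewrite mxE big_ord1 mulrA; congr (_ * _ * _).
by rewrite mxE; apply: eq_bigr => j _; rewrite mxE.
Qed.

(** A positive semidefinite form is a sum of squares of linear forms. If b i i is
    positive, subtracting the squared linear form of the i-th row, over b i i, leaves a
    positive semidefinite form with one more zero on the diagonal; once the
    diagonal vanishes, the form is zero. *)
Lemma psd_ind (Q : (V -> R) -> Prop) :
  (forall q r, (forall u, q u = r u) -> Q q -> Q r) ->
  Q (fun=> 0) ->
  (forall q v, Q q -> Q (fun u => q u + dotp u v ^+ 2)) ->
  forall b, b^T = b -> (forall u, 0 <= dotp (u *m b) u) ->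
  Q (fun u => dotp (u *m b) u).
Proof.
move=> Qext Q0 QS b; move: {2}(#|_|.+1) (ltnSn #|[pred i | b i i != 0]|) => k.
elim: k b => // k IH b; rewrite ltnS => bk bT bge0.
have bii i : b i i = dotp (delta_mx ord0 i *m b) (delta_mx ord0 i).
  by rewrite dotp_delta -rowE mxE.
have [b0|bi] := pselect (forall i, b i i = 0); last first.
  have [i bin] : exists i, b i i != 0.
    apply: contra_notP bi => /forallNP h j; apply/eqP/negPn/negP; exact: h.
  have bi0 : 0 < b i i by rewrite lt_neqAle eq_sym bin bii bge0.
  pose v := row i b.
  pose b' : 'M[R]_n := b - (b i i)^-1 *: (v^T *m v).
  have qE u : dotp (u *m b') u = dotp (u *m b) u - (b i i)^-1 * dotp u v ^+ 2.
    rewrite /b' mulmxBr dotpDl dotpNl -scalemxAr dotpZl mulmx_dotp_outer.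
    by rewrite (dotpC v) expr2.
  have b'T : b'^T = b'.
    by rewrite /b' linearB/= linearZ/= trmx_mul trmxK bT.
  have b'ge0 u : 0 <= dotp (u *m b') u.
    have := bge0 (u - (dotp u v / b i i) *: delta_mx ord0 i).
    rewrite mulmxBl -scalemxAl -rowE -/v dotpDl !dotpDr !dotpNl !dotpNr.
    rewrite !dotpZl !dotpZr !dotp_delta qE.
    rewrite (_ : (u *m b) ord0 i = dotp u v); last first.
      by rewrite -dotp_delta dotp_mulmx_sym// -rowE dotpC.
    rewrite (_ : v ord0 i = b i i); last by rewrite mxE.
    rewrite (dotpC v u) => h; apply: le_trans h _.
    by rewrite le_eqVlt; apply/orP; left; apply/eqP; field; rewrite gt_eqF.
  have b'k : (#|[pred j | b' j j != 0%R]| < k)%N.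
    apply: leq_trans bk; apply: proper_card; apply/properP; split.
      apply/fintype.subsetP => j; rewrite !inE; apply: contra => /eqP bj.
      have := b'ge0 (delta_mx ord0 j); rewrite qE -bii bj sub0r oppr_ge0 => h.
      rewrite (_ : b' j j = dotp (delta_mx ord0 j *m b') (delta_mx ord0 j)); last first.
        by rewrite dotp_delta -rowE [RHS]mxE.
      rewrite eq_le b'ge0 andbT qE -bii bj sub0r oppr_le0 mulr_ge0 ?sqr_ge0//.
      by rewrite invr_ge0 ltW.
    exists i; rewrite !inE//= negbK !mxE big_ord1 !mxE mulrA mulVf// mul1r.
    by rewrite subrr.
  have := QS _ ((Num.sqrt (b i i))^-1 *: v) (IH _ b'k b'T b'ge0).
  apply: Qext => u; rewrite dotpZr exprMn exprVn sqr_sqrtr ?(ltW bi0)// qE.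
  by rewrite subrK.
apply: Qext Q0 => u; rewrite (_ : b = 0); first by rewrite mulmx0 dotp0l.
apply/matrixP => i j; rewrite mxE.
have bij i' j' : dotp (delta_mx ord0 i' *m b) (delta_mx ord0 j') = b i' j'.
  by rewrite dotp_delta -rowE mxE.
have bji : b j i = b i j by rewrite -[in LHS]bT mxE.
have h1 := bge0 (delta_mx ord0 i + delta_mx ord0 j).
have h2 := bge0 (delta_mx ord0 i - delta_mx ord0 j).
rewrite mulmxDl dotpDl !dotpDr !bij !b0 bji in h1.
rewrite mulmxBl dotpDl !dotpDr !dotpNl !dotpNr !bij !b0 bji in h2.
apply/eqP; rewrite eq_le; apply/andP; split; lra.
Qed.

Lemma heat_multiplier_psd (s : R) b : 0 < s -> b^T = b ->
  (forall u, 0 <= dotp (u *m b) u) ->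
  heat_multiplier s 1 (fun u => (expR (- (2^-1 * dotp (u *m b) u)))%:C).
Proof.
move=> s0 bT b0.
pose Q (q : V -> R) := heat_multiplier s 1 (fun u => (expR (- (2^-1 * q u)))%:C).
apply: (@psd_ind Q _ _ _ b bT b0); rewrite /Q.
- by move=> q r qr; apply: eq_heat_multiplier => u; rewrite qr.
- have := heat_multiplier_cst (n := n) s0 1; rewrite Normc.normc1.
  by apply: eq_heat_multiplier => u; rewrite mulr0 oppr0 expR0.
- move=> q v hq; have := heat_multiplierM hq (heat_multiplier_gauss_line s0 v).
  rewrite mulr1; apply: eq_heat_multiplier => u; rewrite -rmorphM/= -expRD.
  by congr (expR _)%:C; field.
Qed.

End quadratic_forms.

Section restricted_measure.
Context d (T : measurableType d) (R : realType) (mu : {measure set T -> \bar R}).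
Variables (D : set T) (mD : measurable D) (Dfin : (mu D < +oo)%E).

Lemma cintegral_mfrestr (f : T -> R[i]) (M : R) : cmeasurable_fun f ->
  (forall x, normc (f x) <= M) ->
  cintegral (mfrestr mD Dfin) setT f = cintegral mu D f.
Proof.
move=> mf fM.
have if_ : cintegrable (mfrestr mD Dfin) setT f.
  apply: (cintegrable_le measurableT mf (finite_measure_integrable_cst _ M _)) => //.
have H (g : T -> R) : (mfrestr mD Dfin).-integrable setT (EFin \o g) ->
    \int[mfrestr mD Dfin]_(x in setT) g x = \int[mu]_(x in D) g x.
  move=> ig; congr fine.
  rewrite (@negligible_integral _ _ _ _ setT (~` D))//; last 2 first.
  - exact: measurableC.
  - by rewrite /= /mfrestr /mrestr setICl measure0.
  rewrite setDE setTI setCK; apply: eq_measure_integral => A mA AD.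
  by rewrite /= /mfrestr /mrestr setIidl.
by congr Complex; [exact: H if_.1|exact: H if_.2].
Qed.

Lemma mfrestr_setT : mfrestr mD Dfin setT = mu D.
Proof. by rewrite /mfrestr /mrestr setTI. Qed.

End restricted_measure.

Section levy_kernel.
Context {R : realType} {n : nat}.
Local Notation V := 'rV[R]_n.
Implicit Types (u y : V).

Definition levy_kernel (u y : V) : R[i] :=
  expi (dotp u y) - 1 - (0 +i* (dotp u y / (1 + sqnorm y))).

Lemma measurable_inv1sqnorm :
  measurable_fun setT (fun y : V => (1 + sqnorm y)^-1).
Proof.
have -> : (fun y : V => (1 + sqnorm y)^-1) =
    (fun y : V => expR (- ln (1 + sqnorm y))).
  apply/funext => y; rewrite expRN lnK// posrE.
  by rewrite ltr_pwDl ?sqnorm_ge0.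
apply: measurableT_comp => //; apply: measurableT_comp => //.
apply: measurableT_comp => //; apply: measurable_funD => //.
exact: measurable_sqnorm.
Qed.

Lemma cmeasurable_levy_kernel u : cmeasurable_fun (levy_kernel u).
Proof.
have mu : measurable_fun setT (dotp u) by exact: measurable_dotp.
apply: cmeasurableB; first apply: cmeasurableB.
- exact: cmeasurable_expi.
- exact: cmeasurable_cst.
- apply: cmeasurable_RI; first exact: measurable_cst.
  apply: measurable_funM => //.
  exact: measurable_inv1sqnorm.
Qed.

(** For |y| <= 1 the terms of first order in y cancel up to O(|y|^3), and for
    |y| >= 1 the kernel is bounded: this is why a Levy measure integrates it. *)
Lemma normc_levy_kernel u y :
  normc (levy_kernel u y) <= 3 * (1 + sqnorm u) * Num.min 1 (sqnorm y).
Proof.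
have y0 := sqnorm_ge0 y; have u0 := sqnorm_ge0 u.
have cs := cauchy_schwarz u y.
set q := dotp u y in cs *.
have q1 : 0 < 1 + sqnorm y by lra.
have hq : `|q / (1 + sqnorm y)| <= 2^-1 * (1 + sqnorm u).
  rewrite normrM normfV (gtr0_norm q1) ler_pdivrMr//.
  rewrite -(@ler_pXn2r _ 2)// ?nnegrE ?mulr_ge0//; try lra.
  rewrite real_normK ?num_real// !expr2; rewrite expr2 in cs; nra.
have [y1|y1] := leP 1 (sqnorm y).
  rewrite /levy_kernel -/q.
  apply: (le_trans (le_normcD _ _)); rewrite normcN normc_im.
  apply: (@le_trans _ _ (2 + 2^-1 * (1 + sqnorm u))); last by lra.
  apply: lerD => //; apply: (le_trans (le_normcD _ _)).
  by rewrite normcN normc_expi Normc.normc1.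
have -> : levy_kernel u y = (cos q - 1) +i*
    ((sin q - q) + q * sqnorm y / (1 + sqnorm y)).
  rewrite /levy_kernel -/q /expi; simpc; congr Complex; field.
  by rewrite gt_eqF.
apply: (le_trans (normc_le_ReIm _)) => /=.
have h1 := normr_cosB1 q; have h2 := normr_sinB_id q.
have h3 : `|q * sqnorm y / (1 + sqnorm y)| <= 2^-1 * (1 + sqnorm u) * sqnorm y.
  by rewrite mulrAC normrM (ger0_norm y0) ler_wpM2r.
have h4 := ler_normD (sin q - q) (q * sqnorm y / (1 + sqnorm y)).
nra.
Qed.

End levy_kernel.

Lemma cintegral_indic d (T : measurableType d) (R : realType)
    (mu : {measure set T -> \bar R}) (D E : set T) (f : T -> R[i]) : D `<=` E ->
  cintegral mu D f = cintegral mu E (fun x => (\1_D x)%:C * f x).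
Proof.
move=> DE.
have H (g : T -> R) : \int[mu]_(x in D) g x = \int[mu]_(x in E) (\1_D x * g x).
  rewrite -[in LHS](setIidr DE) Rintegral_mkcondr; apply: eq_Rintegral => x _.
  by rewrite patchE indicE; case: (x \in D); rewrite ?mul1r ?mul0r.
congr Complex; rewrite H; apply: eq_Rintegral => x _; case: (f x) => a b /=.
  by rewrite mul0r subr0.
by rewrite mul0r addr0.
Qed.

Lemma Rintegral_dotp {R : realType} {n : nat}
    (mu : {measure set 'rV[R]_n -> \bar R}) (D : set 'rV[R]_n)
    (q : 'rV[R]_n -> R) (u : 'rV[R]_n) : measurable D ->
  (forall j, mu.-integrable D (EFin \o (fun y : 'rV[R]_n => y ord0 j * q y))) ->
  mu.-integrable D (EFin \o (fun y => dotp u y * q y)) /\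
  \int[mu]_(y in D) (dotp u y * q y) =
  dotp u (\row_j \int[mu]_(y in D) (y ord0 j * q y)).
Proof.
move=> mD ij.
have iu j : mu.-integrable D
    (EFin \o (fun y : 'rV[R]_n => u ord0 j * (y ord0 j * q y))).
  exact: (integrableZl mD (u ord0 j) (ij j)).
have key (r : seq 'I_n) :
    mu.-integrable D (EFin \o (fun y : 'rV[R]_n => \sum_(j <- r) u ord0 j *
      (y ord0 j * q y))) /\
    \int[mu]_(y in D) (\sum_(j <- r) u ord0 j * (y ord0 j * q y)) =
    \sum_(j <- r) u ord0 j * \int[mu]_(y in D) (y ord0 j * q y).
  elim: r => [|j r [IH1 IH2]].
    under eq_fun do rewrite big_nil; split; first exact: integrable0.
    by rewrite /Rintegral integral0 big_nil.
  split.
    have := integrableD mD (iu j) IH1; apply: eq_integrable => // y _ /=.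
    by rewrite big_cons.
  under eq_Rintegral do rewrite big_cons.
  by rewrite RintegralD// IH2 RintegralZl// big_cons.
have E y : dotp u y * q y = \sum_j u ord0 j * (y ord0 j * q y).
  by rewrite mulr_suml; apply: eq_bigr => j _; rewrite mulrA.
have [k1 k2] := key (index_enum 'I_n); split.
  by under eq_fun do rewrite E.
under eq_Rintegral do rewrite E.
by rewrite k2; apply: eq_bigr => j _; rewrite mxE.
Qed.

Section levy_exponent.
Context {R : realType} {n : nat}.
Local Notation V := 'rV[R]_n.
Variables (rho : {measure set V -> \bar R}) (rho_levy : is_levy_measure rho).

Let D0 : set V := ~` [set 0].

Lemma measurable_sqnorm_gt (r : R) : measurable [set y : V | r < sqnorm y].
Proof.
have := @measurable_sqnorm R n _ _ id (@measurable_id _ _ setT).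
move=> /(_ measurableT `]r, +oo[%classic (measurable_itv _)).
rewrite setTI (_ : _ @^-1` _ = [set y : V | r < sqnorm y])//.
by apply/seteqP; split => y /=; rewrite in_itv/= andbT.
Qed.

Lemma measurable_setC0 : measurable D0.
Proof.
rewrite (_ : D0 = [set y | 0 < sqnorm y]); first exact: measurable_sqnorm_gt.
apply/seteqP; split => y /=; rewrite lt_neqAle sqnorm_ge0 andbT eq_sym sqnorm_eq0.
  by move=> /eqP.
by move=> /eqP.
Qed.

Lemma sqnorm_gt_sub (r : R) : 0 < r -> [set y : V | r < sqnorm y] `<=` D0.
Proof. by move=> r0 y /= ry y0; move: ry; rewrite y0 /sqnorm dotp0l ltNge ltW. Qed.

Let weight (y : V) : R := Num.min 1 (sqnorm y).

Let weight_ge0 y : 0 <= weight y.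
Proof. by rewrite /weight le_min ler01 sqnorm_ge0. Qed.

Let mweight : measurable_fun setT weight.
Proof. by apply: measurable_minr => //; exact: measurable_sqnorm. Qed.

Lemma integrable_levy_weight :
  rho.-integrable D0 (EFin \o (fun y => Num.min 1 (sqnorm y))).
Proof.
apply/integrableP; split; first exact/measurable_EFinP/measurable_funTS.
move: rho_levy; rewrite /is_levy_measure; apply: le_lt_trans.
rewrite le_eqVlt; apply/orP; left; apply/eqP; apply: eq_integral => y _ /=.
by rewrite ger0_norm//; exact: weight_ge0.
Qed.

Lemma levy_set_finite (r : R) : 0 < r -> r <= 1 ->
  (rho [set y : V | (r < sqnorm y)%R] < +oo)%E.
Proof.
move=> r0 r1; set D := [set y | _].
have mD : measurable D by exact: measurable_sqnorm_gt.
have -> : rho D = (\int[rho]_(y in D) 1)%E by rewrite integral_cst// mul1e.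
apply: (@le_lt_trans _ _ (\int[rho]_(y in D) (r^-1 * weight y)%:E)%E).
  apply: ge0_le_integral => //.
  - apply/measurable_EFinP/measurable_funTS/measurable_funM => //.
  - move=> y /= ry; rewrite lee_fin -ler_pdivrMl ?invr_gt0// invrK mulr1.
    by rewrite /weight le_min r1 ltW.
apply: (@le_lt_trans _ _ (\int[rho]_(y in D0) (r^-1 * weight y)%:E)%E).
  apply: ge0_subset_integral => //.
  - exact: measurable_setC0.
  - by apply/measurable_EFinP/measurable_funTS/measurable_funM.
  - by move=> y _; rewrite lee_fin mulr_ge0// invr_ge0 ltW.
  - exact: sqnorm_gt_sub.
have := integrable_fin_num measurable_setC0
  (integrableZl measurable_setC0 r^-1 integrable_levy_weight).
rewrite ge0_fin_numE//.
by apply: integral_ge0 => y _; rewrite -EFinM lee_fin mulr_ge0 ?invr_ge0 ?(ltW r0)//; exact: weight_ge0.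
Qed.

Lemma cintegrable_levy_kernel u : cintegrable rho D0 (levy_kernel u).
Proof.
apply: (cintegrable_le measurable_setC0 (cmeasurable_levy_kernel u)
  (integrableZl measurable_setC0 (3 * (1 + sqnorm u)) integrable_levy_weight)).
by move=> y _; exact: normc_levy_kernel.
Qed.

Lemma levy_truncation_cvg u :
  ccvg (fun k => cintegral rho [set y | k.+1%:R^-1 < sqnorm y] (levy_kernel u))
    (cintegral rho D0 (levy_kernel u)).
Proof.
pose Dk (k : nat) : set V := [set y | k.+1%:R^-1 < sqnorm y].
have Dk0 k : Dk k `<=` D0 by apply: sqnorm_gt_sub; rewrite invr_gt0.
under [X in ccvg X]eq_fun do rewrite (cintegral_indic _ _ (@Dk0 _)).
have mDk k : measurable (Dk k) by exact: measurable_sqnorm_gt.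
apply: (cdominated_cvg measurable_setC0 _ (cmeasurable_levy_kernel u) _
  (integrableZl measurable_setC0 (3 * (1 + sqnorm u)) integrable_levy_weight)).
- move=> k; apply: cmeasurableM; last exact: cmeasurable_levy_kernel.
  exact/cmeasurable_real/measurable_indic.
- move=> y Dy; rewrite -[X in ccvg _ X]mul1r; apply: ccvgM; last exact: ccvg_cst.
  apply: ccvg_real.
  have y0 : 0 < sqnorm y.
    by rewrite lt_neqAle sqnorm_ge0 andbT eq_sym sqnorm_eq0; apply/eqP.
  apply: cvg_near_cst.
  have /cvgr_lt/(_ _ y0) := @cvg_harmonic R; apply: filterS => k ky.
  by rewrite indicE mem_set.
- move=> k y _; rewrite Normc.normcM normc_real.
  apply: le_trans (normc_levy_kernel u y).
  rewrite ler_piMl ?normc_ge0// indicE; case: (_ \in _) => /=.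
    by rewrite normr1.
  by rewrite normr0.
Qed.

Section truncated.
Variables (D : set V) (mD : measurable D) (Dfin : (rho D < +oo)%E).

Let icst (r : R) : rho.-integrable D (EFin \o (fun=> r)).
Proof.
apply/integrableP; split; first exact: measurable_cst.
by rewrite /= integral_cst// lte_mul_pinfty.
Qed.

Let ibound (f : V -> R) (M : R) : measurable_fun setT f -> (forall y, `|f y| <= M) ->
  rho.-integrable D (EFin \o f).
Proof.
move=> mf fM; apply: (le_integrable mD _ _ (icst M)).
  exact/measurable_EFinP/measurable_funTS.
by move=> y _ /=; rewrite lee_fin (le_trans (fM y))// ler_norm.
Qed.

(** On a set of finite mass the compensator can be integrated by itself, and it
    contributes a linear form, that is, a translation. *)
Definition levy_drift : V :=
  \row_j \int[rho]_(y in D) (y ord0 j / (1 + sqnorm y)).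

Lemma truncated_drift u :
  rho.-integrable D (EFin \o (fun y => dotp u y / (1 + sqnorm y))) /\
  \int[rho]_(y in D) (dotp u y / (1 + sqnorm y)) = dotp u levy_drift.
Proof.
have ij j : rho.-integrable D (EFin \o (fun y : V => y ord0 j / (1 + sqnorm y))).
  apply: (@ibound _ 1).
    apply: measurable_funM; first exact: measurable_rV_coord.
    exact: measurable_inv1sqnorm.
  move=> y; have q1 : 0 < 1 + sqnorm y by rewrite ltr_pwDl ?sqnorm_ge0.
  rewrite normrM normfV (gtr0_norm q1) ler_pdivrMr// mul1r.
  apply: le_trans (normr_coord_le y j) _; rewrite -sqr_enorm.
  by have := sqr_ge0 (enorm y - 1); have := enorm_ge0 y; rewrite !expr2; nra.
exact: Rintegral_dotp.
Qed.

Lemma cintegral_levy_kernel_truncated u :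
  cintegral rho D (levy_kernel u) =
  cintegral (mfrestr mD Dfin) setT (fun y => expi (dotp u y)) - (fine (rho D))%:C
  - (0 +i* dotp u levy_drift).
Proof.
have me : cmeasurable_fun (fun y => expi (dotp u y)).
  by apply: cmeasurable_expi; exact: measurable_dotp.
have [i1 i2] := truncated_drift u.
have ie : cintegrable rho D (fun y => expi (dotp u y)).
  by apply: (cintegrable_le mD me (icst 1)) => y _; rewrite normc_expi.
have ic : cintegrable rho D (fun=> 1).
  by split; exact: icst.
rewrite (cintegral_mfrestr mD Dfin (M := 1) me); last by move=> y; rewrite normc_expi.
rewrite cintegralB//; last 2 first.
- exact: cintegrableB.
- by split => //; exact: icst.
rewrite cintegralB//; congr (_ - _ - _).
  by rewrite /cintegral !Rintegral_cst// mul1r mul0r.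
by rewrite /cintegral Rintegral_cst// mul0r i2.
Qed.

End truncated.

Variable s : R.
Hypothesis s0 : 0 < s.

(** Truncating the Levy measure to |y|^2 > 1 / (k + 1) makes the exponent the sum
    of minus a positive semidefinite form (the diffusion minus delta |u|^2), a
    linear term and a compound Poisson term; each exponentiates to a multiplier
    with constant 1, and k tends to infinity. *)
Lemma heat_multiplier_levy (t delta : R) (m : V) (a : 'M[R]_n) : 0 <= t ->
  a^T = a -> (forall u, delta * sqnorm u <= 2^-1 * dotp (u *m a^T) u) ->
  heat_multiplier s 1
    (fun u => cexp (t%:C * (levy_symbol m a rho u + (delta * sqnorm u)%:C))).
Proof.
move=> t0 aT age.
pose Dk (k : nat) : set V := [set y | k.+1%:R^-1 < sqnorm y].
have mDk k : measurable (Dk k) by exact: measurable_sqnorm_gt.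
have Dkfin k : (rho (Dk k) < +oo)%E.
  by apply: levy_set_finite; rewrite ?invr_gt0// invf_le1// ler1n.
pose q u := 2^-1 * dotp (u *m a^T) u - delta * sqnorm u.
pose z (k : nat) u : R[i] := t%:C *
  ((0 +i* dotp m u) - (q u)%:C + cintegral rho (Dk k) (levy_kernel u)).
apply: (@heat_multiplier_lim _ _ _ s0 _ (fun k u => cexp (z k u))); last first.
  move=> u; apply: ccvg_cexp; apply: ccvgM; first exact: ccvg_cst.
  rewrite (_ : levy_symbol _ _ _ _ + _ = (0 +i* dotp m u) - (q u)%:C +
    cintegral rho D0 (levy_kernel u)); last first.
    rewrite /levy_symbol /q rmorphB/= opprB -/(levy_kernel u); ring.
  by apply: ccvgD; [exact: ccvg_cst|exact: levy_truncation_cvg].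
move=> k.
pose la : {finite_measure set V -> \bar R} := mfrestr (mDk k) (Dkfin k).
pose b := (2 * t) *: (2^-1 *: a - delta%:M).
have bE u : 2^-1 * dotp (u *m b) u = t * q u.
  rewrite /b -scalemxAr dotpZl mulmxBr -scalemxAr dotpDl dotpNl dotpZl.
  by rewrite mul_mx_scalar dotpZl /q aT /sqnorm; field.
have b0 u : 0 <= dotp (u *m b) u.
  have : 0 <= 2^-1 * dotp (u *m b) u by rewrite bE mulr_ge0// subr_ge0.
  by rewrite pmulr_rge0// invr_gt0.
have bT : b^T = b by rewrite /b linearZ/= linearB/= linearZ/= aT tr_scalar_mx.
have h1 := heat_multiplier_psd s0 bT b0.
have h2 := heat_multiplier_translation s0 (t *: (m - levy_drift (Dk k))).
have h3 := heat_multiplier_exp s0 (heat_multiplierM (heat_multiplier_cst s0 t%:C)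
  (heat_multiplier_fourier s0 la)).
have := heat_multiplierM (heat_multiplierM h1 h2) h3.
rewrite !mulr1; apply: eq_heat_multiplier => u.
rewrite bE -cexp_real -cexp_im -!cexpD; congr cexp.
rewrite /z cintegral_levy_kernel_truncated normc_real (ger0_norm t0).
rewrite [la setT]mfrestr_setT dotpZr dotpDr dotpNr (dotpC m).
set A := cintegral _ _ _; case: A => A1 A2; simpc.
by congr Complex; rewrite /q; ring.
Qed.

End levy_exponent.

(** * Closed boxes determine a measure *)

Section boxes.
Context {R : realType} {n : nat}.
Local Notation V := 'rV[R]_n.
Local Notation leb := (@lebesgue_rV R n).
Implicit Types (a b v : V).

Definition box (a b : V) : set V :=
  [set v | forall i, a ord0 i <= v ord0 i <= b ord0 i].

Lemma boxE a b :
  box a b = [set v : V | forall i, `[a ord0 i, b ord0 i]%classic (v ord0 i)].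
Proof. by apply/seteqP; split => v /= h i; have := h i; rewrite /= in_itv/=. Qed.

Lemma measurable_box a b : measurable (box a b).
Proof.
have -> : box a b = \bigcap_(i in [set: 'I_n])
    (rV_coord i @^-1` `[a ord0 i, b ord0 i]%classic).
  rewrite boxE; apply/seteqP; split => v /= Av i; first by move=> _; exact: Av.
  exact: Av.
apply: fin_bigcap_measurable => // i _.
by rewrite -[X in measurable X]setTI; exact: measurable_rV_coord.
Qed.

Lemma lebesgue_box_lty a b : (leb (box a b) < +oo)%E.
Proof.
rewrite boxE (@lebesgue_rV_box R n (fun i => `[a ord0 i, b ord0 i]%classic))//.
rewrite ltey_eq; apply/orP; left.
elim/big_ind: _ => // [x y|i _]; first exact: fin_numM.
by rewrite /= lebesgue_measure_itv/=; case: ifPn.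
Qed.

Lemma integrable_indic_box a b :
  leb.-integrable setT (EFin \o (\1_(box a b) : V -> R)).
Proof.
apply/integrableP; split.
  by apply/measurable_EFinP; apply: measurable_indic; exact: measurable_box.
under eq_integral do rewrite gee0_abs ?lee_fin ?indicE//.
rewrite integral_indic//; last exact: measurable_box.
by rewrite setIT; exact: lebesgue_box_lty.
Qed.

Definition boxes : set (set V) := [set B | exists a b, B = box a b].

Lemma boxes_setI : setI_closed boxes.
Proof.
move=> _ _ [a [b ->]] [a' [b' ->]].
exists (\row_i Num.max (a ord0 i) (a' ord0 i)),
  (\row_i Num.min (b ord0 i) (b' ord0 i)).
apply/seteqP; split => v /=.
  move=> [h h'] i; rewrite !mxE ge_max le_min.
  by have /andP[-> ->] := h i; have /andP[-> ->] := h' i.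
move=> h; split=> i; have := h i; rewrite !mxE ge_max le_min;
  by move=> /andP[/andP[h1 h2] /andP[h3 h4]]; rewrite ?h1 ?h2 ?h3 ?h4.
Qed.

Definition cube (k : nat) : set V := box (const_mx (- k%:R)) (const_mx k%:R).

Lemma coord_le_cube (v : V) : exists k : nat, forall i, `|v ord0 i| <= k%:R.
Proof.
exists (Num.bound (enorm v)) => i; apply: (le_trans (normr_coord_le v i)).
by apply/ltW/archi_boundP/enorm_ge0.
Qed.

Lemma bigcup_cube : \bigcup_k cube k = setT.
Proof.
apply/seteqP; split => // v _; have [k vk] := coord_le_cube v.
by exists k => // i; rewrite !mxE -ler_norml.
Qed.

(** A half-space is a countable union of boxes, namely of its intersections with
    the cubes. *)
Lemma measurable_boxes : (measurable : set (set V)) = <<s boxes>>.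
Proof.
apply/seteqP; split; last first.
  apply: smallest_sub; first exact: sigma_algebra_measurable.
  by move=> _ [a [b ->]]; exact: measurable_box.
have mcoord i : measurable_fun (setT : set (g_sigma_algebraType boxes))
    (fun v : V => v ord0 i).
  apply: (measurability (@RGenCInfty.G R)); first exact: RGenCInfty.measurableE.
  move=> _ [_ [x ->] <-]; rewrite setTI.
  have -> : (fun v : V => v ord0 i) @^-1` `[x, +oo[%classic =
      \bigcup_k box (\row_j if j == i then x else - k%:R) (const_mx k%:R).
    apply/seteqP; split => v /=.
      rewrite in_itv/= andbT => xv; have [k vk] := coord_le_cube v.
      exists k => // j; rewrite !mxE; have := vk j; rewrite ler_norml => /andP[h1 h2].
      by rewrite h2 andbT; case: eqP => [->|_]; rewrite ?xv ?h1.
    move=> [k _ /(_ i)]; rewrite !mxE eqxx => /andP[xv _].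
    by rewrite in_itv/= xv.
  apply: bigcupT_measurable => k; apply: sub_sigma_algebra.
  by eexists; eexists; reflexivity.
apply: smallest_sub; first exact: smallest_sigma_algebra.
move=> A; rewrite -bigcup_seq/= => -[i _ [C mC <-]].
exact: mcoord.
Qed.

Lemma measure_box_unique (mu nu : {measure set V -> \bar R}) :
  (forall a b, mu (box a b) = nu (box a b)) ->
  (forall a b, mu (box a b) < +oo)%E ->
  forall A, measurable A -> mu A = nu A.
Proof.
move=> munu mufin A mA.
apply: (measure_unique boxes cube measurable_boxes boxes_setI _ bigcup_cube) => //.
- by move=> k; eexists; eexists; reflexivity.
- by move=> _ [a [b ->]]; exact: munu.
- by move=> k; exact: mufin.
Qed.

(** The l1 distance to the box. It is Lipschitz and vanishes exactly on the box,
    so that [box_bump] gives Lipschitz functions decreasing to the indicator. *)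
Definition box_dist (a b v : V) : R :=
  \sum_i (Num.max 0 (a ord0 i - v ord0 i) + Num.max 0 (v ord0 i - b ord0 i)).

Definition box_bump (a b : V) (k : nat) (v : V) : R :=
  Num.max 0 (1 - k%:R * box_dist a b v).

Let max0 (x : R) : 0 <= Num.max 0 x. Proof. by rewrite le_max lexx. Qed.

Let max0_le (x : R) : x <= Num.max 0 x. Proof. by rewrite le_max lexx orbT. Qed.

Let max0_lip (x y : R) : `|Num.max 0 x - Num.max 0 y| <= `|x - y|.
Proof.
wlog xy : x y / y <= x.
  move=> h; have [/h//|/ltW/h] := leP y x; by rewrite distrC (distrC y).
rewrite (ger0_norm (_ : 0 <= x - y)) ?subr_ge0//.
have [x0|x0] := leP 0 x; have [y0|y0] := leP 0 y; rewrite ger0_norm; lra.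
Qed.

Lemma box_dist_ge0 a b v : 0 <= box_dist a b v.
Proof. by apply: sumr_ge0 => i _; rewrite addr_ge0. Qed.

Lemma box_distP a b v : box_dist a b v = 0 <-> box a b v.
Proof.
split=> [d0 i|h].
  have h0 j : 0 <= Num.max 0 (a ord0 j - v ord0 j) + Num.max 0 (v ord0 j - b ord0 j).
    by rewrite addr_ge0.
  have /eqP := d0; rewrite psumr_eq0// => /allP/(_ i (mem_index_enum _))/=.
  rewrite paddr_eq0// => /andP[/eqP h1 /eqP h2].
  have := max0_le (a ord0 i - v ord0 i); have := max0_le (v ord0 i - b ord0 i).
  by rewrite h1 h2 !subr_le0 => -> ->.
apply: big1 => i _; have /andP[h1 h2] := h i.
by rewrite !(max_idPl _) ?addr0// subr_le0.
Qed.

Lemma box_dist_lip a b v v' :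
  `|box_dist a b v - box_dist a b v'| <= (2 * n)%:R * enorm (v - v').
Proof.
rewrite -sumrB; apply: (le_trans (ler_norm_sum _ _ _)).
apply: (@le_trans _ _ (\sum_(i < n) 2 * enorm (v - v'))); last first.
  rewrite sumr_const card_ord -mulr_natr natrM le_eqVlt; apply/orP; left.
  by apply/eqP; ring.
apply: ler_sum => i _.
have vi : `|v ord0 i - v' ord0 i| <= enorm (v - v').
  by have := normr_coord_le (v - v') i; rewrite !mxE.
rewrite opprD addrACA; apply: (le_trans (ler_normD _ _)).
rewrite mulr_natl mulr2n; apply: lerD; apply: (le_trans (max0_lip _ _)).
  rewrite (_ : _ - _ = - (v ord0 i - v' ord0 i)) ?normrN//; ring.
by rewrite (_ : _ - _ = v ord0 i - v' ord0 i)//; ring.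
Qed.

Lemma box_bump_ge0 a b k v : 0 <= box_bump a b k v.
Proof. exact: max0. Qed.

Lemma box_bump_le1 a b k v : box_bump a b k v <= 1.
Proof. by rewrite ge_max ler01 gerBl mulr_ge0 ?box_dist_ge0. Qed.

Lemma box_bump_lip a b k v v' : `|box_bump a b k v - box_bump a b k v'| <=
  (k * (2 * n))%:R * enorm (v - v').
Proof.
apply: (le_trans (max0_lip _ _)).
rewrite (_ : _ - _ = k%:R * (box_dist a b v' - box_dist a b v)); last by ring.
rewrite normrM distrC natrM -mulrA ger0_norm// ler_wpM2l//.
exact: box_dist_lip.
Qed.

Lemma measurable_box_bump a b k : measurable_fun setT (box_bump a b k).
Proof.
apply: measurable_maxr => //; apply: measurable_funB => //.
apply: measurable_funM => //; apply: measurable_sum => i.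
apply: measurable_funD; apply: measurable_maxr => //; apply: measurable_funB => //;
  exact: measurable_rV_coord.
Qed.

Lemma box_bump_support a b k v : box_bump a b k.+1 v <=
  \1_(box (a - const_mx 1) (b + const_mx 1)) v.
Proof.
rewrite indicE; have [_|] := boolP (v \in _); first exact: box_bump_le1.
rewrite ge_max lexx/= subr_le0; apply: contraR; rewrite -ltNge => d1.
have d2 : box_dist a b v < 1.
  apply: le_lt_trans d1; rewrite ler_peMl ?box_dist_ge0// ler1n//.
rewrite inE => i; rewrite !mxE.
have := d2; rewrite /box_dist (bigD1 i)//= => d3.
have : 0 <= \sum_(j < n | j != i) (Num.max 0 (a ord0 j - v ord0 j) +
  Num.max 0 (v ord0 j - b ord0 j)) by apply: sumr_ge0 => j _; rewrite addr_ge0.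
have := max0_le (a ord0 i - v ord0 i); have := max0_le (v ord0 i - b ord0 i).
have := max0 (a ord0 i - v ord0 i); have := max0 (v ord0 i - b ord0 i).
move=> h1 h2 h3 h4 h5; apply/andP; split; lra.
Qed.

Lemma box_bump_cvg a b v :
  (box_bump a b k.+1 v : R) @[k --> \oo] --> (\1_(box a b) v : R).
Proof.
have [vB|vB] := pselect (box a b v).
  rewrite indicE mem_set//; have d0 := (box_distP a b v).2 vB.
  under eq_fun do rewrite /box_bump d0 mulr0 subr0 (max_idPr _)//.
  exact: cvg_cst.
rewrite indicE memNset//.
have d0 : 0 < box_dist a b v.
  by rewrite lt_neqAle box_dist_ge0 andbT eq_sym; apply/eqP => /box_distP.
apply: cvg_near_cst; near=> k.
apply/max_idPl; rewrite subr_le0 -ler_pdivrMr// mul1r.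
apply: (@le_trans _ _ k%:R); last by rewrite ler_nat.
by near: k; exact: nbhs_infty_ger.
Unshelve. all: by end_near. Qed.

End boxes.

(** * The inverse Fourier transform is a density *)

Section heat_kernel.
Context {R : realType} {n : nat}.
Local Notation V := 'rV[R]_n.
Local Notation leb := (@lebesgue_rV R n).

(** (2 pi)^n times the density of the centred normal law of variance 2 r in each
    coordinate, with the factor that makes it the Fourier transform of
    exp(- r |u|^2). *)
Definition heat_kernel (r : R) (x : V) : R :=
  Num.sqrt (pi / r) ^+ n * gauss (4 * r)^-1 x.

Lemma heat_kernel_ge0 r x : 0 <= heat_kernel r x.
Proof. by rewrite mulr_ge0 ?gauss_ge0// exprn_ge0// sqrtr_ge0. Qed.

Lemma measurable_heat_kernel r : measurable_fun setT (heat_kernel r).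
Proof. by apply: measurable_funM => //; exact: measurable_gauss. Qed.

Lemma heat_kernel_le r x : 0 < r -> heat_kernel r x <= Num.sqrt (pi / r) ^+ n.
Proof.
move=> r0; rewrite ler_piMr ?exprn_ge0 ?sqrtr_ge0// -expR0 ler_expR oppr_le0.
by rewrite mulr_ge0 ?sqnorm_ge0// invr_ge0 mulr_ge0 ?ltW.
Qed.

Variable r : R.
Hypothesis r0 : 0 < r.

Let r4 : 0 < (4 * r)^-1. Proof. by rewrite invr_gt0 mulr_gt0. Qed.

Lemma integrable_heat_kernel : leb.-integrable setT (EFin \o heat_kernel r).
Proof.
have := integrableZl measurableT (Num.sqrt (pi / r) ^+ n) (@integrable_gauss R n _ r4).
by apply: eq_integrable => // x _ /=; rewrite -EFinM.
Qed.

Lemma Rintegral_heat_kernel :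
  \int[leb]_(x in setT) heat_kernel r x = (2 * pi) ^+ n.
Proof.
rewrite RintegralZl//; last exact: integrable_gauss.
rewrite /Rintegral integral_gauss// -exprMn -sqrtrM ?divr_ge0 ?pi_ge0 ?(ltW r0)//.
rewrite (_ : pi / r * (pi / (4 * r)^-1) = (2 * pi) ^+ 2).
  by rewrite sqrtr_sqr ger0_norm// mulr_ge0// pi_ge0.
by field; rewrite gt_eqF.
Qed.

(** Half of the Gaussian absorbs |x|, and the factor sqrt(8 r) that remains makes
    the first moment of the heat kernel tend to 0 with r. *)
Lemma enorm_heat_kernel_le x :
  enorm x * heat_kernel r x <=
  Num.sqrt (8 * r) * (Num.sqrt (pi / r) ^+ n * gauss (8 * r)^-1 x).
Proof.
rewrite /heat_kernel mulrCA [leRHS]mulrCA ler_wpM2l ?exprn_ge0 ?sqrtr_ge0//.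
have -> : gauss (4 * r)^-1 x = gauss (8 * r)^-1 x * gauss (8 * r)^-1 x.
  by rewrite /gauss -expRD; congr expR; field; rewrite gt_eqF.
rewrite mulrA ler_wpM2r ?gauss_ge0//.
rewrite {1}/gauss expRN ler_pdivrMr ?expR_gt0//.
set q := Num.sqrt (8 * r).
have q0 : 0 < q by rewrite sqrtr_gt0 mulr_gt0.
have q2 : q ^+ 2 = 8 * r by rewrite sqr_sqrtr// mulr_ge0// ltW.
rewrite -ler_pdivrMl// -sqr_enorm -q2 mulrC -(exprVn q) -exprMn mulrC.
set p := q^-1 * enorm x.
apply: le_trans (expR_ge1Dx _).
by have := sqr_ge0 (p - 1); rewrite !expr2; nra.
Qed.

Lemma Rintegral_enorm_heat_kernel :
  leb.-integrable setT (EFin \o (fun x => enorm x * heat_kernel r x)) /\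
  \int[leb]_(x in setT) (enorm x * heat_kernel r x) <=
  Num.sqrt (8 * r) * Num.sqrt (8 * pi ^+ 2) ^+ n.
Proof.
have r8 : 0 < (8 * r)^-1 by rewrite invr_gt0 mulr_gt0.
have ig := integrableZl measurableT (Num.sqrt (8 * r) * Num.sqrt (pi / r) ^+ n)
  (@integrable_gauss R n _ r8).
have me : measurable_fun setT (@enorm R n).
  apply: (measurableT_comp (continuous_measurable_fun (@sqrt_continuous R))) => //.
  exact: measurable_sqnorm.
have i1 : leb.-integrable setT (EFin \o (fun x => enorm x * heat_kernel r x)).
  apply: (le_integrable measurableT _ _ ig).
    by apply/measurable_EFinP/measurable_funM => //; exact: measurable_heat_kernel.
  move=> x _ /=; rewrite lee_fin.
  rewrite (ger0_norm (mulr_ge0 (enorm_ge0 x) (heat_kernel_ge0 r x))).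
  apply: (le_trans (enorm_heat_kernel_le x)); rewrite mulrA; exact: ler_norm.
split=> //; apply: (@le_trans _ _ (\int[leb]_(x in setT)
    (Num.sqrt (8 * r) * Num.sqrt (pi / r) ^+ n * gauss (8 * r)^-1 x))).
  apply: le_Rintegral => // x _.
  by apply: (le_trans (enorm_heat_kernel_le x)); rewrite mulrA.
rewrite RintegralZl//; last exact: integrable_gauss.
rewrite /Rintegral integral_gauss// -mulrA -exprMn -sqrtrM ?divr_ge0 ?pi_ge0 ?(ltW r0)//.
rewrite (_ : pi / r * (pi / (8 * r)^-1) = 8 * pi ^+ 2)//.
by field; rewrite gt_eqF.
Qed.

End heat_kernel.

Section density.
Context {R : realType} {n : nat}.
Local Notation V := 'rV[R]_n.
Local Notation leb := (@lebesgue_rV R n).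
Variables (nu : probability V R) (s : R) (w : V -> R[i]).
Hypothesis s0 : 0 < s.
Hypothesis hw : heat_bounded s 1 w.
Hypothesis nuE : forall u,
  cintegral nu setT (fun x => expi (dotp u x)) = (gauss s u)%:C * w u.

Let mw : cmeasurable_fun w. Proof. by case: hw. Qed.
Let w1 u : normc (w u) <= 1. Proof. by case: hw. Qed.

(* (2 pi)^n times the candidate density. *)
Let g (x : V) : R[i] := gauss_fourier s w x 0.

(* The convolution of nu with the heat kernel: nonnegative by construction, and a
   Fourier integral by [fourier_smooth_nu]. *)
Let smooth_nu (r : R) (x : V) : R :=
  \int[nu]_(y in setT) heat_kernel r (y - x).

Let icst (c : R) : nu.-integrable setT (EFin \o (fun=> c)).
Proof. exact: finite_measure_integrable_cst. Qed.

(** Fubini between nu and the Fourier representation of the heat kernel. *)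
Lemma fourier_smooth_nu r x : 0 < r ->
  (smooth_nu r x)%:C = cintegral leb setT
    (fun u => expi (- dotp x u) * ((gauss (r + s) u)%:C * w u)).
Proof.
move=> r0.
have mk : cmeasurable_fun (fun p : V * V =>
    expi (dotp (p.1 - x) p.2) * (gauss r p.2)%:C).
  apply: cmeasurableM.
    by apply: cmeasurable_expi; apply: measurable_dotp => //; exact: measurable_rVB.
  by apply: cmeasurable_real; exact: (measurableT_comp (measurable_gauss r)).
have nk y u : normc (expi (dotp (y - x) u) * (gauss r u)%:C) <= 1 * gauss r u.
  by rewrite Normc.normcM normc_expi !mul1r normc_real ger0_norm ?gauss_ge0.
have -> : (smooth_nu r x)%:C = cintegral nu setT (fun y =>
    cintegral leb setT (fun u => expi (dotp (y - x) u) * (gauss r u)%:C)).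
  under eq_cintegral do rewrite fourier_gauss//.
  by rewrite /cintegral /= Rintegral_cst// mul0r.
rewrite (cintegral_fubini mk (icst 1) (@integrable_gauss R n _ r0))//; last first.
  by move=> u; exact: gauss_ge0.
apply: eq_cintegral => u _ /=.
have -> : gauss (r + s) u = gauss r u * gauss s u.
  by rewrite /gauss -expRD; congr expR; ring.
pose c : R[i] := expi (- dotp x u) * (gauss r u)%:C.
transitivity (c * cintegral nu setT (fun y => expi (dotp u y))); last first.
  by rewrite nuE /c rmorphM/=; ring.
have ie : cintegrable nu setT (fun y : V => expi (dotp u y)).
  apply: (cintegrable_le measurableT _ (icst 1)).
    by apply: cmeasurable_expi; exact: measurable_dotp.
  by move=> y _; rewrite normc_expi.
rewrite -(cintegralZl measurableT c ie); apply: eq_cintegral => y _.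
by rewrite dotpDl dotpNl expiD (dotpC u y) /c; ring.
Qed.

Let rk (k : nat) : R := k.+1%:R^-1.

Let rk0 k : 0 < rk k. Proof. by rewrite invr_gt0. Qed.

Let gauss_le r (u : V) : 0 <= r -> gauss (r + s) u <= gauss s u.
Proof.
by move=> r0; rewrite ler_expR lerN2 ler_wpM2r ?sqnorm_ge0// lerDr.
Qed.

Let mint r x : cmeasurable_fun
  (fun u : V => expi (- dotp x u) * ((gauss r u)%:C * w u)).
Proof.
apply: cmeasurableM.
  apply: cmeasurable_expi; apply: measurableT_comp => //; exact: measurable_dotp.
by apply: cmeasurableM => //; apply: cmeasurable_real; exact: measurable_gauss.
Qed.

Let nint k x u :
  normc (expi (- dotp x u) * ((gauss (rk k + s) u)%:C * w u)) <= gauss s u.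
Proof.
rewrite !Normc.normcM normc_expi mul1r normc_real (ger0_norm (gauss_ge0 _ _)).
apply: (@le_trans _ _ (gauss (rk k + s) u)); first by rewrite ler_piMr ?gauss_ge0.
exact/gauss_le/ltW.
Qed.

Lemma smooth_nu_cvg x : ccvg (fun k => (smooth_nu (rk k) x)%:C) (g x).
Proof.
under [X in ccvg X]eq_fun do rewrite fourier_smooth_nu//.
rewrite /g /gauss_fourier.
rewrite (_ : fourier_kernel s w x 0 = (fun u : V =>
  expi (- dotp x u) * ((gauss s u)%:C * w u))); last first.
  by apply/funext => u; rewrite /fourier_kernel dotp0l expR0 mul1r.
apply: (cdominated_cvg measurableT (fun k => mint _ x) (mint _ x) _
  (@integrable_gauss R n _ s0)).
- move=> u _; apply: ccvgM; first exact: ccvg_cst.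
  apply: ccvgM; last exact: ccvg_cst.
  apply: ccvg_real; apply: continuous_cvg; first exact: continuous_expR.
  apply: cvgN; apply: cvgMl; rewrite -[X in _ --> X]add0r.
  by apply: cvgD; [exact: cvg_harmonic|exact: cvg_cst].
- by move=> k u _; exact: nint.
Qed.

Let smooth_nu_ge0 r x : 0 <= smooth_nu r x.
Proof. by apply: Rintegral_ge0 => y _; exact: heat_kernel_ge0. Qed.

Lemma gauss_fourier_real x : g x = (complex.Re (g x))%:C.
Proof.
have [_] := smooth_nu_cvg x; under eq_fun do rewrite /=.
move=> /cvg_lim; rewrite lim_cst// => h; case: (g x) h => a b /= <-//.
Qed.

Lemma gauss_fourier_ge0 x : 0 <= complex.Re (g x).
Proof.
have [h _] := smooth_nu_cvg x.
have /cvg_lim <- := h => //.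
apply: limr_ge; first by apply/cvg_ex; eexists; exact: h.
by apply: nearW => k; exact: smooth_nu_ge0.
Qed.

Let M : R := \int[leb]_(u in setT) gauss s u.

Lemma smooth_nu_bounded k x : smooth_nu (rk k) x <= M.
Proof.
have ik : cintegrable leb setT
    (fun u : V => expi (- dotp x u) * ((gauss (rk k + s) u)%:C * w u)).
  by apply: (cintegrable_le measurableT (mint _ x) (@integrable_gauss R n _ s0)) => u _.
rewrite -[leLHS]ger0_norm// -normc_real fourier_smooth_nu//.
apply: (le_trans (le_normc_cintegral measurableT (mint _ x) ik)).
apply: le_Rintegral => //.
- exact: (integrable_normc measurableT (mint _ x) ik).
- exact: integrable_gauss.
Qed.

Let mg : measurable_fun setT (fun x => complex.Re (g x)).
Proof. exact: (cmeasurable_gauss_fourier s mw 0).1. Qed.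

Let msmooth r : measurable_fun setT (smooth_nu r).
Proof.
apply: (measurable_Rintegral nu (f := fun p : V * V => heat_kernel r (p.2 - p.1))).
apply: (measurableT_comp (measurable_heat_kernel r)); exact: measurable_rVB.
Qed.

(** Smoothing by the heat kernel moves mass by O(sqrt r) on average, so it changes
    the integral of a Lipschitz function by at most that much. *)
Lemma smooth_nu_test (f : V -> R) (L : R) (a b : V) r : 0 < r ->
  measurable_fun setT f -> (forall v, 0 <= f v <= \1_(box a b) v) -> 0 <= L ->
  (forall v v', `|f v - f v'| <= L * enorm (v - v')) ->
  `|\int[leb]_(x in setT) (f x * smooth_nu r x) -
    (2 * pi) ^+ n * \int[nu]_(y in setT) f y| <=
  L * (Num.sqrt (8 * r) * Num.sqrt (8 * pi ^+ 2) ^+ n).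
Proof.
move=> r0 mf f01 L0 fL.
have f0 v : 0 <= f v by have /andP[] := f01 v.
have f1 v : f v <= 1.
  have /andP[_ h] := f01 v; apply: (le_trans h).
  by rewrite indicE; case: (_ \in _).
have fn v : `|f v| <= 1 by rewrite ger0_norm.
pose K : R := Num.sqrt (pi / r) ^+ n.
have hK (x : V) : heat_kernel r x <= K by exact: heat_kernel_le.
have K0 : 0 <= K by rewrite exprn_ge0// sqrtr_ge0.
have mk : measurable_fun setT (@heat_kernel R n r) by exact: measurable_heat_kernel.
have mB := measurable_box a b.
have iB := integrable_indic_box a b.
have mk2 : measurable_fun setT (fun p : V * V => f p.1 * heat_kernel r (p.2 - p.1)).
  apply: measurable_funM; first exact: (measurableT_comp mf).
  by apply: (measurableT_comp mk); exact: measurable_rVB.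
have bk2 x y : `|f x * heat_kernel r (y - x)| <= \1_(box a b) x * K.
  rewrite normrM !ger0_norm ?heat_kernel_ge0//.
  by apply: ler_pM => //; [exact: heat_kernel_ge0|have /andP[] := f01 x].
have hkN z : heat_kernel r (- z) = heat_kernel r z :> R.
  by rewrite /heat_kernel /gauss /sqnorm dotpNl dotpNr opprK.
have ik := @integrable_heat_kernel R n r r0.
have [ie Ie] := @Rintegral_enorm_heat_kernel R n r r0.
have e1 : \int[leb]_(x in setT) (f x * smooth_nu r x) =
    \int[nu]_(y in setT) \int[leb]_(x in setT) (f (x + y) * heat_kernel r x).
  transitivity (\int[leb]_(x in setT) \int[nu]_(y in setT) (f x * heat_kernel r (y - x))).
    apply: eq_Rintegral => x _; rewrite RintegralZl//.
    apply: (le_integrable measurableT _ _ (icst K)).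
      by apply/measurable_EFinP/(measurableT_comp mk); exact: measurable_rVB.
    move=> y _ /=; rewrite lee_fin !ger0_norm ?heat_kernel_ge0//.
  rewrite (Rintegral_fubini mk2 iB (icst K)) => [|x|//|//]; last first.
    by rewrite indicE.
  apply: eq_Rintegral => y _ /=.
  rewrite -[LHS](Rintegral_translation y (g := fun x => f x * heat_kernel r (y - x))).
    apply: eq_Rintegral => x _; congr (_ * _); rewrite -hkN; congr heat_kernel.
    by rewrite opprB addrK.
  by apply: measurable_funM => //; apply: (measurableT_comp mk); exact: measurable_rVB.
have ifk y : leb.-integrable setT (EFin \o (fun x => f (x + y) * heat_kernel r x)).
  apply: (le_integrable measurableT _ _ ik).
    apply/measurable_EFinP/measurable_funM => //.
    by apply: (measurableT_comp mf); exact: measurable_rVD.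
  move=> x _ /=; rewrite lee_fin normrM ler_piMl//.
have inu : nu.-integrable setT (EFin \o f).
  apply: (le_integrable measurableT _ _ (icst 1)); first exact/measurable_EFinP.
  by move=> y _ /=; rewrite lee_fin normr1.
have dE y : \int[leb]_(x in setT) (f (x + y) * heat_kernel r x) -
    (2 * pi) ^+ n * f y =
    \int[leb]_(x in setT) ((f (x + y) - f y) * heat_kernel r x).
  rewrite -(Rintegral_heat_kernel r0) mulrC -RintegralZl// -RintegralB//; last first.
    exact: (integrableZl measurableT (f y) ik).
  by apply: eq_Rintegral => x _; rewrite mulrBl.
have dB y : `|\int[leb]_(x in setT) (f (x + y) * heat_kernel r x) -
    (2 * pi) ^+ n * f y| <=
    L * (Num.sqrt (8 * r) * Num.sqrt (8 * pi ^+ 2) ^+ n).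
  rewrite dE.
  have idk : leb.-integrable setT
      (EFin \o (fun x => (f (x + y) - f y) * heat_kernel r x)).
    have := integrableB measurableT (ifk y) (integrableZl measurableT (f y) ik).
    by apply: eq_integrable => // x _ /=; rewrite mulrBl.
  apply: (le_trans (le_normr_Rintegral measurableT idk)).
  apply: (@le_trans _ _ (\int[leb]_(x in setT) (L * (enorm x * heat_kernel r x)))).
    apply: le_Rintegral => //.
    - exact: integrable_norm.
    - exact: (integrableZl measurableT L ie).
    - move=> x _; rewrite normrM (ger0_norm (heat_kernel_ge0 _ _)) mulrA.
      rewrite ler_wpM2r ?heat_kernel_ge0//.
      by have := fL (x + y) y; rewrite addrK.
  by rewrite RintegralZl// ler_wpM2l.
have mI : measurable_fun setT
    (fun y => \int[leb]_(x in setT) (f (x + y) * heat_kernel r x)).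
  apply: (measurable_Rintegral leb (f := fun p : V * V => f (p.2 + p.1) * heat_kernel r p.2)).
  apply: measurable_funM; last exact: (measurableT_comp mk).
  by apply: (measurableT_comp mf); exact: measurable_rVD.
have iI : nu.-integrable setT (EFin \o
    (fun y => \int[leb]_(x in setT) (f (x + y) * heat_kernel r x))).
  apply: (le_integrable measurableT _ _ (icst ((2 * pi) ^+ n))).
    exact/measurable_EFinP.
  move=> y _ /=; rewrite lee_fin (le_trans (le_normr_Rintegral _ _))//.
  rewrite -(Rintegral_heat_kernel r0) (le_trans _ (ler_norm _))//.
  apply: le_Rintegral => //; first exact: integrable_norm.
  by move=> x _; rewrite normrM (ger0_norm (heat_kernel_ge0 _ _)) ler_piMl ?heat_kernel_ge0.
rewrite e1 -RintegralZl// -RintegralB//; last first.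
  exact: (integrableZl measurableT _ inu).
apply: (le_trans (le_normr_Rintegral _ _)) => //.
  have := integrableB measurableT iI (integrableZl measurableT ((2 * pi) ^+ n) inu).
  exact: eq_integrable.
set C := L * _.
rewrite (_ : C = \int[nu]_(y in setT) C); last first.
  by rewrite Rintegral_cst// [X in fine X](probability_setT nu) mulr1.
apply: le_Rintegral => //.
apply: integrable_norm.
have := integrableB measurableT iI (integrableZl measurableT ((2 * pi) ^+ n) inu).
exact: eq_integrable.
Qed.

Lemma integrable_gauss_fourier :
  leb.-integrable setT (EFin \o (fun x => complex.Re (g x))).
Proof.
apply/integrableP; split; first exact/measurable_EFinP.
have [_ _ /(_ 0) h] := hw.
apply: le_lt_trans (le_lt_trans h (ltry _)).
apply: ge0_le_integral => //.
- by apply/measurable_EFinP/measurableT_comp.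
- exact/measurable_EFinP/measurable_normc/cmeasurable_gauss_fourier.
- move=> x _; change (`|complex.Re (g x)|%:E <= (normc (g x))%:E)%E.
  by rewrite lee_fin; exact: normc_Re.
Qed.

(** Both sides are the limit, as r tends to 0, of the integral of f against the
    smoothed measure. *)
Lemma gauss_fourier_test (f : V -> R) (L : R) (a b : V) :
  measurable_fun setT f -> (forall v, 0 <= f v <= \1_(box a b) v) -> 0 <= L ->
  (forall v v', `|f v - f v'| <= L * enorm (v - v')) ->
  \int[leb]_(x in setT) (f x * complex.Re (g x)) =
  (2 * pi) ^+ n * \int[nu]_(y in setT) f y.
Proof.
move=> mf f01 L0 fL.
have f0 v : 0 <= f v by have /andP[] := f01 v.
have iB : leb.-integrable setT (EFin \o (fun x => M * \1_(box a b) x)).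
  exact: (integrableZl measurableT M (integrable_indic_box a b)).
have M0 : 0 <= M by apply: Rintegral_ge0 => u _; exact: gauss_ge0.
have c1 : (\int[leb]_(x in setT) (f x * smooth_nu (rk k) x) : R) @[k --> \oo] -->
    \int[leb]_(x in setT) (f x * complex.Re (g x)).
  apply: (Rdominated_cvg measurableT (fun k => measurable_funM mf (msmooth (rk k)))
    (measurable_funM mf mg) _ iB) => [x _|k x _].
    by apply: cvgMr; exact: (smooth_nu_cvg x).1.
  rewrite /= ger0_norm ?mulr_ge0// mulrC.
  apply: ler_pM => //; first exact: smooth_nu_bounded.
  by have /andP[] := f01 x.
have c2 : (\int[leb]_(x in setT) (f x * smooth_nu (rk k) x) : R) @[k --> \oo] -->
    (2 * pi) ^+ n * \int[nu]_(y in setT) f y.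
  apply/cvgrPdist_le => eps e0.
  have sq0 : (L * (Num.sqrt (8 * rk k) * Num.sqrt (8 * pi ^+ 2) ^+ n) : R)
      @[k --> \oo] --> (0 : R).
    rewrite -(mulr0 L); apply: cvgMr; rewrite -(mul0r (Num.sqrt (8 * pi ^+ 2) ^+ n)).
    apply: cvgMl; rewrite -sqrtr0; apply: continuous_cvg; first exact: sqrt_continuous.
    rewrite -(mulr0 8); apply: cvgMr; exact: cvg_harmonic.
  have /cvgrPdist_le/(_ _ e0) := sq0; apply: filterS => k.
  rewrite sub0r normrN => h; rewrite distrC.
  apply: (le_trans (smooth_nu_test (rk0 k) mf f01 L0 fL)).
  exact: (le_trans (ler_norm _)).
by rewrite -(cvg_lim _ c1)// -(cvg_lim _ c2).
Qed.

Lemma gauss_fourier_box (a b : V) :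
  \int[leb]_(x in box a b) complex.Re (g x) = (2 * pi) ^+ n * fine (nu (box a b)).
Proof.
have mB := measurable_box a b.
have bump01 k v : 0 <= box_bump a b k.+1 v <=
    \1_(box (a - const_mx 1) (b + const_mx 1)) v.
  by rewrite box_bump_ge0 box_bump_support.
have e k := gauss_fourier_test (measurable_box_bump a b k.+1) (bump01 k)
  (ler0n _ _) (box_bump_lip a b k.+1).
have lim_bump (mu : {measure set V -> \bar R}) (h : V -> R) :
    mu.-integrable setT (EFin \o h) -> (forall x, 0 <= h x) ->
    (\int[mu]_(x in setT) (box_bump a b k.+1 x * h x) : R) @[k --> \oo] -->
    \int[mu]_(x in box a b) h x.
  move=> ih h0.
  have mh : measurable_fun setT h by have /integrableP[/measurable_EFinP] := ih.
  have -> : \int[mu]_(x in box a b) h x = \int[mu]_(x in setT) (\1_(box a b) x * h x).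
    rewrite Rintegral_mkcond; apply: eq_Rintegral => x _.
    by rewrite patchE indicE; case: (x \in _); rewrite ?mul1r ?mul0r.
  apply: (Rdominated_cvg measurableT
    (fun k => measurable_funM (measurable_box_bump a b k.+1) mh)
    (measurable_funM (measurable_indic mB) mh) _ ih) => [x _|k x _].
    by apply: cvgMl; exact: box_bump_cvg.
  by rewrite ger0_norm ?mulr_ge0 ?box_bump_ge0// ler_piMl// box_bump_le1.
have l1 := lim_bump leb _ integrable_gauss_fourier gauss_fourier_ge0.
have l2 := lim_bump nu _ (icst 1) (fun=> ler01).
have eqf : (fun k => \int[leb]_(x in setT) (box_bump a b k.+1 x * complex.Re (g x))) =
    (fun k => (2 * pi) ^+ n * \int[nu]_(y in setT) (box_bump a b k.+1 y * 1)).
  apply/funext => k; rewrite e; congr (_ * _).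
  by apply: eq_Rintegral => y _; rewrite mulr1.
have l3 : (\int[leb]_(x in setT) (box_bump a b k.+1 x * complex.Re (g x)) : R)
    @[k --> \oo] --> (2 * pi) ^+ n * \int[nu]_(x in box a b) 1.
  by rewrite eqf; apply: cvgMr.
by rewrite -(cvg_lim _ l1)// (cvg_lim _ l3)// Rintegral_cst// mul1r.
Qed.

Definition fourier_density (x : V) : R := ((2 * pi) ^+ n)^-1 * complex.Re (g x).

Lemma fourier_densityP : is_density nu fourier_density.
Proof.
have c0 : 0 < (2 * pi) ^+ n :> R by rewrite exprn_gt0// mulr_gt0// pi_gt0.
have d0 x : 0 <= fourier_density x.
  by rewrite mulr_ge0 ?invr_ge0 ?(ltW c0)// gauss_fourier_ge0.
have md : measurable_fun setT fourier_density by exact: measurable_funM.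
split=> // A mA.
have mdE : measurable_fun setT (EFin \o fourier_density) by exact/measurable_EFinP.
have d0E x : (0 <= (EFin \o fourier_density) x)%E by rewrite lee_fin.
pose D (A : set V) : \bar R := (\int[leb]_(x in A) (EFin \o fourier_density) x)%E.
have D_0 : D set0 = 0%E by exact: integral_set0.
have D_ge0 B : (0 <= D B)%E by apply: integral_ge0 => x _.
have D_add : semi_sigma_additive D by exact: semi_sigma_additive_nng_induced.
pose Dm := isMeasure.Build _ V R D D_0 D_ge0 D_add.
pose DM : {measure set V -> \bar R} := HB.pack D Dm.
rewrite -[RHS]/(DM A); apply: (measure_box_unique (nu := DM)) => //.
- move=> a b /=; rewrite /D.
  have id_ : leb.-integrable (box a b) (EFin \o fourier_density).
    apply: (integrableS measurableT (measurable_box a b) (subsetT _)).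
    have := integrableZl measurableT ((2 * pi) ^+ n)^-1 integrable_gauss_fourier.
    by apply: eq_integrable => // x _ /=; rewrite -EFinM.
  rewrite -[LHS]fineK; last by rewrite fin_num_measure//; exact: measurable_box.
  rewrite -[RHS]fineK; last exact: (integrable_fin_num (measurable_box a b) id_).
  congr EFin; rewrite -[RHS]/(\int[leb]_(x in box a b) fourier_density x).
  rewrite RintegralZl//; last 2 first.
  - exact: measurable_box.
  - exact: (integrableS measurableT (measurable_box a b) (subsetT _) integrable_gauss_fourier).
  by rewrite gauss_fourier_box mulKf// gt_eqF.
- move=> a b; apply: le_lt_trans (probability_le1 nu (measurable_box a b)) _.
  exact: ltry.
Qed.

End density.

(** * Holomorphy of the inverse Fourier transform *)

Section quadratic_remainder.
Context {K : numFieldType} {V W : normedModType K}.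

(** A remainder of second order is little-o of the increment. *)
Lemma differentiable_quadratic (f : V -> W) (df : {linear V -> W}) (x : V)
    (B C : K) : 0 < B -> 0 < C ->
  (forall h, `|df h| <= B * `|h|) ->
  (forall h, `|h| <= 1 -> `|f (x + h) - f x - df h| <= C * `|h| ^+ 2) ->
  differentiable f x.
Proof.
move=> B0 C0 dB fC.
have dc : continuous df.
  apply: bounded_linear_continuous; apply/linear_boundedP.
  exists B; split; first exact: gtr0_real.
  move=> r rB y; apply: (le_trans (dB y)); rewrite ler_wpM2r//; exact: ltW.
have fE : f \o shift x = cst (f x) + df +o_ 0 id.
  apply/eqaddoP => e e0; near=> h.
  have h1 : `|h| <= 1.
    near: h; apply: nbhs0_le => //.
  have he : `|h| <= e / C.
    near: h; apply: nbhs0_le => //; exact: divr_gt0.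
  rewrite !fctE /=.
  rewrite (_ : f (h + x) - (f x + df h) = f (x + h) - f x - df h); last first.
    by rewrite opprD addrA (addrC h).
  apply: (le_trans (fC h h1)); rewrite expr2 mulrA ler_wpM2r//.
  by rewrite mulrC -ler_pdivlMr.
by apply/diff_locallyP; rewrite (diff_unique dc fE).
Unshelve. all: by end_near. Qed.

End quadratic_remainder.

Section holomorphy.
Context {R : realType} {n : nat}.
Local Notation V := 'rV[R]_n.
Local Notation U := 'rV[R[i]]_n.
Local Notation leb := (@lebesgue_rV R n).
Variables (s : R) (w : V -> R[i]).
Hypothesis s0 : 0 < s.
Implicit Types (z h : U) (u : V).
Hypotheses (mw : cmeasurable_fun w) (w1 : forall u, normc (w u) <= 1).

(** The complex linear form z |-> - i z.u; its exponential is the oscillating factor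
    of the Fourier integral at the complex point z. *)
Definition phase (z : U) (u : V) : R[i] :=
  - (0 +i* 1) * \sum_j z ord0 j * (u ord0 j)%:C.

Lemma phaseD z z' u : phase (z + z') u = phase z u + phase z' u.
Proof.
rewrite /phase -mulrDr -big_split/=; congr (_ * _).
by apply: eq_bigr => j _; rewrite mxE mulrDl.
Qed.

Lemma phaseZ (c : R[i]) z u : phase (c *: z) u = c * phase z u.
Proof.
rewrite /phase mulrCA; congr (_ * _); rewrite mulr_sumr.
by apply: eq_bigr => j _; rewrite mxE mulrA.
Qed.

(** The norm of a complex row vector takes its values in R[i]; this is the
    corresponding real number. *)
Definition row_norm (z : U) : R := complex.Re `|z|.

Lemma row_normE z : `|z| = (row_norm z)%:C.
Proof.
have : 0 <= `|z| by exact: normr_ge0.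
by rewrite /row_norm; case: `|z| => a b; rewrite lecE /= => /andP[/eqP -> _].
Qed.

Lemma row_norm_ge0 z : 0 <= row_norm z.
Proof.
have : 0 <= `|z| by exact: normr_ge0.
by rewrite row_normE lecE /= => /andP[_].
Qed.

Lemma normc_coord_le z j : normc (z ord0 j) <= row_norm z.
Proof.
have : `|z ord0 j| <= `|z|.
  rewrite [leRHS]/Num.norm/= mx_normE -[leLHS]nngE num_le.
  exact: (le_bigmax _ (fun i => `|z i.1 i.2|%:nng) (ord0, j)).
by rewrite row_normE lecE /= => /andP[_].
Qed.

Lemma normc_phase_le z u : normc (phase z u) <= n%:R * row_norm z * enorm u.
Proof.
rewrite /phase Normc.normcM normcN normc_im normr1 mul1r.
apply: (@le_trans _ _ (\sum_j normc (z ord0 j * (u ord0 j)%:C))).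
  elim/big_rec2: _ => [|j a b _ ab]; first by rewrite Normc.normc0.
  by apply: (le_trans (le_normcD _ _)); rewrite lerD2l.
apply: (@le_trans _ _ (\sum_(j < n) row_norm z * enorm u)).
  apply: ler_sum => j _; rewrite Normc.normcM normc_real.
  apply: ler_pM => //; [exact: normc_ge0|exact: normc_coord_le|exact: normr_coord_le].
by rewrite sumr_const card_ord -mulrA mulr_natl.
Qed.

Lemma cmeasurable_phase z : cmeasurable_fun (phase z).
Proof.
apply: cmeasurableM; first exact: cmeasurable_cst.
suff H (r : seq 'I_n) : cmeasurable_fun (fun u : V => \sum_(j <- r) z ord0 j * (u ord0 j)%:C) by exact: H.
elim: r => [|j r IH].
  by under eq_fun do rewrite big_nil; exact: cmeasurable_cst.
under eq_fun do rewrite big_cons.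
apply: cmeasurableD => //; apply: cmeasurableM; first exact: cmeasurable_cst.
by apply: cmeasurable_real; exact: measurable_coord.
Qed.

Definition re_part (z : U) : V := \row_j complex.Re (z ord0 j).
Definition im_part (z : U) : V := \row_j complex.Im (z ord0 j).

Lemma phaseE z u : phase z u = dotp (im_part z) u +i* - dotp (re_part z) u.
Proof.
rewrite /phase /dotp.
have -> : \sum_j z ord0 j * (u ord0 j)%:C =
    (\sum_j re_part z ord0 j * u ord0 j) +i* (\sum_j im_part z ord0 j * u ord0 j).
  elim/big_rec3: _ => // j a b c _ ->; rewrite !mxE.
  by case: (z ord0 j) => p q; rewrite /= ; simpc.
by simpc.
Qed.

Let K (z : U) (u : V) : R[i] := cexp (phase z u) * ((gauss s u)%:C * w u).

Lemma fourier_kernel_phase z : fourier_kernel s w (re_part z) (im_part z) = K z.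
Proof.
apply/funext => u; rewrite /K phaseE /cexp /= /fourier_kernel rmorphM/=; ring.
Qed.

(** The inverse Fourier transform of exp(- s |u|^2) w(u) at the complex point z. *)
Definition fourier_extension (z : U) : R[i] :=
  (((2 * pi) ^+ n)^-1)%:C * gauss_fourier s w (re_part z) (im_part z).

Section at_point.
Variable z : U.

(* With N = row_norm h <= 1, the remainder is at most |K z u| times
   4 n^2 N^2 exp((n + 1) |u|), and |K z u| contributes exp(|im_part z| |u|); G is an
   integrable bound of the product of these exponentials with the Gaussian. *)
Let c : R := n.+1%:R + enorm (im_part z).
Let G (u : V) : R := expR (c ^+ 2 / (2 * s)) * gauss (s / 2) u.

Let mK z' : cmeasurable_fun (K z').
Proof. by rewrite -fourier_kernel_phase; exact: cmeasurable_kernel. Qed.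

Let iK z' : cintegrable leb setT (K z').
Proof. by rewrite -fourier_kernel_phase; apply: cintegrable_kernel. Qed.

Let iG (B : R) : leb.-integrable setT (EFin \o (fun u => B * G u)).
Proof.
have s20 : 0 < s / 2 by rewrite divr_gt0.
have := integrableZl measurableT (B * expR (c ^+ 2 / (2 * s)))
  (@integrable_gauss R n _ s20).
by apply: eq_integrable => // u _ /=; rewrite -EFinM mulrA.
Qed.

Let G_ge u : expR (n.+1%:R * enorm u) * normc (K z u) <= G u.
Proof.
apply: le_trans (expR_gauss_le c u s0).
rewrite -fourier_kernel_phase /fourier_kernel !Normc.normcM normc_expi mul1r normc_real.
rewrite ger0_norm ?mulr_ge0 ?expR_ge0 ?gauss_ge0//.
rewrite /c mulrDl expRD -[leRHS]mulrA ler_wpM2l ?expR_ge0//.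
rewrite -[leRHS]mulr1; apply: ler_pM => //.
- by rewrite mulr_ge0 ?expR_ge0 ?gauss_ge0.
- exact: normc_ge0.
- rewrite ler_wpM2r ?gauss_ge0// ler_expR.
  exact: le_trans (ler_norm _) (dotp_le_enorm _ _).
Qed.

Let dK (h : U) (u : V) : R[i] := K z u * phase h u.

Let mdK h : cmeasurable_fun (dK h).
Proof. by apply: cmeasurableM => //; exact: cmeasurable_phase. Qed.

Let ndK h u : normc (dK h u) <= n%:R * row_norm h * G u.
Proof.
rewrite /dK Normc.normcM.
apply: (@le_trans _ _ (normc (K z u) * (n%:R * row_norm h * expR (n.+1%:R * enorm u)))).
  rewrite ler_wpM2l ?normc_ge0//; apply: (le_trans (normc_phase_le h u)).
  rewrite ler_wpM2l ?mulr_ge0 ?row_norm_ge0 ?ler0n//.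
  apply: le_trans (_ : n.+1%:R * enorm u <= _).
    by rewrite ler_peMl ?enorm_ge0// ler1n.
  by apply: le_trans (expR_ge1Dx _); rewrite lerDr.
rewrite mulrCA; apply: ler_wpM2l; last by rewrite mulrC; exact: G_ge.
by rewrite mulr_ge0 ?row_norm_ge0 ?ler0n.
Qed.

Let idK h : cintegrable leb setT (dK h).
Proof. apply: (cintegrable_le measurableT (mdK h) (iG (n%:R * row_norm h))) => u _.
exact: ndK.
Qed.

Let L (h : U) : R[i] := cintegral leb setT (dK h).

Let L_lin : linear L.
Proof.
move=> k h h'; rewrite /L -[k *: cintegral _ _ _]/(k * _).
rewrite -(cintegralZl measurableT k (idK h)) -(cintegralD measurableT _ (idK h')); last first.
  exact: (cintegrableZl measurableT k (idK h)).
by apply: eq_cintegral => u _; rewrite /dK phaseD phaseZ; ring.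
Qed.

Let M : R := \int[leb]_(u in setT) G u.

Let M_ge0 : 0 <= M.
Proof. by apply: Rintegral_ge0 => u _; rewrite mulr_ge0 ?expR_ge0 ?gauss_ge0. Qed.

Let int_le (k : V -> R[i]) (B : R) : cmeasurable_fun k ->
  (forall u, normc (k u) <= B * G u) -> normc (cintegral leb setT k) <= B * M.
Proof.
move=> mk kB.
have ik : cintegrable leb setT k.
  by apply: (cintegrable_le measurableT mk (iG B)) => u _.
apply: (le_trans (le_normc_cintegral measurableT mk ik)).
have iG1 : leb.-integrable setT (EFin \o G).
  by have := iG 1; apply: eq_integrable => // u _ /=; rewrite mul1r.
rewrite /M -(RintegralZl B measurableT iG1); apply: le_Rintegral => //.
exact: (integrable_normc measurableT mk ik).
Qed.

Let L_bound h : normc (L h) <= n%:R * M * row_norm h.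
Proof.
by rewrite mulrAC; apply: int_le => // u; exact: ndK.
Qed.

Let remainder h : row_norm h <= 1 ->
  normc (cintegral leb setT (K (z + h)) - cintegral leb setT (K z) - L h) <=
  4 * n%:R ^+ 2 * M * row_norm h ^+ 2.
Proof.
move=> h1; rewrite -(cintegralB measurableT (iK _) (iK _)).
rewrite -(cintegralB measurableT (cintegrableB measurableT (iK _) (iK _)) (idK h)).
rewrite mulrAC; apply: int_le.
  by apply: cmeasurableB => //; apply: cmeasurableB.
move=> u.
rewrite (_ : _ - _ = K z u * (cexp (phase h u) - 1 - phase h u)); last first.
  by rewrite /dK /K phaseD cexpD; ring.
rewrite Normc.normcM.
set e := enorm u; have e0 : 0 <= e := enorm_ge0 u.
set N := row_norm h; have N0 : 0 <= N := row_norm_ge0 h.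
have pe : normc (phase h u) <= n%:R * N * e := normc_phase_le h u.
apply: (@le_trans _ _ (normc (K z u) *
    (4 * n%:R ^+ 2 * N ^+ 2 * expR (n.+1%:R * e)))); last first.
  rewrite mulrCA; apply: ler_wpM2l; last by rewrite mulrC; exact: G_ge.
  by rewrite !mulr_ge0 ?exprn_ge0.
rewrite ler_wpM2l ?normc_ge0//; apply: (le_trans (normc_cexpB1B _)).
apply: (@le_trans _ _ (2 * (n%:R * N * e) ^+ 2 * expR (n%:R * e))).
  apply: ler_pM; rewrite ?mulr_ge0 ?exprn_ge0 ?normc_ge0 ?expR_ge0//.
    by rewrite ler_wpM2l// lerXn2r// nnegrE ?normc_ge0// !mulr_ge0.
  rewrite ler_expR (le_trans pe)// ler_wpM2r// -[leRHS]mulr1 ler_wpM2l//.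
have e2 : e ^+ 2 <= 2 * expR e.
  have := expR_ge1Dxn 1 e0; rewrite (_ : 2`! = 2)%N// => h2; lra.
have -> : n.+1%:R = n%:R + 1 :> R by rewrite natr1.
rewrite (mulrDl _ 1 e) mul1r expRD !exprMn.
have -> : 2 * (n%:R ^+ 2 * N ^+ 2 * e ^+ 2) * expR (n%:R * e) =
  (2 * n%:R ^+ 2 * N ^+ 2 * expR (n%:R * e)) * e ^+ 2 by ring.
have -> : 4 * n%:R ^+ 2 * N ^+ 2 * (expR (n%:R * e) * expR e) =
  (2 * n%:R ^+ 2 * N ^+ 2 * expR (n%:R * e)) * (2 * expR e) by ring.
by rewrite ler_wpM2l// !mulr_ge0 ?exprn_ge0 ?expR_ge0.
Qed.

Lemma differentiable_fourier_extension : differentiable fourier_extension z.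
Proof.
pose q : R := ((2 * pi) ^+ n)^-1.
have q0 : 0 < q by rewrite invr_gt0 exprn_gt0// mulr_gt0// pi_gt0.
pose D (h : U) : R[i] := q%:C * L h.
have Dlin : linear D.
  by move=> k h h'; rewrite /D L_lin /GRing.scale/=; ring.
pose Dl := GRing.isLinear.Build R[i] U R[i] _ D Dlin.
pose DL : {linear U -> R[i]} := HB.pack D Dl.
have FE z' : fourier_extension z' = q%:C * cintegral leb setT (K z').
  by rewrite /fourier_extension /gauss_fourier fourier_kernel_phase.
have complexE (x : R[i]) : `|x| = (normc x)%:C by [].
apply: (@differentiable_quadratic _ _ _ _ DL z (q * (n%:R * M + 1))%:C
  (q * (4 * n%:R ^+ 2 * M + 1))%:C).
- by rewrite ltcR mulr_gt0// ltr_wpDl// mulr_ge0.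
- by rewrite ltcR mulr_gt0// ltr_wpDl// !mulr_ge0.
- move=> h; rewrite complexE row_normE -rmorphM lecR -[DL h]/(q%:C * L h) Normc.normcM normc_real.
  rewrite (gtr0_norm q0) -mulrA ler_wpM2l ?(ltW q0)//.
  by apply: (le_trans (L_bound h)); rewrite ler_wpM2r ?row_norm_ge0// lerDl.
- move=> h; rewrite row_normE lecR => h1.
  have -> : (row_norm h)%:C ^+ 2 = (row_norm h ^+ 2)%:C by rewrite rmorphXn.
  rewrite complexE -rmorphM lecR !FE -[DL h]/(q%:C * L h) -!mulrBr Normc.normcM normc_real.
  rewrite (gtr0_norm q0) -[leRHS]mulrA; apply: ler_wpM2l; first exact: ltW.
  by apply: (le_trans (remainder h1)); rewrite ler_wpM2r ?exprn_ge0 ?row_norm_ge0// lerDl.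
Qed.

End at_point.

Lemma holomorphic_fourier_extension : holomorphic fourier_extension.
Proof. exact: differentiable_fourier_extension. Qed.

Lemma re_part_cvec x y : re_part (cvec x y) = x.
Proof. by apply/rowP => j; rewrite !mxE. Qed.

Lemma im_part_cvec x y : im_part (cvec x y) = y.
Proof. by apply/rowP => j; rewrite !mxE. Qed.

End holomorphy.

(** * Functions whose derivatives all grow at most quadratically *)

Section tame.
Context {R : realType} {n : nat}.
Local Notation V := 'rV[R]_n.
Implicit Types (f g : V -> R) (u v x : V).

Lemma enormD u v : enorm (u + v) <= enorm u + enorm v.
Proof.
rewrite -(@ler_pXn2r _ 2)// ?nnegrE ?addr_ge0 ?enorm_ge0//.
rewrite sqrrD !sqr_enorm sqnormD lerD2r lerD2l.
rewrite -[leRHS]mulr_natl ler_wpM2l// (le_trans (ler_norm _))//.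
exact: dotp_le_enorm.
Qed.

Lemma enormZ (c : R) u : enorm (c *: u) = `|c| * enorm u.
Proof. by rewrite /enorm sqnormZ sqrtrM ?sqr_ge0// sqrtr_sqr. Qed.

Lemma continuous_add f g : continuous f -> continuous g ->
  continuous (fun u => f u + g u).
Proof. by move=> cf cg x; apply: continuousD; [exact: cf|exact: cg]. Qed.

Lemma continuous_mul f g : continuous f -> continuous g ->
  continuous (fun u => f u * g u).
Proof. by move=> cf cg x; apply: continuousM; [exact: cf|exact: cg]. Qed.

Lemma continuous_dominated f g x : continuous g -> g x = 0 ->
  (forall z, `|f z - f x| <= g z) -> {for x, continuous f}.
Proof.
move=> cg gx fg; apply/(@cvgrPdist_lt _ _ _ (nbhs x)) => e e0.
have /(@cvgrPdist_lt _ _ _ (nbhs x))/(_ _ e0) := cg x; apply: filterS => z.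
rewrite gx sub0r normrN => gz; rewrite distrC.
exact: le_lt_trans (fg z) (le_lt_trans (ler_norm _) gz).
Qed.

Lemma continuous_dotp (h k : V -> V) : continuous h -> continuous k ->
  continuous (fun u => dotp (h u) (k u)).
Proof.
move=> ch ck; rewrite /dotp; elim: (index_enum _) => [|i s IH].
  by under eq_fun do rewrite big_nil; exact: cst_continuous.
under eq_fun do rewrite big_cons.
apply: (@continuous_add (fun u => h u ord0 i * k u ord0 i)
  (fun u => \sum_(j <- s) h u ord0 j * k u ord0 j)) => //.
apply: (@continuous_mul (fun u => h u ord0 i) (fun u => k u ord0 i)) => u.
  exact: (continuous_comp (ch u) (@coord_continuous R 1 n ord0 i _)).
exact: (continuous_comp (ck u) (@coord_continuous R 1 n ord0 i _)).
Qed.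

Lemma continuous_enorm : continuous (@enorm R n).
Proof.
move=> u; apply: (@continuous_comp _ _ _ (@sqnorm R n) Num.sqrt).
  by apply: (@continuous_dotp id id) => x; exact: cvg_id.
exact: sqrt_continuous.
Qed.

(** The growth condition of class M together with smoothness, for all iterated
    derivatives at once, so that the class is visibly stable under derivation. *)
Definition tame g := forall s : seq 'I_n, let h := foldr partial g s in
  [/\ exists A : R, forall u, `|h u| <= A * (sqnorm u + 1), continuous h &
      forall i x, derivable h x (delta_mx ord0 i)].

(** A set of functions stable under partial derivatives, whose members are
    continuous and of quadratic growth, consists of tame functions: no induction
    on the order of derivation is needed afterwards. *)
Lemma tame_ind (S : (V -> R) -> Prop) :
  (forall g, S g -> exists A : R, forall u, `|g u| <= A * (sqnorm u + 1)) ->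
  (forall g, S g -> continuous g) ->
  (forall g i, S g -> exists2 h, S h &
     forall x, is_derive x (delta_mx ord0 i) g (h x)) ->
  forall g, S g -> tame g.
Proof.
move=> Sb Sc Sd g Sg s.
have Ss : S (foldr partial g s).
  elim: s => //= i s IH; have [h Sh dh] := Sd _ i IH.
  rewrite (_ : partial i _ = h)//; apply/funext => x.
  by rewrite /partial; have [_] := dh x.
split; [exact: Sb|exact: Sc|move=> i x].
by have [h Sh dh] := Sd _ i Ss; have [] := dh x.
Qed.

Lemma eq_tame f g : f =1 g -> tame f -> tame g.
Proof. by move=> /funext ->. Qed.

Lemma tame_partial g i : tame g -> tame (partial i g).
Proof.
move=> tg s; have := tg (rcons s i); rewrite foldr_rcons; exact.
Qed.

Lemma tameD f g : tame f -> tame g -> tame (fun u => f u + g u).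
Proof.
move=> tf tg; apply: (@tame_ind (fun h => exists f g, [/\ tame f, tame g &
    h = (fun u => f u + g u)])); last by exists f, g.
- move=> _ [{}f [{}g [{}tf {}tg ->]]].
  have [[A hA] _ _] := tf [::]; have [[B hB] _ _] := tg [::].
  exists (A + B) => u; rewrite mulrDl (le_trans (ler_normD _ _))//.
  by apply: lerD; [exact: hA|exact: hB].
- move=> _ [{}f [{}g [{}tf {}tg ->]]] x.
  have [_ /= cf _] := tf [::]; have [_ /= cg _] := tg [::].
  by apply: continuousD; [exact: cf|exact: cg].
- move=> _ i [{}f [{}g [{}tf {}tg ->]]].
  exists (fun u => partial i f u + partial i g u).
    exists (partial i f), (partial i g).
    by split; [exact: tame_partial|exact: tame_partial|].
  move=> x; have [_ _ df] := tf [::]; have [_ _ dg] := tg [::].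
  by apply: is_deriveD; apply: derivableP; [exact: df|exact: dg].
Qed.

(** Directional derivatives are derivatives along a line, which is what the
    one-variable calculus provides. *)
Lemma is_derive_line g x v d :
  is_derive (0 : R) (1 : R) (fun tau : R => g (x + tau *: v)) d ->
  is_derive x v g d.
Proof.
have e : (fun h : R => h^-1 *: (((fun tau : R => g (x + tau *: v)) \o shift 0)
    (h *: (1 : R)) - g (x + (0 : R) *: v))) =
    (fun h : R => h^-1 *: ((g \o shift x) (h *: v) - g x)).
  apply/funext => h /=; rewrite addr0 scale0r addr0.
  by rewrite (_ : h%:A = h); [rewrite (addrC x)|exact: mulr1].
move=> [dg <-]; split.
  by move: dg; rewrite /derivable e.
by rewrite /derive e.
Qed.

Lemma normr_coord_sqnorm u i : `|u ord0 i| <= sqnorm u + 1.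
Proof.
apply: le_trans (normr_coord_le u i) _; rewrite -sqr_enorm.
by have := sqr_ge0 (enorm u - 1); have := enorm_ge0 u; rewrite !expr2; nra.
Qed.

(** Quadratic polynomials in two coordinates, with all lower-order terms: the
    family has to be stable under partial derivatives. *)
Lemma tame_monomial (c p q r : R) (i j : 'I_n) :
  tame (fun u => c + p * u ord0 i + q * u ord0 j + r * (u ord0 i * u ord0 j)).
Proof.
pose Q c p q r (u : V) : R :=
  c + p * u ord0 i + q * u ord0 j + r * (u ord0 i * u ord0 j).
apply: (@tame_ind (fun h => exists c p q r, h = Q c p q r)); last first.
  by exists c, p, q, r.
- move=> _ k [{}c [{}p [{}q [{}r ->]]]].
  pose di : R := (delta_mx ord0 k : V) ord0 i.
  pose dj : R := (delta_mx ord0 k : V) ord0 j.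
  exists (Q (p * di + q * dj) (r * dj) (r * di) 0).
    by exists (p * di + q * dj), (r * dj), (r * di), 0.
  move=> x; apply: is_derive_line.
  rewrite (_ : (fun tau : R => _) = (fun tau : R => c + p * (x ord0 i + tau * di) +
    q * (x ord0 j + tau * dj) + r * ((x ord0 i + tau * di) * (x ord0 j + tau * dj)))).
    apply: is_derive_eq; rewrite /GRing.scale/= /Q; ring.
  apply/funext => tau.
  have E l : (x + tau *: delta_mx ord0 k) ord0 l =
      x ord0 l + tau * (delta_mx ord0 k : V) ord0 l by rewrite !mxE.
  by rewrite /Q !E.
- move=> _ [{}c [{}p [{}q [{}r ->]]]].
  pose e k (u : V) : R := u ord0 k.
  have ci k : continuous (e k) by exact: coord_continuous.
  have cc (a : R) : continuous (fun _ : V => a) by exact: cst_continuous.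
  have cM (a : R) f : continuous f -> continuous (fun u => a * f u).
    by move=> cf; exact: (continuous_mul (cc a) cf).
  exact: (continuous_add (continuous_add (continuous_add (cc c) (cM p _ (ci i)))
    (cM q _ (ci j))) (cM r _ (continuous_mul (ci i) (ci j)))).
- move=> _ [{}c [{}p [{}q [{}r ->]]]].
  exists (`|c| + `|p| + `|q| + `|r|) => u.
  have s0 := sqnorm_ge0 u.
  have rij : `|u ord0 i * u ord0 j| <= sqnorm u + 1.
    rewrite normrM; apply: (@le_trans _ _ (enorm u * enorm u)).
      by apply: ler_pM => //; exact: normr_coord_le.
    by rewrite -expr2 sqr_enorm lerDl.
  rewrite !mulrDl -/(Q _ _ _ _ _).
  apply: (le_trans (ler_normD _ _)); apply: lerD; last first.
    by rewrite normrM ler_wpM2l.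
  apply: (le_trans (ler_normD _ _)); apply: lerD; last first.
    by rewrite normrM ler_wpM2l// normr_coord_sqnorm.
  apply: (le_trans (ler_normD _ _)); apply: lerD; last first.
    by rewrite normrM ler_wpM2l// normr_coord_sqnorm.
  by rewrite ler_peMr// lerDr.
Qed.

Lemma tame_cst (c : R) : tame (fun=> c).
Proof.
apply: (@tame_ind (fun h => exists c, h = (fun=> c))); last by exists c.
- move=> _ [{}c ->]; exists `|c| => u.
  by rewrite ler_peMr// lerDr sqnorm_ge0.
- by move=> _ [{}c ->]; exact: cst_continuous.
- move=> _ i [{}c ->]; exists (fun=> 0); first by exists 0.
  by move=> x; exact: is_derive_cst.
Qed.

Lemma tame_sum (I : Type) (s : seq I) (F : I -> V -> R) :
  (forall i, tame (F i)) -> tame (fun u => \sum_(i <- s) F i u).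
Proof.
move=> tF; elim: s => [|i s IH].
  by apply: (eq_tame _ (tame_cst 0)) => u; rewrite big_nil.
by apply: (eq_tame _ (tameD (tF i) IH)) => u; rewrite big_cons.
Qed.

Lemma tame_dotp (m : V) : tame (dotp m).
Proof.
apply: (@tame_sum _ _ (fun i u => m ord0 i * u ord0 i)) => i.
by apply: (eq_tame _ (@tame_monomial 0 (m ord0 i) 0 0 i i)) => u; ring.
Qed.

Lemma tame_quadratic (c : R) (a : 'M[R]_n) : tame (fun u => c * dotp (u *m a) u).
Proof.
rewrite (_ : (fun u => _) =
  (fun u => \sum_j \sum_k (c * a k j) * (u ord0 k * u ord0 j))).
  apply: tame_sum => j; apply: tame_sum => k.
  by apply: (eq_tame _ (@tame_monomial 0 0 0 (c * a k j) k j)) => u; ring.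
apply/funext => u; rewrite mulr_sumr; apply: eq_bigr => j _.
rewrite mxE mulr_suml mulr_sumr; apply: eq_bigr => k _; ring.
Qed.

End tame.

Section trig.
Context {R : realType}.

(** a cos t + b sin t minus its Taylor polynomial of degree p - 1, for p <= 2: it is
    O(|t|^p), and derivation lowers p by one while exchanging (a, b) with
    (b, - a). *)
Definition trig (p : nat) (a b t : R) : R :=
  a * (cos t - (p != 0%N)%:R) + b * (sin t - (p == 2)%:R * t).

Lemma trig_le p a b t : (p <= 2)%N ->
  `|trig p a b t| <= 2 * (`|a| + `|b|) * `|t| ^+ p.
Proof.
move=> p2; have t0 : 0 <= `|t| by [].
have c1 := normr_cosB1 t; have s1 := normr_sin_le t; have s2 := normr_sinB_id t.
have c2 : `|cos t| <= 1 by rewrite ler_norml cos_geN1 cos_le1.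
have c3 : `|sin t| <= 1 by rewrite ler_norml sin_geN1 sin_le1.
have c4 : `|cos t - 1| <= 2 by rewrite (le_trans (ler_normB _ _))// normr1; lra.
rewrite -(real_normK (num_real t)) in c1 s2.
suff [h1 h2] : `|cos t - (p != 0%N)%:R| <= 2 * `|t| ^+ p /\
    `|sin t - (p == 2)%:R * t| <= 2 * `|t| ^+ p.
  apply: (le_trans (ler_normD _ _)); rewrite !normrM.
  rewrite mulrAC [leRHS]mulrC mulrDl.
  by apply: lerD; rewrite ler_wpM2l.
case: p p2 => [|[|[|//]]] _ /=.
- by rewrite subr0 mul0r subr0 expr0 mulr1; split; lra.
- by rewrite mul0r subr0 expr1; split; [have [|] := leP `|t| 1; nra|lra].
- by rewrite mul1r; split; nra.
Qed.

Lemma is_derive_trig p a b t : (p <= 2)%N ->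
  is_derive t (1 : R) (trig p a b) (trig p.-1 b (- a) t).
Proof.
move=> p2; rewrite /trig.
apply: is_derive_eq; rewrite /GRing.scale/=.
by case: p p2 => [|[|[|//]]] _ /=; ring.
Qed.

Lemma measurable_trig p a b : measurable_fun setT (trig p a b).
Proof.
apply: measurable_funD; apply: measurable_funM => //; apply: measurable_funB => //.
- exact: continuous_measurable_fun (@continuous_cos R).
- exact: continuous_measurable_fun (@continuous_sin R).
Qed.

End trig.

Section small_jumps.
Context {R : realType} {n : nat}.
Local Notation V := 'rV[R]_n.
Variables (rho : {measure set V -> \bar R}) (B : set V).
Hypotheses (mB : measurable B) (B1 : forall y, B y -> enorm y <= 1).
Hypothesis iB : rho.-integrable B (EFin \o @sqnorm R n).

(** For |y| <= 1 this exponent balances the order p of vanishing of [trig]: the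
    product k y * trig p a b (u.y) is O(|y|^2), hence integrable, and of order p
    <= 2 in u. *)
Definition moment_le (p : nat) (C : R) (k : V -> R) : Prop :=
  measurable_fun setT k /\ forall y, B y -> `|k y| <= C * enorm y ^+ (2 - p).

Definition trig_integral (p : nat) (k : V -> R) (a b : R) (u : V) : R :=
  \int[rho]_(y in B) (k y * trig p a b (dotp u y)).

Let M : R := \int[rho]_(y in B) sqnorm y.

(** A derivative in the direction v lowers p and brings down the factor v.y, so the
    balance is preserved; at p = 0 the additional factor |y| is at most 1. *)
Lemma moment_le_dotp p C k (v : V) : (p <= 2)%N -> 0 <= C -> moment_le p C k ->
  moment_le p.-1 (C * enorm v) (fun y => k y * dotp v y).
Proof.
move=> p2 C0 [mk kC]; split.
  by apply: measurable_funM => //; exact: measurable_dotp.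
move=> y By; have e1 := B1 By; have e0 := enorm_ge0 y; have v0 := enorm_ge0 v.
rewrite normrM; apply: (@le_trans _ _ (C * enorm y ^+ (2 - p) * (enorm v * enorm y))).
  by apply: ler_pM => //; [exact: kC|exact: dotp_le_enorm].
rewrite mulrACA ler_wpM2l ?mulr_ge0// -exprSr.
case: p p2 {kC} => [|[|[|//]]] _ //=.
by rewrite exprS ler_piMl ?exprn_ge0.
Qed.

Section bounds.
Variables (p : nat) (C : R) (k : V -> R) (a b : R).
Hypotheses (p2 : (p <= 2)%N) (kC : moment_le p C k).

Let K : R := 2 * (`|a| + `|b|) * C.

Lemma trig_integrand_le u y : B y ->
  `|k y * trig p a b (dotp u y)| <= K * enorm u ^+ p * sqnorm y.
Proof.
move=> By; rewrite normrM.
have e0 := enorm_ge0 y; have u0 := enorm_ge0 u.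
apply: (@le_trans _ _ ((C * enorm y ^+ (2 - p)) *
    (2 * (`|a| + `|b|) * (enorm u * enorm y) ^+ p))).
  apply: ler_pM => //; first exact: kC.2.
  apply: (le_trans (trig_le _ _ _ p2)); rewrite ler_wpM2l ?mulr_ge0//.
  by rewrite lerXn2r ?nnegrE ?mulr_ge0//; exact: dotp_le_enorm.
have e2 : sqnorm y = enorm y ^+ (2 - p) * enorm y ^+ p.
  by rewrite -exprD subnK// sqr_enorm.
rewrite e2 exprMn /K.
rewrite le_eqVlt; apply/orP; left; apply/eqP; ring.
Qed.

Lemma integrable_trig_integrand u :
  rho.-integrable B (EFin \o (fun y => k y * trig p a b (dotp u y))).
Proof.
apply: (le_integrable mB _ _ (integrableZl mB (K * enorm u ^+ p) iB)).
  apply/measurable_EFinP/measurable_funTS/measurable_funM; first exact: kC.1.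
  apply: (measurableT_comp (measurable_trig p a b)); exact: measurable_dotp.
move=> y By /=; rewrite lee_fin (le_trans (trig_integrand_le u By))//.
exact: ler_norm.
Qed.

Lemma trig_integral_le u :
  `|trig_integral p k a b u| <= K * enorm u ^+ p * M.
Proof.
apply: (le_trans (le_normr_Rintegral mB (integrable_trig_integrand u))).
rewrite /M -RintegralZl//; apply: le_Rintegral => //.
- exact: integrable_norm (integrable_trig_integrand u).
- exact: (integrableZl mB _ iB).
- by move=> y By; exact: trig_integrand_le.
Qed.

End bounds.

Lemma is_derive_trig_integral p (C : R) k a b (x v : V) (tau : R) :
  (p <= 2)%N -> 0 <= C -> moment_le p C k ->
  is_derive tau (1 : R) (fun t : R => trig_integral p k a b (x + t *: v))
    (trig_integral p.-1 (fun y => k y * dotp v y) b (- a) (x + tau *: v)).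
Proof.
move=> p2 C0 kC.
have q2 : (p.-1 <= 2)%N by rewrite (leq_trans (leq_pred p)).
have kC' := moment_le_dotp v p2 C0 kC.
have C'0 : 0 <= C * enorm v by rewrite mulr_ge0 ?enorm_ge0.
pose D : R := 2 * (`|b| + `|- a|) * (C * enorm v) *
  (1 + (enorm x + (`|tau| + 1) * enorm v)) .
pose f (t : R) (y : V) : R := k y * trig p a b (dotp (x + t *: v) y).
pose f' (t : R) (y : V) : R :=
  k y * dotp v y * trig p.-1 b (- a) (dotp (x + t *: v) y).
have H1 t : `|t - tau| < 1 -> rho.-integrable B (EFin \o f t).
  by move=> _; exact: (integrable_trig_integrand a b p2 kC _).
have H2 t y : `|t - tau| < 1 -> B y -> is_derive t (1 : R) (f^~ y) (f' t y).
  move=> _ By.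
  have dt : is_derive t (1 : R) (fun t => dotp (x + t *: v) y) (dotp v y).
    under eq_fun do rewrite dotpDl dotpZl.
    by apply: is_derive_eq; rewrite /GRing.scale/=; ring.
  have dc := @is_derive1_comp R (trig p a b) (fun t => dotp (x + t *: v) y)
    t _ _ (is_derive_trig a b _ p2) dt.
  have := is_deriveZ (k y) dc.
  rewrite (_ : f' t y = k y *: (trig p.-1 b (- a) (dotp (x + t *: v) y) * dotp v y)) //.
  by rewrite /f' /GRing.scale/=; ring.
have H3 : rho.-integrable B (EFin \o (fun y => D * sqnorm y)).
  exact: (integrableZl mB D iB).
have H4 t y : `|t - tau| < 1 -> B y -> `|f' t y| <= D * sqnorm y.
  move=> t1 By.
  apply: (le_trans (trig_integrand_le b (- a) q2 kC' _ By)).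
  rewrite ler_wpM2r ?sqnorm_ge0// /D ler_wpM2l//.
    by rewrite mulr_ge0// mulr_ge0// addr_ge0.
  have h : enorm (x + t *: v) <= enorm x + (`|tau| + 1) * enorm v.
    apply: (le_trans (enormD _ _)); rewrite lerD2l enormZ ler_wpM2r ?enorm_ge0//.
    by have := ler_normD (t - tau) tau; rewrite subrK; lra.
  have := enorm_ge0 (x + t *: v).
  case: p p2 {q2 kC kC' f f' H1 H2} => [|[|[|//]]] _ /=; rewrite ?expr0 ?expr1; lra.
exact: (is_derive_Rintegral mB ltr01 H1 H2 H3 H4).
Qed.

(** The mean value theorem along segments, with the bound of the directional
    derivative, gives a local Lipschitz estimate. *)
Lemma continuous_trig_integral p (C : R) k a b : (p <= 2)%N -> 0 <= C ->
  moment_le p C k -> continuous (trig_integral p k a b).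
Proof.
move=> p2 C0 kC x.
have q2 : (p.-1 <= 2)%N by rewrite (leq_trans (leq_pred p)).
have M0 : 0 <= M by apply: Rintegral_ge0 => y _; exact: sqnorm_ge0.
pose L : R := 2 * (`|b| + `|- a|) * C * M.
have L0 : 0 <= L by rewrite !mulr_ge0// addr_ge0.
have lip v : `|trig_integral p k a b (x + v) - trig_integral p k a b x| <=
    L * (1 + enorm x + enorm v) * enorm v.
  pose g (t : R) := trig_integral p k a b (x + t *: v).
  have dg t : is_derive t (1 : R) g _ := is_derive_trig_integral a b x v t p2 C0 kC.
  have cg : {within `[0 : R, 1], continuous g}.
    by apply: derivable_within_continuous => t _; have [] := dg t.
  have [t t01] := @MVT_segment R g _ 0 1 ler01 (fun t _ => dg t) cg.
  rewrite /g scale1r scale0r addr0 subr0 mulr1 => ->.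
  have kC' := moment_le_dotp v p2 C0 kC.
  have C'0 : 0 <= C * enorm v by rewrite mulr_ge0 ?enorm_ge0.
  apply: (le_trans (trig_integral_le b (- a) q2 kC' _)).
  rewrite (_ : _ * M = L * enorm v * enorm (x + t *: v) ^+ p.-1); last by rewrite /L; ring.
  rewrite mulrAC; apply: ler_wpM2r; first exact: enorm_ge0.
  apply: ler_wpM2l => //.
  have h : enorm (x + t *: v) <= enorm x + enorm v.
    apply: (le_trans (enormD _ _)); rewrite lerD2l enormZ ler_piMl ?enorm_ge0//.
    by move: t01; rewrite in_itv/= => /andP[t0 t1]; rewrite ger0_norm.
  have := enorm_ge0 (x + t *: v).
  case: p p2 {q2 kC kC' g dg cg} => [|[|[|//]]] _ /=; rewrite ?expr0 ?expr1; lra.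
pose e (z : V) : R := enorm (z - x).
have ce : continuous e.
  move=> z; apply: (@continuous_comp _ _ _ (fun z : V => z - x) enorm).
    by apply: continuousB; [exact: cvg_id|exact: cst_continuous].
  exact: continuous_enorm.
have cc (c : R) : continuous (fun _ : V => c) by exact: cst_continuous.
apply: (continuous_dominated (continuous_mul (continuous_mul (cc L)
  (continuous_add (cc (1 + enorm x)) ce)) ce)) => [|z].
  by rewrite /e subrr /enorm /sqnorm dotp0l sqrtr0 mulr0.
by have := lip (z - x); rewrite (addrC x) subrK.
Qed.

Lemma tame_trig_integral p C k a b : (p <= 2)%N -> 0 <= C ->
  moment_le p C k -> tame (trig_integral p k a b).
Proof.
move=> p2 C0 kC.
apply: (@tame_ind R n (fun h => exists p C k a b, [/\ (p <= 2)%N, 0 <= C,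
   moment_le p C k & h = trig_integral p k a b])); last by exists p, C, k, a, b.
- move=> _ [{}p [{}C [{}k [{}a [{}b [{}p2 {}C0 {}kC ->]]]]]].
  exists (2 * (`|a| + `|b|) * C * M) => u.
  apply: (le_trans (trig_integral_le a b p2 kC _)).
  have M0 : 0 <= M by apply: Rintegral_ge0 => y _; exact: sqnorm_ge0.
  rewrite mulrAC; apply: ler_wpM2l; first by rewrite !mulr_ge0 ?addr_ge0.
  rewrite -sqr_enorm; have := sqr_ge0 (enorm u - 1); have := enorm_ge0 u.
  by case: p p2 {kC} => [|[|[|//]]] _; rewrite ?expr0 ?expr1 ?expr2; nra.
- move=> _ [{}p [{}C [{}k [{}a [{}b [{}p2 {}C0 {}kC ->]]]]]].
  exact: (continuous_trig_integral p2 C0 kC).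
- move=> _ i [{}p [{}C [{}k [{}a [{}b [{}p2 {}C0 {}kC ->]]]]]].
  pose e : V := delta_mx ord0 i.
  exists (trig_integral p.-1 (fun y => k y * dotp e y) b (- a)).
    exists p.-1, (C * enorm e), (fun y => k y * dotp e y), b, (- a); split=> //.
    + by rewrite (leq_trans (leq_pred p)).
    + by rewrite mulr_ge0 ?enorm_ge0.
    + exact: moment_le_dotp.
  move=> x; apply: is_derive_line.
  have := is_derive_trig_integral a b x e 0 p2 C0 kC.
  by rewrite scale0r addr0.
Qed.

End small_jumps.

(** * Splitting the Levy exponent into small and large jumps *)

Section levy_split.
Context {R : realType} {n : nat}.
Local Notation V := 'rV[R]_n.
Variables (m : V) (a : 'M[R]_n) (rho : {measure set V -> \bar R}).
Hypothesis rho_levy : is_levy_measure rho.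

Let D0 : set V := ~` [set 0].
Let D1 : set V := [set y | 1 < sqnorm y].
Let B : set V := D0 `\` D1.

Let mD1 : measurable D1. Proof. exact: measurable_sqnorm_gt. Qed.
Let mB : measurable B. Proof. by apply: measurableD => //; exact: measurable_setC0. Qed.
Let D1_fin : (rho D1 < +oo)%E. Proof. exact: levy_set_finite. Qed.

Let B_enorm y : B y -> enorm y <= 1.
Proof.
move=> [_ /negP]; rewrite -leNgt -sqr_enorm => h.
by rewrite -(@ler_pXn2r _ 2)// ?nnegrE ?enorm_ge0// expr1n.
Qed.

Let iB : rho.-integrable B (EFin \o @sqnorm R n).
Proof.
have := integrableS measurable_setC0 mB (@subDsetl _ D0 D1)
  (integrable_levy_weight rho_levy).
apply: eq_integrable => // y; rewrite inE => By /=; congr EFin.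
by rewrite min_r// -sqr_enorm expr_le1// ?enorm_ge0// B_enorm.
Qed.

(** The restriction of the Levy measure to |y| > 1, which is finite. *)
Definition big_jumps : {finite_measure set V -> \bar R} := mfrestr mD1 D1_fin.

Definition big_jump_symbol (u : V) : R[i] :=
  cintegral big_jumps setT (fun y => expi (dotp u y)).

Definition small_jump_symbol (u : V) : R[i] :=
  levy_symbol m a rho u - big_jump_symbol u.

Let q (y : V) : R := sqnorm y / (1 + sqnorm y).
Let b : V := \row_j \int[rho]_(y in B) (y ord0 j * q y).

Let q01 y : 0 <= q y <= 1.
Proof.
have s0 := sqnorm_ge0 y; rewrite divr_ge0 ?addr_ge0//= ler_pdivrMr ?ltr_wpDr//.
by rewrite mul1r lerDr.
Qed.

Let mq : measurable_fun setT q.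
Proof.
by apply: measurable_funM; [exact: measurable_sqnorm|exact: measurable_inv1sqnorm].
Qed.

Let q_le y : q y <= sqnorm y.
Proof.
have s0 := sqnorm_ge0 y; rewrite ler_pdivrMr ?ltr_wpDr//.
by rewrite ler_peMr// lerDl.
Qed.

Let ib j : rho.-integrable B (EFin \o (fun y : V => y ord0 j * q y)).
Proof.
apply: (le_integrable mB _ _ iB).
  apply/measurable_EFinP/measurable_funTS/measurable_funM => //.
  exact: measurable_rV_coord.
move=> y By /=; rewrite lee_fin normrM (ger0_norm (sqnorm_ge0 y)).
have /andP[q0 _] := q01 y; rewrite (ger0_norm q0).
rewrite -[leRHS]mul1r; apply: ler_pM => //.
exact: le_trans (normr_coord_le y j) (B_enorm By).
Qed.

Let one_moment : moment_le B 2 1 (fun=> 1 : R).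
Proof. by split=> // y _; rewrite normr1 expr0 mulr1. Qed.

Let int1 c s u := integrable_trig_integrand mB iB c s (leqnn 2) one_moment u.

(** Over |y| > 1 the kernel integrates to the symbol of the large jumps, a constant
    and a linear form. Over |y| <= 1 its real part is cos(u.y) - 1, and its
    imaginary part is sin(u.y) - u.y plus (u.y) |y|^2 / (1 + |y|^2), whose integral is
    linear in u. *)
Lemma small_jump_symbolE u : small_jump_symbol u =
  (- (2^-1) * dotp (u *m a^T) u + trig_integral rho B 2 (fun=> 1) 1 0 u
    + - fine (rho D1)) +i*
  (dotp m u + trig_integral rho B 2 (fun=> 1) 0 1 u
    + (dotp b u + - dotp (levy_drift rho D1) u)).
Proof.
have ik := cintegrable_levy_kernel rho_levy u.
have D01 : D0 = B `|` D1.
  by rewrite /B setUC setDUK//; exact: sqnorm_gt_sub.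
have kE y : levy_kernel u y = (1 * trig 2 1 0 (dotp u y)) +i*
    (1 * trig 2 0 1 (dotp u y) + dotp u y * q y).
  rewrite /levy_kernel /trig /expi /=; simpc; congr Complex.
  have := sqnorm_ge0 y; rewrite /q => s0; field.
  by rewrite gt_eqF// ltr_wpDr.
have -> : small_jump_symbol u = (0 +i* dotp m u) - (2^-1 * dotp (u *m a^T) u)%:C
   + cintegral rho B (levy_kernel u) - (fine (rho D1))%:C
   - (0 +i* dotp u (levy_drift rho D1)).
  rewrite /small_jump_symbol /levy_symbol -/D0 -/(levy_kernel u).
  have -> : cintegral rho D0 (levy_kernel u) =
      cintegral rho B (levy_kernel u) + cintegral rho D1 (levy_kernel u).
    have [ikr iki] := ik.
    have dis : [disjoint B & D1] by apply/disj_setPS => y [[_ h1] h2].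
    rewrite /cintegral D01 !Rintegral_setU// -?D01//.
  rewrite (cintegral_levy_kernel_truncated mD1 D1_fin) /big_jump_symbol /big_jumps; ring.
have -> : cintegral rho B (levy_kernel u) = trig_integral rho B 2 (fun=> 1) 1 0 u +i*
    (trig_integral rho B 2 (fun=> 1) 0 1 u + dotp b u).
  rewrite /cintegral; congr Complex.
    by apply: eq_Rintegral => y _; rewrite kE.
  have [i1 e1] := Rintegral_dotp u mB ib.
  rewrite (dotpC b) /b -e1 /trig_integral -(RintegralD mB (int1 0 1 u) i1).
  by apply: eq_Rintegral => y _; rewrite kE.
by simpc; rewrite (dotpC u); congr Complex; ring.
Qed.

Lemma tame_Re_small_jump : tame (fun u => complex.Re (small_jump_symbol u)).
Proof.
apply: eq_tame (tameD (tameD (tame_quadratic (- 2^-1) a^T)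
  (tame_trig_integral mB B_enorm iB 1 0 (leqnn 2) ler01 one_moment))
  (tame_cst (- fine (rho D1)))) => u.
by rewrite small_jump_symbolE.
Qed.

Lemma tame_Im_small_jump : tame (fun u => complex.Im (small_jump_symbol u)).
Proof.
apply: eq_tame (tameD (tameD (tame_dotp m)
  (tame_trig_integral mB B_enorm iB 0 1 (leqnn 2) ler01 one_moment))
  (tameD (tame_dotp b) (tame_dotp (- levy_drift rho D1)))) => u.
by rewrite small_jump_symbolE dotpNl.
Qed.

(** cos(u.y) - 1 is nonpositive, and so is minus the mass of the large jumps. *)
Lemma Re_small_jump_le u :
  complex.Re (small_jump_symbol u) <= - (2^-1 * dotp (u *m a^T) u).
Proof.
rewrite small_jump_symbolE /= mulNr -addrA gerDl.
have f0 : 0 <= fine (rho D1) by apply: fine_ge0.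
suff : trig_integral rho B 2 (fun=> 1) 1 0 u <= 0 by lra.
rewrite -oppr_ge0 -mulN1r /trig_integral -(RintegralZl (-1) mB (int1 1 0 u)).
apply: Rintegral_ge0 => y _; rewrite /trig /=.
by have := cos_le1 (dotp u y); lra.
Qed.

End levy_split.

Section tame_class.
Context {R : realType} {n : nat}.
Local Notation V := 'rV[R]_n.

Lemma tame_smooth (g : V -> R) : tame g -> smooth g.
Proof. by move=> tg s h; have [_ ? ?] := tg s. Qed.

Lemma partial_multiE (alpha : 'I_n -> nat) :
  exists s, forall g : V -> R, partial_multi alpha g = foldr partial g s.
Proof.
rewrite /partial_multi; elim: (enum 'I_n) => [|i r [s IH]]; first by exists [::].
exists (nseq (alpha i) i ++ s) => g.
by rewrite foldr_cat -IH /=; elim: (alpha i) => //= k ->.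
Qed.

Lemma tame_cpartial_multi (phi : V -> R[i]) (alpha : 'I_n -> nat) :
  tame (fun u => complex.Re (phi u)) -> tame (fun u => complex.Im (phi u)) ->
  exists2 A : R, 0 < A &
    forall u, normc (cpartial_multi alpha phi u) <= A * (sqnorm u + 1).
Proof.
move=> tr ti; have [s sE] := partial_multiE alpha.
have [[A hA] _ _] := tr s; have [[B hB] _ _] := ti s.
exists (`|A| + `|B| + 1) => [|u]; first by rewrite ltr_wpDl// addr_ge0.
have u1 : 0 <= sqnorm u + 1 by rewrite addr_ge0 ?sqnorm_ge0.
apply: (le_trans (normc_le_ReIm _)); rewrite /= !sE !mulrDl mul1r.
apply: (@le_trans _ _ (`|A| * (sqnorm u + 1) + `|B| * (sqnorm u + 1))); last by rewrite lerDl.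
apply: lerD.
  by apply: (le_trans (hA u)); rewrite ler_wpM2r// ler_norm.
by apply: (le_trans (hB u)); rewrite ler_wpM2r// ler_norm.
Qed.

End tame_class.

(** * Bounded measures, and averaging over large jumps *)

Section probability_fourier.
Context d {T : measurableType d} {R : realType}.

Lemma eq_cmeasure_integral (mu nu : {measure set T -> \bar R}) (f : T -> R[i]) :
  (forall A, measurable A -> mu A = nu A) ->
  cintegral mu setT f = cintegral nu setT f.
Proof.
move=> e; rewrite /cintegral /Rintegral.
by congr (fine _ +i* fine _); apply: eq_measure_integral => A mA _; exact: e.
Qed.

Lemma cintegral_null (mu : {measure set T -> \bar R}) (f : T -> R[i]) :
  (forall A, measurable A -> mu A = 0%E) -> cintegral mu setT f = 0.
Proof.
move=> mu0; rewrite (@eq_cmeasure_integral mu mzero)//.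
by rewrite /cintegral /Rintegral !integral_measure_zero.
Qed.

(** For a nonnegative charge the negative Hahn set is null, so the Jordan
    decomposition reduces to the measure itself. *)
Lemma charge_integral_ge0 (nu : {charge set T -> \bar R})
    (mu : {measure set T -> \bar R}) (f : T -> R[i]) :
  (forall A, measurable A -> nu A = mu A) ->
  charge_integral nu f = cintegral mu setT f.
Proof.
move=> numu; have [[mP posP] [mN negN] PN _] := hahn_posnegP nu.
rewrite /charge_integral; set P := hahn_pos nu; set N := hahn_neg nu.
have nuN A : measurable A -> nu (A `&` N) = 0%E.
  move=> mA; apply/eqP; rewrite eq_le; apply/andP; split.
    by apply: negN; [exact: measurableI|exact: subIsetr].
  by rewrite numu//; exact: measurableI.
have -> : cintegral (jordan_neg (hahn_posnegP nu)) setT f = 0.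
  apply: cintegral_null => A mA.
  transitivity (- crestr0 nu mN A)%E; first exact: cjordan_negE.
  by rewrite /crestr0 /= mem_set// /crestr nuN// oppe0.
rewrite subr0; apply: eq_cmeasure_integral => A mA.
transitivity (crestr0 nu mP A); first exact: cjordan_posE.
rewrite /crestr0 /= mem_set// /crestr.
rewrite numu; last exact: measurableI.
apply/eqP; rewrite eq_le; apply/andP; split.
  by apply: le_measure; rewrite ?inE//; exact: measurableI.
have AE : A = (A `&` P) `|` (A `&` N) by rewrite -setIUr PN setIT.
rewrite {1}AE; apply: (le_trans (measureU2 _ _ _)); try exact: measurableI.
have muN : mu (A `&` N) = 0%E by rewrite -numu ?nuN//; exact: measurableI.
suff : (mu (A `&` P) + mu (A `&` N) <= mu (A `&` P))%E by [].
by rewrite muN adde0.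
Qed.

Lemma bm_integral_probability (mu : probability T R) (f : T -> R[i]) :
  bm_integral (bm_of_probability mu) f = cintegral mu setT f.
Proof.
rewrite /bm_integral /= (@charge_integral_ge0 _ mu)//.
by rewrite (@charge_integral_ge0 _ mzero)// (@cintegral_null mzero)// mulr0 addr0.
Qed.

End probability_fourier.

Lemma fourier_law {R : realType} {n : nat} d (T : measurableType d)
    (P : probability T R) (X : {RV P >-> 'rV[R]_n}) (u : 'rV[R]_n) :
  cintegral (law X) setT (plane_wave u) = char_fun X u.
Proof.
have mX : measurable_fun setT X by [].
have me : cmeasurable_fun (plane_wave u).
  by apply: cmeasurable_expi; exact: measurable_dotp.
have iX : cintegrable P setT (plane_wave u \o X).
  have ic : P.-integrable setT (EFin \o (fun=> 1)) by exact: finite_measure_integrable_cst.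
  apply: (cintegrable_le measurableT _ ic).
    exact: cmeasurable_comp me.
  by move=> w _; change (normc (expi (dotp u (X w))) <= 1); rewrite normc_expi.
have -> : cintegral (law X) setT (plane_wave u) = cintegral P setT (plane_wave u \o X) :=
  @cintegral_pushforward _ _ _ _ R X mX P (law X) _ (fun A mA => erefl) me iX.
by apply: eq_cintegral => w _; rewrite /plane_wave dotpC.
Qed.

Section averaging.
Context {R : realType} {n : nat}.
Local Notation V := 'rV[R]_n.
Local Notation leb := (@lebesgue_rV R n).

Lemma lebesgue_rV_gt0 : (0 < leb setT)%E.
Proof.
rewrite lt0e measure_ge0 andbT; apply/eqP => l0.
have /esym := @integral_gauss R n 1 ltr01.
rewrite null_set_integral//; last by apply/measurable_EFinP; exact: measurable_gauss.
move=> /eqP; rewrite eqe expf_eq0 sqrtr_eq0 leNgt divr_gt0 ?pi_gt0// andbF//.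
Qed.

Lemma Linfty_norm_leP (f : V -> R[i]) (M : \bar R) :
  (Linfty_norm f <= M)%E <-> {ae leb, forall x, ((normc (f x))%:E <= M)%E}.
Proof.
rewrite /Linfty_norm unlock /= lebesgue_rV_gt0.
rewrite (_ : abse \o _ = (fun x => (normc (f x))%:E)).
  by split => /ess_supP.
by apply/funext => x /=; rewrite ger0_norm ?normc_ge0.
Qed.

Lemma Linfty_norm_ge0 (f : V -> R[i]) : (0 <= Linfty_norm f)%E.
Proof. exact: Lnorm_ge0. Qed.

Lemma Linfty_bound (f : V -> R[i]) : Linfty f -> exists2 K : R, 0 <= K &
  Linfty_norm f = K%:E /\ {ae leb, forall x, normc (f x) <= K}.
Proof.
move=> [mf foo]; have f0 := Linfty_norm_ge0 f.
have fE : Linfty_norm f = (fine (Linfty_norm f))%:E.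
  by rewrite fineK// ge0_fin_numE.
exists (fine (Linfty_norm f)); first exact: fine_ge0.
split=> //; have /Linfty_norm_leP := lexx (Linfty_norm f).
by apply: filterS => x; rewrite {1}fE lee_fin.
Qed.

Variable mu : {finite_measure set V -> \bar R}.

(** If N is Lebesgue null, Tonelli and translation invariance show that the
    mu-measure of {y | x + y in N} is zero for almost every x. This is what makes
    averaging well defined on classes of functions. *)
Lemma ae_translate (Q : V -> Prop) : {ae leb, forall x, Q x} ->
  {ae leb, forall x, {ae mu, forall y, Q (x + y)}}.
Proof.
move=> [N [mN N0 QN]].
pose F (p : V * V) : \bar R := (\1_N (p.1 + p.2))%:E.
have mI : measurable_fun setT (\1_N : V -> R) by exact: measurable_indic.
have mF : measurable_fun setT F.
  apply/measurable_EFinP; apply: (measurableT_comp mI); exact: measurable_rVD.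
have F0 p : (0 <= F p)%E by rewrite lee_fin.
have FE x : (\int[mu]_y F (x, y) = mu [set y | N (x + y)%R])%E.
  rewrite (_ : (fun y => F (x, y)) = EFin \o \1_[set y | N (x + y)]).
    rewrite integral_indic ?setIT//.
    have := measurable_rVD (measurable_cst x) (@measurable_id _ V setT).
    by move=> /(_ measurableT N mN); rewrite setTI.
  by apply/funext => y /=; rewrite /F !indicE.
have mN' x : measurable [set y | N (x + y)].
  have := measurable_rVD (measurable_cst x) (@measurable_id _ V setT).
  by move=> /(_ measurableT N mN); rewrite setTI.
have I0 : (\int[leb]_x `|\int[mu]_y F (x, y)| = 0)%E.
  under eq_integral do rewrite gee0_abs ?integral_ge0//.
  rewrite (fubini_tonelli F mF F0).
  rewrite integral0_eq// => y _ /=.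
  rewrite (@ge0_integral_translation R n y (fun x => (\1_N x)%:E))//.
    by rewrite integral_indic// setIT.
  exact/measurable_EFinP.
have mG : measurable_fun setT (fun x => \int[mu]_y F (x, y))%E.
  exact: measurable_fun_fubini_tonelli_F.
have /(ae_eq_integral_abs leb measurableT mG) := I0.
apply: filterS => x /(_ I) /= h; exists [set y | N (x + y)]; split=> //.
  by rewrite -FE.
by move=> y /= nQ; apply: QN.
Qed.

Lemma ae_bounded_cintegral (g : V -> R[i]) (K : R) : cmeasurable_fun g -> 0 <= K ->
  {ae mu, forall y, normc (g y) <= K} ->
  cintegrable mu setT g /\ normc (cintegral mu setT g) <= K * fine (mu setT).
Proof.
move=> mg K0 gK.
have mn : measurable_fun setT (fun y => normc (g y)) by exact: measurable_normc.
have iK (h : V -> R) : measurable_fun setT h -> (forall y, `|h y| <= normc (g y)) ->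
    (\int[mu]_y `|(h y)%:E| <= (K * fine (mu setT))%:E)%E.
  move=> mh hg.
  apply: (@le_trans _ _ (\int[mu]_y K%:E)%E); last first.
    by rewrite integral_cst// EFinM fineK// fin_num_measure.
  apply: ae_ge0_le_integral => //.
  - by apply/measurable_EFinP/measurableT_comp.
  - by move: gK; apply: filterS => y gy _; rewrite lee_fin (le_trans (hg y)).
have ih (h : V -> R) : measurable_fun setT h -> (forall y, `|h y| <= normc (g y)) ->
    mu.-integrable setT (EFin \o h).
  move=> mh hg; apply/integrableP; split; first exact/measurable_EFinP.
  exact: le_lt_trans (iK _ mh hg) (ltry _).
have ig : cintegrable mu setT g.
  by split; apply: ih; [exact: mg.1|move=> y; exact: normc_Re|exact: mg.2|
    move=> y; exact: normc_Im].
split=> //; rewrite -lee_fin.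
apply: (le_trans (le_normc_cintegral_ereal measurableT mg ig)).
have := iK _ mn; rewrite (_ : (fun y => `|(normc (g y))%:E|%E) = (fun y => (normc (g y))%:E)).
  by apply=> y; rewrite ger0_norm ?normc_ge0.
by apply/funext => y; rewrite gee0_abs// lee_fin normc_ge0.
Qed.

(** Convolution by the reflection of mu; it commutes with translations, and its
    symbol is the Fourier transform of mu. *)
Definition average (f : V -> R[i]) (x : V) : R[i] :=
  cintegral mu setT (fun y => f (x + y)).

Lemma cmeasurable_average f : cmeasurable_fun f -> cmeasurable_fun (average f).
Proof.
move=> mf; apply: (cmeasurable_cintegral mu (f := fun p : V * V => f (p.1 + p.2))).
apply: cmeasurable_comp mf; exact: measurable_rVD.
Qed.

Let mshift (f : V -> R[i]) (x : V) : cmeasurable_fun f -> cmeasurable_fun (fun y => f (x + y)).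
Proof. by move=> mf; apply: (cmeasurable_comp _ mf); exact: measurable_rVD. Qed.

Lemma ae_average f (K : R) : cmeasurable_fun f -> 0 <= K ->
  {ae leb, forall x, normc (f x) <= K} ->
  {ae leb, forall x, cintegrable mu setT (fun y => f (x + y)) /\
     normc (average f x) <= K * fine (mu setT)}.
Proof.
move=> mf K0 /ae_translate; apply: filterS => x fx.
exact: ae_bounded_cintegral (mshift x mf) K0 fx.
Qed.

Lemma bounded_average : bounded_op average.
Proof.
have mu0 : 0 <= fine (mu setT) by apply: fine_ge0.
split.
- move=> f fL; have [K K0 [fK aeK]] := Linfty_bound fL.
  have [mf _] := fL; split; first exact: cmeasurable_average.
  apply: (@le_lt_trans _ _ (K * fine (mu setT))%:E); last exact: ltry.
  apply/Linfty_norm_leP; have := ae_average mf K0 aeK.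
  by apply: filterS => x [_]; rewrite lee_fin.
- move=> f g [mf _] [mg _] fg.
  have fg' : {ae leb, forall x, f x = g x}.
    by move: fg; apply: filterS => x /(_ I).
  have := ae_translate fg'; apply: filterS => x fgx _.
  rewrite /average /cintegral /Rintegral.
  have [[mfr mfi] [mgr mgi]] := (mshift x mf, mshift x mg).
  congr (fine _ +i* fine _); apply: ae_eq_integral => //; try exact/measurable_EFinP.
    by move: fgx; apply: filterS => y -> _.
  by move: fgx; apply: filterS => y -> _.
- move=> c f g fL gL.
  have [K K0 [_ aeK]] := Linfty_bound fL; have [K' K'0 [_ aeK']] := Linfty_bound gL.
  have := ae_average fL.1 K0 aeK; apply: filterS2 (ae_average gL.1 K'0 aeK').
  move=> x [ig _] [if_ _] _; rewrite /average.
  by rewrite cintegralD ?cintegralZl//; exact: cintegrableZl.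
- exists (fine (mu setT)) => f fL; have [K K0 [fK aeK]] := Linfty_bound fL.
  apply/Linfty_norm_leP; have := ae_average fL.1 K0 aeK.
  by apply: filterS => x [_]; rewrite fK -EFinM lee_fin mulrC.
Qed.

Lemma average_translation : commutes_with_translations average.
Proof.
move=> a f _; apply: nearW => x _ /=; rewrite /average.
by apply: eq_cintegral => y _; rewrite addrAC.
Qed.

Lemma average_symbol :
  is_symbol average (fun u => cintegral mu setT (fun y => expi (dotp u y))).
Proof.
move=> a; apply: nearW => x _ /=; rewrite /average /plane_wave mulrC.
have ie : cintegrable mu setT (fun y : V => expi (dotp a y)).
  have ic : mu.-integrable setT (EFin \o (fun=> 1)) by exact: finite_measure_integrable_cst.
  apply: (cintegrable_le measurableT _ ic).
    by apply: cmeasurable_expi; exact: measurable_dotp.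
  by move=> y _; rewrite normc_expi.
rewrite -(cintegralZl measurableT (expi (dotp a x)) ie).
by apply: eq_cintegral => y _; rewrite dotpDr expiD.
Qed.

End averaging.

Section consequence.
Context {R : realType} {n : nat}.
Local Notation V := 'rV[R]_n.
Local Notation leb := (@lebesgue_rV R n).

(** What the theorem needs of the law of X t is only the factorisation of its
    Fourier transform by a Gaussian and a multiplier of constant 1. *)
Lemma holomorphic_density (nu : probability V R) (s : R) (w : V -> R[i]) :
  0 < s -> heat_bounded s 1 w ->
  (forall u, cintegral nu setT (fun x => expi (dotp u x)) = (gauss s u)%:C * w u) ->
  exists (Phi : V -> R) (F : 'rV[R[i]]_n -> R[i]),
    [/\ is_density nu Phi, holomorphic F,
        forall x, F (cvec x 0) = (Phi x)%:C &
        forall Y, (\int[leb]_x (normc (F (cvec x Y)))%:E <=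
          (expR (sqnorm Y / (4 * s)))%:E)%E].
Proof.
move=> s0 hw nuE; have [mw w1 wI] := hw.
have c0 : 0 < (2 * pi) ^+ n :> R by rewrite exprn_gt0// mulr_gt0// pi_gt0.
have q0 : 0 < ((2 * pi) ^+ n)^-1 :> R by rewrite invr_gt0.
exists (fourier_density s w), (fourier_extension s w); split.
- exact: fourier_densityP s0 hw nuE.
- exact: holomorphic_fourier_extension.
- move=> x; rewrite /fourier_extension re_part_cvec im_part_cvec.
  by rewrite (gauss_fourier_real s0 hw nuE) /fourier_density rmorphM.
- move=> Y.
  under eq_integral => x _.
    rewrite /fourier_extension re_part_cvec im_part_cvec Normc.normcM normc_real.
    rewrite (gtr0_norm q0) EFinM; over.
  rewrite ge0_integralZl//; last first.
  + by rewrite lee_fin invr_ge0 ltW.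
  + by move=> x _; rewrite lee_fin normc_ge0.
  + exact/measurable_EFinP/measurable_normc/cmeasurable_gauss_fourier.
  apply: le_trans (lee_wpmul2l _ (wI Y)) _; first by rewrite lee_fin invr_ge0 ltW.
  by rewrite -EFinM mul1r mulKf// gt_eqF.
Qed.

End consequence.

Theorem theorem2p18 (R : realType) (n : nat)
    (d : measure_display) (T : measurableType d) (P : probability T R)
    (X : R -> {RV P >-> 'rV[R]_n})
    (m : 'rV[R]_n) (a : 'M[R]_n) (rho : {measure set 'rV[R]_n -> \bar R})
    (delta : R)
    (X_levy : levy_process X)
    (a_sym : a^T = a)
    (a_psd : forall u : 'rV[R]_n, 0 <= dotp (u *m a^T) u)
    (rho_levy : is_levy_measure rho)
    (X_char : forall (t : R) (u : 'rV[R]_n), 0 <= t ->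
      char_fun (X t) u = cexp (t%:C * levy_symbol m a rho u))
    (delta_gt0 : 0 < delta)
    (a_ge : forall u : 'rV[R]_n,
      delta * sqnorm u <= 2^-1 * dotp (u *m a^T) u)
    (gamma : R) (gamma_gt0 : 0 < gamma) (gamma_lt : gamma < delta) :
  class_M (- gamma) (fun t => bm_of_probability (law (X t))) /\
  forall eps : R, 0 < eps -> eps < 4 * gamma ->
  forall t : R, 0 < t ->
  exists (Phi : 'rV[R]_n -> R) (F : 'rV[R[i]]_n -> R[i]),
    [/\ is_density (law (X t)) Phi,
        holomorphic F,
        forall x : 'rV[R]_n, F (cvec x 0) = (Phi x)%:C
      & exists C : R, forall Y : 'rV[R]_n,
          (\int[lebesgue_rV n]_(x in setT) (Normc.normc (F (cvec x Y)))%:E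
             <= (C * expR (sqnorm Y / (eps * t)))%:E)%E].
Proof.
split.
  (* phi1 collects the jumps larger than 1, and phi2 is the rest of the exponent. *)
  exists (big_jump_symbol rho_levy), (small_jump_symbol m a rho_levy); split.
  - move=> h u h0; rewrite /fourier bm_integral_probability fourier_law.
    by rewrite X_char ?ltW// /small_jump_symbol addrC subrK.
  - exists (average (big_jumps rho_levy)).
    by split; [exact: bounded_average|exact: average_translation|exact: average_symbol].
  - split; apply: tame_smooth; first exact: tame_Re_small_jump.
    exact: tame_Im_small_jump.
  - move=> alpha; apply: tame_cpartial_multi; first exact: tame_Re_small_jump.
    exact: tame_Im_small_jump.
  - exists 0 => u _; apply: (le_trans (Re_small_jump_le _ _ _ u)).
    rewrite mulNr lerN2; apply: le_trans (a_ge u).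
    by rewrite ler_wpM2r ?sqnorm_ge0// ltW.
move=> eps eps0 epsg t t0.
have s0 : 0 < t * delta by rewrite mulr_gt0.
have hw := heat_multiplier_bounded s0
  (heat_multiplier_levy rho_levy s0 m (ltW t0) a_sym a_ge).
have [|Phi [F [PhiP Fh FPhi FY]]] := holomorphic_density (nu := law (X t)) s0 hw.
  move=> u; rewrite -[LHS]/(cintegral (law (X t)) setT (plane_wave u)).
  rewrite fourier_law X_char ?ltW// /gauss -cexp_real -cexpD; congr cexp.
  by rewrite rmorphN !rmorphM/=; ring.
exists Phi, F; split=> //; exists 1 => Y.
apply: (le_trans (FY Y)); rewrite mul1r lee_fin ler_expR.
rewrite ler_wpM2l ?sqnorm_ge0// lef_pV2 ?posrE ?mulr_gt0//.
rewrite mulrCA mulrC ler_wpM2l ?(ltW t0)//.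
by rewrite (le_trans (ltW epsg))// ler_wpM2l// ltW.
Qed.
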